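(* Let $n$ and $\ell$ be divisible by $4$. There is an algorithm for the $\ell$-weight subset sum problem on $n$ integers whose time and space constraints lie on the curve $T \cdot S^2 = \binom{n}{\ell}$, where $T$ and $S$ are the exponential terms of its time and space usage. The deterministic version of the algorithm takes $\widetilde{O}\left(n^3 \binom{n/4}{\ell/4}^2\right)$ bit operations, and the randomized version is expected to take $\widetilde{O}\left(\ell^{3/2} \binom{n/4}{\ell/4}^2\right)$ bit operations. Both versions have space complexity $\widetilde{O}\left(\binom{n/4}{\ell/4}\right)$.
   Context: The $\ell$-weight (fixed weight) subset sum problem: given positive integers $a_1,\dots,a_n$, a target positive integer $t$ and a weight $\ell$, find a bit vector $\mathbf{x}=(x_1,\dots,x_n)\in\{0,1\}^n$ with exactly $\ell$ entries equal to $1$ such that $\sum_{i=1}^n a_i x_i = t$ over the integers. Instances are considered with an unknown solution (identified with the set $Y\subseteq\{1,\dots,n\}$ of size $\ell$ of indices $i$ with $x_i=1$) that is to be found. Soft-Oh notation: $f$ is $\widetilde{O}(g)$ if there exist $c,N\in\mathbb{N}$ such that $f(n)\le g(n)(\log(3+g(n)))^c$ for all $n\ge N$. Logarithms have base $2$. $T$ and $S$ refer to the exponential term of an algorithm's time and space usage; polynomial factors are ignored when saying that $(T,S)$ lies on a curve such as $T\cdot S^2=\binom{n}{\ell}$.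
   Formalization: The time and space bounds carry an extra factor b, the maximal bit length of the target and the integers, since no bound in n and ℓ alone can hold for integers of arbitrary size; factors polynomial in the input length n·b are ignored for the exponential terms. *)

(* Defs.v *)
From mathcomp Require Import all_boot all_order all_algebra finmap.
From mathcomp Require Import all_classical all_reals all_analysis.

Set Implicit Arguments.
Unset Strict Implicit.
Unset Printing Implicit Defensive.

Import Order.TTheory GRing.Theory Num.Theory.

Local Open Scope nat_scope.

Definition bitsize (k : nat) : nat := (trunc_log 2 k).+1.

(** ** Fixed weight subset sum *)

Record instance : Type := Instance {
  inst_n : nat;
  inst_l : nat;
  inst_t : nat;
  inst_a : inst_n.-tuple nat }.

Definition is_solution (i : instance) (x : (inst_n i).-tuple bool) : Prop :=
  count_mem true x = inst_l i /\
  \sum_(j < inst_n i) tnth (inst_a i) j * tnth x j = inst_t i.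

(* Only instances that do have a solution are considered; several solutions
   are allowed. *)
Definition valid_instance (i : instance) : Prop :=
  [/\ 4 %| inst_n i, 4 %| inst_l i, 0 < inst_t i,
      (forall j, 0 < tnth (inst_a i) j) & exists x, is_solution (i := i) x].

(* Bounds on bit operations and on bits of memory need this as a factor, as no
   bound depending on [inst_n] and [inst_l] only can cover all integers. *)
Definition inst_bits (i : instance) : nat :=
  \max_(k <- inst_t i :: inst_a i) bitsize k.

Definition inst_input (i : instance) : seq nat :=
  [:: inst_n i, inst_l i, inst_t i & inst_a i].

Definition output_solves (i : instance) (out : seq nat) : Prop :=
  exists2 x, is_solution (i := i) x & out = map nat_of_bool x.

(** ** Random access machines with logarithmic cost (Cook-Reckhow), with coin
    tossing, a read-only randomly accessible input and a write-only output *)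

Inductive instr : Type :=
| IConst (r k : nat)
| IAdd (r s u : nat)
| ISub (r s u : nat)   (* truncated subtraction *)
| ILoad (r s : nat)    (* M[r] := M[M[s]] *)
| IStore (r s : nat)   (* M[M[r]] := M[s] *)
| IRead (r s : nat)    (* M[r] := input[M[s]], 0 outside of the input *)
| IFlip (r : nat)
| IWrite (s : nat)
| IJump (q : nat)
| IJumpZ (s q : nat).

Definition program : Type := seq instr.

Definition deterministic (p : program) : bool :=
  all (fun c => if c is IFlip _ then false else true) p.

Definition memory : Type := {fsfun nat -> nat with 0}.

(* The output is stored in reverse order of writing. *)
Record config : Type := Config { pc : nat; mem : memory; rev_out : seq nat }.

Definition output (s : config) : seq nat := rev (rev_out s).

Definition set_reg (s : config) (r v : nat) : config :=
  Config (pc s).+1 [fsfun mem s with r |-> v] (rev_out s).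

Definition exec (input : seq nat) (coin : bool) (c : instr) (s : config)
    : config :=
  let m := mem s in
  match c with
  | IConst r k => set_reg s r k
  | IAdd r a b => set_reg s r (m a + m b)
  | ISub r a b => set_reg s r (m a - m b)
  | ILoad r a => set_reg s r (m (m a))
  | IStore r a => set_reg s (m r) (m a)
  | IRead r a => set_reg s r (nth 0 input (m a))
  | IFlip r => set_reg s r coin
  | IWrite a => Config (pc s).+1 m (m a :: rev_out s)
  | IJump q => Config q m (rev_out s)
  | IJumpZ a q => Config (if m a == 0 then q else (pc s).+1) m (rev_out s)
  end.

(* Bits of the operands, including indirect addresses; the addresses and
   labels that are literally part of the program are constants. *)
Definition instr_cost (input : seq nat) (c : instr) (s : config) : nat :=
  let m := mem s in
  match c with
  | IConst _ k => bitsize k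
  | IAdd _ a b | ISub _ a b => bitsize (m a) + bitsize (m b)
  | ILoad _ a => bitsize (m a) + bitsize (m (m a))
  | IStore r a => bitsize (m r) + bitsize (m a)
  | IRead _ a => bitsize (m a) + bitsize (nth 0 input (m a))
  | IFlip _ | IJump _ => 1
  | IWrite a | IJumpZ a _ => bitsize (m a)
  end.

Definition halted (p : program) (s : config) : bool := size p <= pc s.

Definition step (p : program) (input : seq nat) (coin : bool) (s : config)
    : config :=
  if halted p s then s else exec input coin (nth (IJump 0) p (pc s)) s.

Definition step_cost (p : program) (input : seq nat) (s : config) : nat :=
  if halted p s then 0 else instr_cost input (nth (IJump 0) p (pc s)) s.

(* The [k]-th step may only look at the [k]-th coin. *)
Fixpoint run (p : program) (input : seq nat) (w : nat -> bool) (k : nat)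
    : config :=
  if k is k'.+1 then step p input (w k') (run p input w k')
  else Config 0 [fsfun] [::].

(* Each register in use is charged for its address and its content; a register
   is in use when it is nonzero, so this is the length of a faithful
   description of the memory. *)
Definition mem_bits (m : memory) : nat :=
  \sum_(r <- finsupp m) (bitsize r + bitsize (m r)).

Definition correct_on_halt (p : program) (i : instance) : Prop :=
  forall w k, halted p (run p (inst_input i) w k) ->
    output_solves i (output (run p (inst_input i) w k)).

(** ** Resources *)

Section Resources.
Local Open Scope ring_scope.
Local Open Scope ereal_scope.
Local Open Scope classical_set_scope.
Variable R : realType.

(* Number of bit operations; this is [+oo] exactly when the run does not halt,
   since each executed instruction costs at least 1 and halted ones cost 0. *)
Definition bit_ops (p : program) (i : instance) (w : nat -> bool) : \bar R :=
  \sum_(0 <= k <oo) (step_cost p (inst_input i)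
                       (run p (inst_input i) w k))%:R%:E.

(* For deterministic programs the coins are irrelevant. *)
Definition det_time (p : program) (i : instance) : \bar R :=
  bit_ops p i (fun=> false).

(* Worst case over time and over all coin sequences. *)
Definition space_bits (p : program) (i : instance) : \bar R :=
  ereal_sup [set (mem_bits (mem (run p (inst_input i) wk.1 wk.2)))%:R%:E
            | wk in [set: (nat -> bool) * nat]].

(* Independent fair coins, through their finite-dimensional distributions. *)
Definition fair_coins d (Omega : measurableType d) (P : probability Omega R)
    (coin : nat -> Omega -> bool) : Prop :=
  (forall k, measurable [set w | coin k w]) /\
  (forall (m : nat) (s : nat -> bool),
     P [set w | forall k, (k < m)%N -> coin k w = s k] = ((2 ^- m)%R)%:E).

Definition expected_time d (Omega : measurableType d) (P : probability Omega R)
    (coin : nat -> Omega -> bool) (p : program) (i : instance) : \bar R :=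
  \int[P]_w bit_ops p i (coin^~ w).

Definition log2 (x : R) : R := (ln x / ln 2)%R.

(* [c] and [N] depend neither on the weight nor on the integers of the
   instance, so this bounds the worst case. *)
Definition softO (f : instance -> \bar R) (g : instance -> R) : Prop :=
  exists c N : nat, forall i, valid_instance i -> (N <= inst_n i)%N ->
    f i <= (g i * log2 (3 + g i) ^+ c)%:E.

(* [f] is at most [E] up to a factor polynomial in the input length. *)
Definition exponential_term (f : instance -> \bar R) (E : nat -> nat -> nat)
    : Prop :=
  exists d N : nat, forall i, valid_instance i -> (N <= inst_n i)%N ->
    f i <= ((inst_n i * inst_bits i) ^ d * E (inst_n i) (inst_l i))%:R%:E.

End Resources.

Definition eq_up_to_poly (E F : nat -> nat -> nat) : Prop :=
  exists d N : nat, forall n l, N <= n -> 4 %| n -> 4 %| l -> l <= n ->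
    E n l <= n ^ d * F n l /\ F n l <= n ^ d * E n l.

(* Main.v *)
Require Import Defs.
From mathcomp Require Import all_boot all_order all_algebra finmap.
From mathcomp Require Import all_classical all_reals all_analysis.
From mathcomp Require Import zify lra.

Set Implicit Arguments.
Unset Strict Implicit.
Unset Printing Implicit Defensive.

Import Order.TTheory GRing.Theory Num.Theory.
Local Open Scope nat_scope.

(** The solver cuts the indices into four blocks of [m = n / 4] and looks for a
    solution with [k = l / 4] ones in each block, in the manner of Schroeppel and
    Shamir.  For each block it lists the [N = 'C(m, k)] sums of its [k]-subsets.
    A tournament tree over the first list enumerates the sums of the first two
    blocks in increasing order while storing one candidate per element of that
    list; a second tree does the same, in decreasing order, for the last two.
    Advancing whichever of the two enumerations is behind, one meets every pair
    that adds up to [t] after [2 * N ^ 2] steps of logarithmic cost, in the space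
    of a few lists of length [N] ([attempt], [wp_attempt]).

    Such an attempt only works if the solution is balanced over the blocks, so
    the arrangement of the indices has to be varied, and trying all shifts would
    cost a power of [n].  The way out is to arrange the indices by residues
    modulo some [q].  If the ones of the solution are pairwise incongruent
    modulo [q], a run of indices with constant stride [q] contains at most one
    of them.  A window of half the length which slides from the start of one run
    to the start of the next therefore changes its number of ones by at most one,
    and by a discrete intermediate value argument it contains exactly half of
    them in one of these [O(q)] positions ([even_split]).  Cutting into halves,
    and each half again into halves, costs [O(q ^ 3)] attempts.

    A suitable [q] is small: the product of the differences of [z] indices
    below [n] is at most [n ^ (z ^ 2)], hence not divisible by all the numbers
    up to [2 * r] once [2 ^ r] exceeds that, because ['C(2 * r, r)] divides all
    their common multiples ([separating_modulus]).  One may separate the zeros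
    of the solution instead of its ones, so [z] is the smaller of [l] and
    [n - l], and that is at most a constant times the logarithm of [N]
    ([modulus_bound_le]).  As [log n] is of this size too, trying [q = 1, 2, ...]
    until a solution appears repeats the attempt only polylogarithmically many
    times in [N], which a soft-Oh absorbs.  The case [l = n] is treated apart:
    there [N = 1] and the solution merely has to be printed, in time [l] up to
    the length of the integers, and both [n ^ 3] and [l ^ (3 / 2)] allow for
    that.  A deterministic machine tosses no coins and its expected time is its
    time, so one program serves as both versions.

    The solver is written in a small imperative language.  Its correctness,
    running time and range of addresses are established by weakest
    preconditions, and a compiler into the machine, proved correct by a forward
    simulation ([sim]), turns them into bit operations and bits of memory
    ([machine_run]).

    The curve itself says that [N ^ 4] is ['C(n, l)] up to a polynomial in [n].
    It comes from applying twice the estimates ['C(a, b) ^ 2 <= 'C(2 a, 2 b)] and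
    ['C(2 a, 2 b) <= (2 b + 1) 'C(a, b) ^ 2] that Vandermonde's identity and
    log-concavity give. *)

(** * A small imperative language *)

(** Scalar variables, arrays and input cells; arrays are named by numbers. *)
Inductive exp : Type :=
| EV (x : nat)
| EC (c : nat)
| EAdd (a b : exp)
| ESub (a b : exp)
| ELd (al : nat) (e : exp)
| EIn (e : exp).

Inductive cmd : Type :=
| CAsg (x : nat) (e : exp)
| CSto (al : nat) (ei ev : exp)
| CWr (e : exp)
| CHalt
| CSkip
| CSeq (c d : cmd)
| CIf (e : exp) (c d : cmd)
| CWhile (e : exp) (c : cmd).

(** The counter [tm] is the number of commands and tests executed so far. *)
Record st := St { sc : nat -> nat; ar : nat -> nat -> nat; out : seq nat; tm : nat }.

(** With [eqn] instead of [==], simplification decides the comparison of two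
    concrete variables. *)
Definition upd {A} (f : nat -> A) (x : nat) (v : A) : nat -> A :=
  fun y => if eqn y x then v else f y.

Arguments upd {A} f x v y /.

Fixpoint ev (inp : seq nat) (s : st) (e : exp) : nat :=
  match e with
  | EV x => sc s x
  | EC c => c
  | EAdd a b => ev inp s a + ev inp s b
  | ESub a b => ev inp s a - ev inp s b
  | ELd al e => ar s al (ev inp s e)
  | EIn e => nth 0 inp (ev inp s e)
  end.

Definition tick s := St (sc s) (ar s) (out s) (tm s).+1.
Definition asg s x v := St (upd (sc s) x v) (ar s) (out s) (tm s).+1.
Definition sto s al i v :=
  St (sc s) (upd (ar s) al (upd (ar s al) i v)) (out s) (tm s).+1.
Definition wri s v := St (sc s) (ar s) (v :: out s) (tm s).+1.

Section Semantics.
Variables (inp : seq nat) (V Lam : nat).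

(** The boolean tells whether [CHalt] has been reached.  Only values below [V] may
    be stored, and only at indices below [Lam], so an execution also certifies
    the size of the memory that it needs; overflow has no execution. *)
Inductive runs : cmd -> st -> bool -> st -> Prop :=
| ExAsg x e s : ev inp s e < V -> runs (CAsg x e) s false (asg s x (ev inp s e))
| ExSto al ei e s : ev inp s ei < Lam -> ev inp s e < V ->
    runs (CSto al ei e) s false (sto s al (ev inp s ei) (ev inp s e))
| ExWr e s : runs (CWr e) s false (wri s (ev inp s e))
| ExHalt s : runs CHalt s true (tick s)
| ExSkip s : runs CSkip s false s
| ExSeqH c d s s' : runs c s true s' -> runs (CSeq c d) s true s'
| ExSeq c d s s' o s'' : runs c s false s' -> runs d s' o s'' ->
    runs (CSeq c d) s o s''
| ExIfT e c d s o s' : ev inp s e != 0 -> runs c (tick s) o s' ->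
    runs (CIf e c d) s o s'
| ExIfF e c d s o s' : ev inp s e = 0 -> runs d (tick s) o s' ->
    runs (CIf e c d) s o s'
| ExWhF e c s : ev inp s e = 0 -> runs (CWhile e c) s false (tick s)
| ExWhH e c s s' : ev inp s e != 0 -> runs c (tick s) true s' ->
    runs (CWhile e c) s true s'
| ExWhT e c s s' o s'' : ev inp s e != 0 -> runs c (tick s) false s' ->
    runs (CWhile e c) s' o s'' -> runs (CWhile e c) s o s''.

Variable H : st -> Prop.

(** Total correctness with two exits: [H] is required where the program halts and
    [Q] where the control falls through. *)
Definition wp (c : cmd) (Q : st -> Prop) (s : st) : Prop :=
  exists o s', runs c s o s' /\ if o then H s' else Q s'.

Lemma wp_mono c (Q Q' : st -> Prop) s :
  wp c Q s -> (forall s', Q s' -> Q' s') -> wp c Q' s.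
Proof. by move=> [[] [s' [E P]]] I; [exists true|exists false]; exists s'; split=> //; apply: I. Qed.

Lemma wp_asg x e (Q : st -> Prop) s :
  ev inp s e < V -> Q (asg s x (ev inp s e)) -> wp (CAsg x e) Q s.
Proof. by move=> h q; exists false, (asg s x (ev inp s e)); split=> //; constructor. Qed.

Lemma wp_sto al ei e (Q : st -> Prop) s :
  ev inp s ei < Lam -> ev inp s e < V ->
  Q (sto s al (ev inp s ei) (ev inp s e)) -> wp (CSto al ei e) Q s.
Proof.
by move=> h h' q; exists false, (sto s al (ev inp s ei) (ev inp s e)); split=> //; constructor.
Qed.

Lemma wp_wr e (Q : st -> Prop) s : Q (wri s (ev inp s e)) -> wp (CWr e) Q s.
Proof. by move=> q; exists false, (wri s (ev inp s e)); split=> //; constructor. Qed.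

Lemma wp_halt (Q : st -> Prop) s : H (tick s) -> wp CHalt Q s.
Proof. by move=> q; exists true, (tick s); split=> //; constructor. Qed.

Lemma wp_skip (Q : st -> Prop) s : Q s -> wp CSkip Q s.
Proof. by move=> q; exists false, s; split=> //; constructor. Qed.

Lemma wp_seq c d (Q : st -> Prop) s : wp c (wp d Q) s -> wp (CSeq c d) Q s.
Proof.
move=> [[] [s' [E P]]].
  by exists true, s'; split=> //; constructor.
case: P => o [s'' [E' P']]; exists o, s''; split=> //.
exact: ExSeq E E'.
Qed.

Lemma wp_if e c d (Q : st -> Prop) s :
  (ev inp s e != 0 -> wp c Q (tick s)) -> (ev inp s e = 0 -> wp d Q (tick s)) ->
  wp (CIf e c d) Q s.
Proof.
case: (eqVneq (ev inp s e) 0) => [z _ /(_ z)|nz /(_ isT) + _].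
  by move=> [h [s' [E P]]]; exists h, s'; split=> //; apply: ExIfF.
by move=> [h [s' [E P]]]; exists h, s'; split=> //; apply: ExIfT.
Qed.

Lemma wp_while (I : st -> Prop) (f : st -> nat) e c (Q : st -> Prop) s :
  I s ->
  (forall s, I s -> ev inp s e = 0 -> Q (tick s)) ->
  (forall s, I s -> ev inp s e != 0 ->
     wp c (fun s' => I s' /\ f s' < f s) (tick s)) ->
  wp (CWhile e c) Q s.
Proof.
move=> Is IQ IS; move: Is; have [k] := ubnP (f s).
elim: k s => // k IH s fs Is.
case: (eqVneq (ev inp s e) 0) => [z|nz].
  by exists false, (tick s); split; [apply: ExWhF|apply: IQ].
case: (IS _ Is nz) => [[] [s' [E P]]].
  by exists true, s'; split=> //; apply: ExWhH.
case: P => Is' lt.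
have [|o [s'' [E' P']]] := IH s' _ Is'; first by lia.
by exists o, s''; split=> //; apply: ExWhT E'.
Qed.

End Semantics.

Notation "c1 ;; c2" := (CSeq c1 c2) (at level 60, right associativity).
Notation "x ::= e" := (CAsg x e) (at level 55).
Declare Scope exp_scope.
Delimit Scope exp_scope with X.
Bind Scope exp_scope with exp.
Arguments CAsg x%_nat e%_X.
Arguments CSto al%_nat ei%_X ev%_X.
Arguments CWr e%_X.
Arguments CIf e%_X c d.
Arguments CWhile e%_X c.
Arguments ELd al%_nat e%_X.
Arguments EIn e%_X.
Notation "a + b" := (EAdd a b) : exp_scope.
Notation "a - b" := (ESub a b) : exp_scope.
Notation "$ x" := (EV x) (at level 1, x at level 0, format "$ x").

(** A frame condition.  Variables are numbered so that a piece of code only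
    writes to those from some [x] on and to the arrays in some [A]. *)
Definition keep (x : nat) (A : seq nat) (s s' : st) : Prop :=
  [/\ forall y, y < x -> sc s' y = sc s y,
      forall b, b \notin A -> ar s' b = ar s b & out s' = out s].

Lemma keepS x A s s' : keep x A s s' -> forall y, y < x -> sc s' y = sc s y.
Proof. by case. Qed.

Lemma keepA x A s s' : keep x A s s' -> forall b, b \notin A -> ar s' b = ar s b.
Proof. by case. Qed.

Lemma keepO x A s s' : keep x A s s' -> out s' = out s.
Proof. by case. Qed.

Arguments keepS {x A s s'} K y _.
Arguments keepA {x A s s'} K b _.

Lemma keep_trans x A s1 s2 s3 : keep x A s1 s2 -> keep x A s2 s3 -> keep x A s1 s3.
Proof.
move=> [a1 b1 c1] [a2 b2 c2]; split.
- by move=> y h; rewrite a2 ?a1.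
- by move=> y h; rewrite b2 ?b1.
- by rewrite c2 c1.
Qed.

Lemma keep_weak x A x' A' s s' :
  keep x A s s' -> x' <= x -> all (mem A') A -> keep x' A' s s'.
Proof.
move=> [k1 k2 k3] hx /allP hA; split=> // y hy; first by apply: k1; lia.
by apply: k2; apply: contra hy => /hA.
Qed.

Lemma keep_weak_trans x A x' A' s1 s2 s3 : keep x' A' s1 s2 -> keep x A s2 s3 ->
  x' <= x -> all (mem A') A -> keep x' A' s1 s3.
Proof. by move=> h1 h2 hx hA; apply: keep_trans h1 (keep_weak h2 hx hA). Qed.

Lemma keep_tick x A s s' : keep x A s s' -> keep x A s (tick s').
Proof. by []. Qed.

Lemma keep_asg x A s s' y v : keep x A s s' -> x <= y -> keep x A s (asg s' y v).
Proof.
move=> [k1 k2 k3] h; split=> //= z hz; rewrite /= /upd -[eqn z y]/(z == y).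
by case: eqP => [?|_]; [lia|apply: k1].
Qed.

Lemma keep_sto x A s s' al i v : keep x A s s' -> al \in A -> keep x A s (sto s' al i v).
Proof.
move=> [k1 k2 k3] h; split=> //= z hz; rewrite /upd -[eqn z al]/(z == al).
by case: eqP hz => [->|_ /k2 //]; rewrite h.
Qed.

(** For a loop whose number of turns is known in advance: the invariant depends on
    the turn, and the guard has to agree with the counter. *)
Lemma wp_for inp V Lam H (b i0 : nat) (J : nat -> st -> Prop) e c (Q : st -> Prop) s :
  i0 <= b -> J i0 s ->
  (forall i s', i <= b -> J i s' -> (ev inp s' e != 0) = (i < b)) ->
  (forall i s', i0 <= i < b -> J i s' -> wp inp V Lam H c (J i.+1) (tick s')) ->
  (forall s', J b s' -> Q (tick s')) ->
  wp inp V Lam H (CWhile e c) Q s.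
Proof.
move=> breaks Ji hc hb hQ.
have [d] := ubnP (b - i0).
elim: d i0 s breaks Ji hb => // d IH i0 s breaks Ji hb lt.
have E := hc _ _ breaks Ji.
case: (ltngtP i0 b) => h; [|by lia|].
- rewrite h in E.
  have [[] [s' [X P]]] := hb i0 s ltac:(lia) Ji; first by exists true, s'; split=> //; apply: ExWhH.
  have lt' : b - i0.+1 < d by move: lt h; clear; lia.
  have hb' i s1 : i0.+1 <= i < b -> J i s1 -> wp inp V Lam H c (J i.+1) (tick s1).
    by move=> hi; apply: hb; move: hi; clear; lia.
  have [h' [s'' [X' P']]] := IH i0.+1 s' h P hb' lt'.
  by exists h', s''; split=> //; apply: ExWhT X'.
- exists false, (tick s); split; last by apply: hQ; rewrite -h.
  by apply: ExWhF; apply/eqP; move: E; rewrite h ltnn => /negbFE.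
Qed.

(** * Compilation into the machine *)

(** Registers below 16 hold intermediate results, the next 32 the scalar
    variables, and from 48 on the 16 arrays are interleaved, so that no array
    needs a length.  The address of a cell is [48 + al + 16 * i], and four
    doublings multiply the index by 16. *)
Definition caddr (al d : nat) : seq instr :=
  [:: IAdd d d d; IAdd d d d; IAdd d d d; IAdd d d d;
      IConst d.+1 (48 + al); IAdd d d d.+1].

Fixpoint cexp (e : exp) (d : nat) : seq instr :=
  match e with
  | EV x => [:: IConst d 0; IAdd d (16 + x) d]
  | EC c => [:: IConst d c]
  | EAdd a b => cexp a d ++ cexp b d.+1 ++ [:: IAdd d d d.+1]
  | ESub a b => cexp a d ++ cexp b d.+1 ++ [:: ISub d d d.+1]
  | ELd al e => cexp e d ++ caddr al d ++ [:: ILoad d d]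
  | EIn e => cexp e d ++ [:: IRead d d]
  end.

Definition casg x e := cexp e 0 ++ [:: IConst 1 0; IAdd (16 + x) 0 1].
Definition csto al ei e := cexp ei 0 ++ caddr al 0 ++ cexp e 1 ++ [:: IStore 0 1].

Fixpoint csize (c : cmd) : nat :=
  match c with
  | CAsg x e => size (casg x e)
  | CSto al ei e => size (csto al ei e)
  | CWr e => (size (cexp e 0)).+1
  | CHalt => 1
  | CSkip => 0
  | CSeq c d => csize c + csize d
  | CIf e c d => (size (cexp e 0)).+2 + csize c + csize d
  | CWhile e c => (size (cexp e 0)).+2 + csize c
  end.

(** [a] is the address of the first instruction and [fin] that of the end of the
    whole program, the target of [CHalt]. *)
Fixpoint comp (fin a : nat) (c : cmd) : seq instr :=
  match c with
  | CAsg x e => casg x e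
  | CSto al ei e => csto al ei e
  | CWr e => cexp e 0 ++ [:: IWrite 0]
  | CHalt => [:: IJump fin]
  | CSkip => [::]
  | CSeq c d => comp fin a c ++ comp fin (a + csize c) d
  | CIf e c d =>
      let a1 := a + (size (cexp e 0)).+1 in
      let a2 := a1 + (csize c).+1 in
      cexp e 0 ++ [:: IJumpZ 0 a2] ++ comp fin a1 c ++
        [:: IJump (a2 + csize d)] ++ comp fin a2 d
  | CWhile e c =>
      let a1 := a + (size (cexp e 0)).+1 in
      cexp e 0 ++ [:: IJumpZ 0 (a1 + (csize c).+1)] ++ comp fin a1 c ++
        [:: IJump a]
  end.

Lemma size_comp fin a c : size (comp fin a c) = csize c.
Proof.
elim: c a => //= [e|c IHc d IHd|e c IHc d IHd|e c IHc] a;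
  rewrite ?size_cat /= ?size_cat /= ?IHc ?IHd //; lia.
Qed.

Definition noflip (c : instr) := if c is IFlip _ then false else true.

Lemma noflip_cexp e d : all noflip (cexp e d).
Proof.
by elim: e d => //= [a IHa b IHb|a IHa b IHb|al e IH|e IH] d;
   rewrite !all_cat ?IHa ?IHb ?IH.
Qed.

Lemma deterministic_comp fin a c : deterministic (comp fin a c).
Proof.
rewrite /deterministic; elim: c a => //= [x e|al ei e|e|c IHc d IHd|e c IHc d IHd|e c IHc] a;
  rewrite ?/casg ?/csto ?all_cat /= ?all_cat /= ?IHc ?IHd ?noflip_cexp //.
Qed.

(** By what factor an expression may exceed the bound on all stored values. *)
Fixpoint growth (e : exp) : nat :=
  match e with
  | EV _ | ELd _ _ | EIn _ => 1
  | EC c => c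
  | EAdd a b => growth a + growth b
  | ESub a b => growth a
  end.

(** The nesting must not exceed the 16 registers for intermediate results, and the
    growth has to be bounded for intermediate results, too, to be [O(V)]. *)
Fixpoint fits_exp (e : exp) (d : nat) : bool :=
  (d < 15) && (growth e <= 31) &&
  match e with
  | EV x => x < 32
  | EC c => true
  | EAdd a b | ESub a b => fits_exp a d && fits_exp b d.+1
  | ELd al e => fits_exp e d && (al < 16)
  | EIn e => fits_exp e d
  end.

(** An upper bound on the number of instructions for one unit of [tm]. *)
Definition cmd_steps := 200.
Fixpoint fits (c : cmd) : bool :=
  match c with
  | CAsg x e => [&& x < 32, fits_exp e 0 & size (casg x e) <= cmd_steps]
  | CSto al ei e => [&& al < 16, fits_exp ei 0, fits_exp e 1 & size (csto al ei e) <= cmd_steps]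
  | CWr e => fits_exp e 0 && ((size (cexp e 0)).+1 <= cmd_steps)
  | CHalt | CSkip => true
  | CSeq c d => fits c && fits d
  | CIf e c d => [&& fits_exp e 0, (size (cexp e 0)).+2 <= cmd_steps, fits c & fits d]
  | CWhile e c => [&& fits_exp e 0, (size (cexp e 0)).+2 <= cmd_steps & fits c]
  end.

Section Sim.
Variables (inp : seq nat) (V Lam : nat).
Hypothesis Vpos : 0 < V.
Hypothesis inpV : forall i, nth 0 inp i < V.

(** [1024] leaves room for the address of a cell whose index is at most [31 * V]. *)
Definition val_bound := 1024 * V.
Definition addr_bound := 48 + 16 * Lam.

Definition bnded (m : memory) : Prop :=
  (forall r, m r < val_bound) /\ (forall r, addr_bound <= r -> m r = 0).

Definition represents (m : memory) (s : st) : Prop :=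
  [/\ forall x, x < 32 -> m (16 + x) = sc s x /\ sc s x < V,
      forall al i, al < 16 -> m (48 + al + 16 * i) = ar s al i /\ ar s al i < V
    & bnded m].

(** Straight-line code changes only the memory, so it can be run without regard to
    the program counter. *)
Definition mem_after (c : instr) (m : memory) : memory :=
  Defs.mem (exec inp false c (Config 0 m [::])).
Fixpoint straight (cs : seq instr) (m : memory) : memory :=
  if cs is c :: cs then straight cs (mem_after c m) else m.
Fixpoint bnded_along (cs : seq instr) (m : memory) : Prop :=
  bnded m /\ if cs is c :: cs then bnded_along cs (mem_after c m) else True.

Lemma straight_cat cs ds m : straight (cs ++ ds) m = straight ds (straight cs m).
Proof. by elim: cs m => //=. Qed.

Lemma bnded_along_cat cs ds m : bnded_along cs m -> bnded_along ds (straight cs m) -> bnded_along (cs ++ ds) m.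
Proof.
elim: cs m => [|c cs IH] m /=; first by case.
by move=> [b p] p'; split=> //; apply: IH.
Qed.

(** The evaluation of an expression into register [d] spares the partial results
    below [d] as well as variables and arrays. *)
Definition hold (d : nat) (m m' : memory) : Prop :=
  forall r, (r < d) || (15 < r) -> m' r = m r.

Lemma bnded_set m r v : bnded m -> r < addr_bound -> v < val_bound -> bnded [fsfun m with r |-> v].
Proof.
move=> [b1 b2] hr hv; split=> x; rewrite fsfun_withE; case: eqP => [xr|_] //.
  by move=> h; exfalso; move: h; rewrite xr; lia.
exact: b2.
Qed.

Lemma represents_hold m s m' : represents m s -> hold 0 m m' -> bnded m' -> represents m' s.
Proof.
move=> [r1 r2 r3] h b; split=> // [x hx|al i ha]; rewrite h.
- exact: r1.
- by apply/orP; right; lia.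
- exact: r2.
- by apply/orP; right; lia.
Qed.

Lemma hold_weak d d' m m' : d' <= d -> hold d m m' -> hold d' m m'.
Proof. by move=> le h r hr; apply: h; lia. Qed.

Lemma hold_trans d m1 m2 m3 : hold d m1 m2 -> hold d m2 m3 -> hold d m1 m3.
Proof. by move=> h1 h2 r hr; rewrite h2 ?h1. Qed.

Lemma hold_set d m m' r v : hold d m m' -> d <= r < 16 -> hold d m [fsfun m' with r |-> v].
Proof.
by move=> h hr x hx; rewrite fsfun_withE; case: eqP => [?|_]; [lia|apply: h].
Qed.

Lemma ev_growth e d m s : fits_exp e d -> represents m s -> ev inp s e <= growth e * V.
Proof.
move=> + [r1 r2 r3].
elim: e d => [x|c|a IHa b IHb|a IHa b IHb|al e IH|e IH] d /=.
- by case/andP=> _ hx; have := r1 _ hx; lia.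
- by move=> _; rewrite leq_pmulr.
- by case/and3P=> _ /IHa ha /IHb hb; rewrite mulnDl leq_add.
- by case/and3P=> _ /IHa ha _; apply: leq_trans ha; rewrite leq_subr.
- by case/and3P=> _ _ h; have := r2 _ (ev inp s e) h; lia.
- by move=> _; have := inpV (ev inp s e); lia.
Qed.

Lemma ev_VB e d m s : fits_exp e d -> represents m s -> ev inp s e <= 31 * V.
Proof.
move=> o r; apply: leq_trans (ev_growth o r) _; rewrite leq_mul2r.
by apply/orP; right; case: e o => [x|c|a b|a b|al e|e] /= /andP[/andP[_ ?] _].
Qed.

Lemma caddr_ok al d m v : al < 16 -> d < 15 -> bnded m -> m d = v -> v <= 31 * V ->
  let m' := straight (caddr al d) m in
  [/\ m' d = 48 + al + 16 * v, hold d m m', bnded m' & bnded_along (caddr al d) m].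
Proof.
move=> hal hd b md hv.
have hb (m0 : memory) x w : bnded m0 -> x < 16 -> w < val_bound -> bnded [fsfun m0 with x |-> w].
  by move=> ? ? ?; apply: bnded_set => //; rewrite /addr_bound; lia.
rewrite /caddr /= /mem_after /= !fsfun_withE !eqxx md.
have -> : (d == d.+1) = false by lia.
rewrite /val_bound in hb *.
set v1 := v + v; have ev1 : v1 = v + v by []; set m1 := [fsfun m with d |-> v1].
have b1 : bnded m1 by apply: hb => //; lia.
set v2 := v1 + v1; have ev2 : v2 = v1 + v1 by []; set m2 := [fsfun m1 with d |-> v2].
have b2 : bnded m2 by apply: hb => //; lia.
set v3 := v2 + v2; have ev3 : v3 = v2 + v2 by []; set m3 := [fsfun m2 with d |-> v3].
have b3 : bnded m3 by apply: hb => //; lia.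
set v4 := v3 + v3; have ev4 : v4 = v3 + v3 by []; set m4 := [fsfun m3 with d |-> v4].
have b4 : bnded m4 by apply: hb => //; lia.
set m5 := [fsfun m4 with d.+1 |-> 48 + al].
have b5 : bnded m5 by apply: hb => //; lia.
set m6 := [fsfun m5 with d |-> v4 + (48 + al)].
have b6 : bnded m6 by apply: hb => //; lia.
split=> //; first lia.
by rewrite /m6 /m5 /m4 /m3 /m2 /m1; do !apply: hold_set; (try lia) => r.
Qed.

Lemma cexp_ok e d m s : fits_exp e d -> represents m s ->
  let m' := straight (cexp e d) m in
  [/\ m' d = ev inp s e, hold d m m', bnded m' & bnded_along (cexp e d) m].
Proof.
elim: e d m => [x|c|a IHa b IHb|a IHa b IHb|al e IH|e IH] d m o R.
- case: (R) => r1 r2 r3; move: o => /= /andP[/andP[d15 _] hx].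
  have [mx lx] := r1 _ hx.
  have b1 : bnded [fsfun m with d |-> 0].
    by apply: bnded_set => //; rewrite /val_bound /addr_bound; lia.
  rewrite /= /mem_after /= !fsfun_withE !eqxx.
  have -> : (16 + x == d) = false by lia.
  rewrite mx addn0.
  have b2 : bnded [fsfun [fsfun m with d |-> 0] with d |-> sc s x].
    by apply: bnded_set => //; rewrite /val_bound /addr_bound; lia.
  split=> //.
  by do !apply: hold_set; (try lia) => r.
- case: (R) => r1 r2 r3; move: (ev_VB o R); move: o => /= /andP[/andP[d15 _] _] hc.
  have b1 : bnded [fsfun m with d |-> c].
    by apply: bnded_set => //; rewrite /val_bound /addr_bound; lia.
  rewrite /= /mem_after /= !fsfun_withE !eqxx; split=> //.
  by apply: hold_set; (try lia) => r.
- have := ev_VB o R; move: o => /= /and3P[/andP[d15 _] oa ob] hv.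
  rewrite straight_cat straight_cat.
  have [ma ha ba pa] := IHa d m oa R.
  have Ra := represents_hold R (hold_weak (leq0n _) ha) ba.
  have [mb hb bb pb_] := IHb _ _ ob Ra.
  set m1 := straight (cexp a d) m in ma ha ba pa Ra mb hb bb pb_ *.
  set m2 := straight (cexp b d.+1) m1 in mb hb bb pb_ *.
  have m2d : m2 d = ev inp s a by rewrite hb //; apply/orP; left.
  rewrite /= /mem_after /= !fsfun_withE !eqxx m2d mb.
  have b3 : bnded [fsfun m2 with d |-> ev inp s a + ev inp s b].
    by apply: bnded_set => //; rewrite /val_bound /addr_bound; lia.
  split=> //.
    apply: hold_set; last lia.
    exact: hold_trans ha (hold_weak _ hb).
  apply: bnded_along_cat => //; apply: bnded_along_cat => //.
  by rewrite /= /mem_after /= -/m1 -/m2 m2d mb.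
- have := ev_VB o R; move: o => /= /and3P[/andP[d15 _] oa ob] hv.
  rewrite straight_cat straight_cat.
  have [ma ha ba pa] := IHa d m oa R.
  have Ra := represents_hold R (hold_weak (leq0n _) ha) ba.
  have [mb hb bb pb_] := IHb _ _ ob Ra.
  set m1 := straight (cexp a d) m in ma ha ba pa Ra mb hb bb pb_ *.
  set m2 := straight (cexp b d.+1) m1 in mb hb bb pb_ *.
  have m2d : m2 d = ev inp s a by rewrite hb //; apply/orP; left.
  rewrite /= /mem_after /= !fsfun_withE !eqxx m2d mb.
  have b3 : bnded [fsfun m2 with d |-> ev inp s a - ev inp s b].
    by apply: bnded_set => //; rewrite /val_bound /addr_bound; lia.
  split=> //.
    apply: hold_set; last lia.
    exact: hold_trans ha (hold_weak _ hb).
  apply: bnded_along_cat => //; apply: bnded_along_cat => //.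
  by rewrite /= /mem_after /= -/m1 -/m2 m2d mb.
- case: (R) => _ r2 _.
  have := ev_VB o R; move: o => /and3P[/andP[d15 _] oe hal] hv.
  have -> : cexp (ELd al e) d = cexp e d ++ (caddr al d ++ [:: ILoad d d]) by [].
  rewrite straight_cat [straight (caddr _ _ ++ _) _]straight_cat.
  have [me he be pe] := IH d m oe R.
  have := caddr_ok hal d15 be me (ev_VB oe R).
  set m1 := straight (cexp e d) m in me he be pe *.
  have [m2 Em2] : {m2 | m2 = straight (caddr al d) m1} by eexists.
  cbv zeta; rewrite -Em2 => -[m2d h2 b2 p2].
  have E : m2 (48 + al + 16 * ev inp s e) = ar s al (ev inp s e).
    by rewrite h2 ?he; [exact: (r2 _ _ hal).1|lia|lia].
  have E3 : straight [:: ILoad d d] m2 = [fsfun m2 with d |-> ar s al (ev inp s e)].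
    by rewrite /= /mem_after /= m2d E.
  have b3 : bnded [fsfun m2 with d |-> ar s al (ev inp s e)].
    have := (r2 al (ev inp s e) hal).2.
    by move=> ?; apply: bnded_set => //; rewrite /val_bound /addr_bound; lia.
  rewrite E3 fsfun_withE eqxx; split=> //.
    apply: hold_set; last lia.
    exact: hold_trans he h2.
  apply: bnded_along_cat => //; apply: bnded_along_cat => //; rewrite -/m1 -Em2.
  by split=> //; split=> //; move: b3; rewrite -E3.
- have := ev_VB o R; move: o => /= /andP[/andP[d15 _] oe] hv.
  rewrite !straight_cat.
  have [me he be pe] := IH d m oe R.
  set m1 := straight (cexp e d) m in me he be pe *.
  rewrite /= /mem_after /= !fsfun_withE !eqxx me.
  have b3 : bnded [fsfun m1 with d |-> nth 0 inp (ev inp s e)].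
    have := inpV (ev inp s e).
    by move=> ?; apply: bnded_set => //; rewrite /val_bound /addr_bound; lia.
  split=> //.
    by apply: hold_set; last lia.
  apply: bnded_along_cat => //.
  by rewrite /= /mem_after /= -/m1 me.
Qed.

Variable p : program.

Definition det_stp := step p inp false.

(** The bound is required of every memory on the way because space is measured
    over all configurations. *)
Fixpoint reach (k : nat) (c c' : config) : Prop :=
  if k is k'.+1 then bnded (Defs.mem c) /\ reach k' (det_stp c) c'
  else c = c' /\ bnded (Defs.mem c).

Lemma reach_trans k1 k2 c1 c2 c3 :
  reach k1 c1 c2 -> reach k2 c2 c3 -> reach (k1 + k2) c1 c3.
Proof.
elim: k1 c1 => [|k1 IH] c1 /=; first by move=> [-> _].
by move=> [b r] r2; split=> //; apply: IH.
Qed.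

Definition code_at (a : nat) (cs : seq instr) : Prop :=
  exists p1 p2, p = p1 ++ cs ++ p2 /\ size p1 = a.

Lemma code_at_cat a cs ds :
  code_at a (cs ++ ds) -> code_at a cs /\ code_at (a + size cs) ds.
Proof.
move=> [p1 [p2 [E <-]]]; rewrite /code_at E; split.
  by exists p1, (ds ++ p2); rewrite !catA.
by exists (p1 ++ cs), p2; rewrite !catA size_cat.
Qed.

Lemma code_at_cons a c cs : code_at a (c :: cs) -> code_at a.+1 cs.
Proof. by move=> ca; have [_] := @code_at_cat a [:: c] cs ca; rewrite addn1. Qed.

Lemma code_at_stp a c cs m o : code_at a (c :: cs) ->
  det_stp (Config a m o) = exec inp false c (Config a m o).
Proof.
move=> [p1 [p2 [E <-]]]; rewrite /det_stp /step /halted E !size_cat /=.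
rewrite ifF; last by lia.
by rewrite nth_cat ltnn subnn.
Qed.

Definition setter (c : instr) : bool :=
  match c with
  | IFlip _ | IWrite _ | IJump _ | IJumpZ _ _ => false
  | _ => true
  end.

Lemma setter_cexp e d : all setter (cexp e d).
Proof.
by elim: e d => //= [a IHa b IHb|a IHa b IHb|al e IH|e IH] d;
   rewrite !all_cat ?IHa ?IHb ?IH.
Qed.

Lemma reach_straight a cs m o : code_at a cs -> all setter cs -> bnded_along cs m ->
  reach (size cs) (Config a m o) (Config (a + size cs) (straight cs m) o).
Proof.
elim: cs a m => [|c cs IH] a m ca /=; first by rewrite addn0 => _ [].
move=> /andP[sc scs] [b pbc]; split=> //.
have ca' : code_at a.+1 cs.
  by have [_] := @code_at_cat a [:: c] cs ca; rewrite addn1.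
rewrite (code_at_stp _ _ ca) addnS -addSn.
have := IH _ _ ca' scs pbc.
by case: c sc {ca pbc IH}.
Qed.

Lemma reach_exp e a m o s cs : fits_exp e 0 -> represents m s -> code_at a (cexp e 0 ++ cs) ->
  exists m', [/\ reach (size (cexp e 0)) (Config a m o) (Config (a + size (cexp e 0)) m' o),
     represents m' s, m' 0 = ev inp s e & code_at (a + size (cexp e 0)) cs].
Proof.
move=> oe R /code_at_cat[ca cb]; have [e1 e2 e3 e4] := cexp_ok oe R.
exists (straight (cexp e 0) m); split=> //.
  exact: reach_straight (setter_cexp _ _) e4.
exact: represents_hold R e2 e3.
Qed.

Lemma reach1 c cs a m o : code_at a (c :: cs) -> bnded m ->
  bnded (Defs.mem (exec inp false c (Config a m o))) ->
  reach 1 (Config a m o) (exec inp false c (Config a m o)).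
Proof. by move=> ca b b'; rewrite /= (code_at_stp _ _ ca). Qed.

Lemma represents_bnded m s : represents m s -> bnded m. Proof. by case. Qed.

Lemma sim_asg x e a m s : fits (CAsg x e) -> represents m s -> code_at a (casg x e) ->
  ev inp s e < V ->
  exists m', reach (size (casg x e)) (Config a m (out s))
     (Config (a + size (casg x e)) m' (out s)) /\ represents m' (asg s x (ev inp s e)).
Proof.
move=> /and3P[x32 oe _] R ca lt.
have [e1 e2 e3 e4] := cexp_ok oe R.
exists (straight (casg x e) m).
have E : straight (casg x e) m =
  [fsfun [fsfun straight (cexp e 0) m with 1 |-> 0] with 16 + x |-> ev inp s e].
  rewrite /casg straight_cat /= /mem_after /= !fsfun_withE eqxx.
  have -> : (0 == 1) = false by [].
  by rewrite e1 addn0.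
have b1 : bnded [fsfun straight (cexp e 0) m with 1 |-> 0].
  by apply: bnded_set => //; rewrite /val_bound /addr_bound; lia.
have b2 : bnded (straight (casg x e) m).
  by rewrite E; apply: bnded_set => //; rewrite /val_bound /addr_bound; lia.
split.
  apply: reach_straight => //; first by rewrite all_cat setter_cexp.
  apply: bnded_along_cat => //=; split=> //; rewrite /mem_after /=; split=> //; split=> //.
  by move: b2; rewrite /casg straight_cat /= /mem_after.
case: R => r1 r2 r3; split=> // [y hy|al i hal]; rewrite E !fsfun_withE.
  have -> : sc (asg s x (ev inp s e)) y = if y == x then ev inp s e else sc s y by [].
  rewrite eqn_add2l; case: (eqVneq y x) => // _.
  have -> : (16 + y == 1) = false by [].
  by rewrite e2; [apply: r1|apply/orP; right; lia].
have -> : (48 + al + 16 * i == 16 + x) = false by lia.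
have -> : (48 + al + 16 * i == 1) = false by lia.
by rewrite e2; [apply: r2|apply/orP; right; lia].
Qed.

Lemma sim_sto al ei e a m s : fits (CSto al ei e) -> represents m s -> code_at a (csto al ei e) ->
  ev inp s ei < Lam -> ev inp s e < V ->
  exists m', reach (size (csto al ei e)) (Config a m (out s))
     (Config (a + size (csto al ei e)) m' (out s)) /\
     represents m' (sto s al (ev inp s ei) (ev inp s e)).
Proof.
move=> /and4P[hal oi oe _] R ca lti lt.
have [e1 e2 e3 e4] := cexp_ok oi R.
have := caddr_ok hal (ltn0Sn _) e3 e1 (ev_VB oi R) => -[c1 c2 c3 c4].
set m1 := straight (caddr al 0) _ in c1 c2 c3 *.
have h1 := hold_trans e2 c2.
have R1 : represents m1 s := represents_hold R h1 c3.
have [f1 f2 f3 f4] := cexp_ok oe R1.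
exists (straight (csto al ei e) m).
set m2 := straight (cexp e 1) m1 in f1 f2 f3 *.
have m20 : m2 0 = 48 + al + 16 * ev inp s ei by rewrite f2.
have E : straight (csto al ei e) m =
  [fsfun m2 with 48 + al + 16 * ev inp s ei |-> ev inp s e].
  rewrite /csto straight_cat straight_cat straight_cat -/m1 -/m2.
  by rewrite [LHS]/= /mem_after /= f1 m20.
have b2 : bnded (straight (csto al ei e) m).
  rewrite E; apply: bnded_set => //; rewrite /val_bound /addr_bound; try lia.
split.
  apply: reach_straight => //; first by rewrite !all_cat !setter_cexp.
  apply: bnded_along_cat => //; apply: bnded_along_cat => //; apply: bnded_along_cat => //; split=> //=; split=> //.
  by move: b2; rewrite /csto !straight_cat.
have [r1 r2 r3] := R1; split=> // [y hy|bl i hbl]; rewrite E !fsfun_withE.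
  have -> : (16 + y == 48 + al + 16 * ev inp s ei) = false by lia.
  by rewrite f2; [apply: r1|apply/orP; right; lia].
set s' := sto _ _ _ _.
have -> : ar s' bl i = if bl == al then if i == ev inp s ei then ev inp s e
   else ar s al i else ar s bl i by rewrite /s' /= /upd -[eqn bl al]/(bl == al); case: ifP.
case: (eqVneq bl al) => [->|nb].
  case: (eqVneq i (ev inp s ei)) => [->|ni]; first by rewrite eqxx.
  have -> : (48 + al + 16 * i == 48 + al + 16 * ev inp s ei) = false by lia.
  by rewrite f2; [apply: r2|apply/orP; right; lia].
have -> : (48 + bl + 16 * i == 48 + al + 16 * ev inp s ei) = false by lia.
by rewrite f2; [apply: r2|apply/orP; right; lia].
Qed.

Lemma reach_test e a m s o t cs : fits_exp e 0 -> represents m s ->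
  code_at a (cexp e 0 ++ IJumpZ 0 t :: cs) ->
  exists m', [/\ reach (size (cexp e 0) + 1) (Config a m o)
       (Config (if ev inp s e == 0 then t else a + (size (cexp e 0)).+1) m' o),
     represents m' s & code_at (a + (size (cexp e 0)).+1) cs].
Proof.
move=> oe R ca; have [m' [r R' m0 ca1]] := reach_exp o oe R ca.
exists m'; split=> //; last by rewrite addnS; apply: code_at_cons ca1.
apply: reach_trans r _.
have := @reach1 _ _ _ m' o ca1 (represents_bnded R') (represents_bnded R').
by rewrite [exec _ _ _ _]/= m0 addnS.
Qed.

Variable fin : nat.

(** Forward simulation, by induction on the execution.  The inequality
    [k + cmd_steps * tm s <= cmd_steps * tm s'] bounds the number of steps by the
    time that passes in the source. *)
Lemma sim c s o s' : runs inp V Lam c s o s' -> forall a m,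
  fits c -> represents m s -> code_at a (comp fin a c) ->
  exists k m', [/\ k + cmd_steps * tm s <= cmd_steps * tm s', represents m' s' &
    reach k (Config a m (out s))
            (Config (if o then fin else a + csize c) m' (out s'))].
Proof.
elim=> {c s o s'}.
- move=> x e s lt a m ok R ca.
  have [m' [r R']] := sim_asg ok R ca lt.
  exists (size (casg x e)), m'; split=> //.
  by move: ok => /= /and3P[_ _]; lia.
- move=> al ei e s li lt a m ok R ca.
  have [m' [r R']] := sim_sto ok R ca li lt.
  exists (size (csto al ei e)), m'; split=> //.
  by move: ok => /= /and4P[_ _ _]; lia.
- move=> e s a m /= /andP[oe sz] R ca.
  have [m' [r R' m0 ca']] := reach_exp (out s) oe R ca.
  exists (size (cexp e 0) + 1), m'; split=> //=; first by lia.
  apply: reach_trans r _; rewrite addnS -addSn.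
  have := @reach1 _ _ _ m' (out s) ca' (represents_bnded R') (represents_bnded R').
  by rewrite [exec _ _ _ _]/= m0 addSn.
- move=> s a m _ R ca; exists 1, m; split=> //=; first by rewrite /cmd_steps; lia.
  exact: (@reach1 _ _ _ m (out s) ca (represents_bnded R) (represents_bnded R)).
- move=> s a m _ R ca; exists 0, m; split=> //=; first by rewrite addn0; split=> //; apply: represents_bnded R.
- move=> c d s s' E IH a m /= /andP[fits okd] R /code_at_cat[c1 c2].
  by have [k [m' [h1 h2 h3]]] := IH _ _ fits R c1; exists k, m'.
- move=> c d s s' o s'' E IH E' IH' a m /= /andP[fits okd] R /code_at_cat[c1].
  rewrite size_comp => c2.
  have [k [m' [h1 h2 h3]]] := IH _ _ fits R c1.
  have [k' [m'' [h1' h2' h3']]] := IH' _ _ okd h2 c2.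
  exists (k + k'), m''; split=> //; first by lia.
  by rewrite addnA; apply: reach_trans h3 h3'.
- move=> e c d s o s' nz E IH a m /= /and4P[oe sz oc od] R ca.
  have [m1 [r R' /code_at_cat[ca2]]] := reach_test (out s) oe R ca.
  rewrite size_comp (negbTE nz) in r * => ca3.
  have [k [m' [h1 h2 h3]]] := IH _ m1 oc R' ca2.
  have r2 := reach_trans r h3.
  case: o E IH r2 h3 => E IH r2 h3.
    exists (size (cexp e 0) + 1 + k), m'; split=> //.
    by move: h1 => /=; lia.
  exists (size (cexp e 0) + 1 + k + 1), m'; split=> //.
    by move: h1 => /=; lia.
  apply: reach_trans r2 _.
  have := @reach1 _ _ _ m' (out s') ca3 (represents_bnded h2) (represents_bnded h2).
  rewrite [exec _ _ _ _]/=.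
  by have -> : a + (size (cexp e 0)).+1 + (csize c).+1 + csize d =
    a + ((size (cexp e 0)).+2 + csize c + csize d) by lia.
- move=> e c d s o s' z E IH a m /= /and4P[oe sz oc od] R ca.
  have [m1 [r R' /code_at_cat[_ /code_at_cons]]] := reach_test (out s) oe R ca.
  rewrite size_comp z eqxx in r * => ca3.
  rewrite -addnS in ca3.
  have [k [m' [h1 h2 h3]]] := IH _ m1 od R' ca3.
  have r2 := reach_trans r h3.
  exists (size (cexp e 0) + 1 + k), m'; split=> //.
    by move: h1 => /=; lia.
  case: o {E IH h3} r2 => //.
  by have -> : a + (size (cexp e 0)).+1 + (csize c).+1 + csize d =
    a + ((size (cexp e 0)).+2 + csize c + csize d) by lia.
- move=> e c s z a m /= /and3P[oe sz oc] R ca.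
  have [m1 [r R' _]] := reach_test (out s) oe R ca.
  rewrite z eqxx in r.
  exists (size (cexp e 0) + 1), m1; split=> //; first by rewrite /=; lia.
  move: r.
  by have -> : a + (size (cexp e 0)).+1 + (csize c).+1 =
    a + ((size (cexp e 0)).+2 + csize c) by lia.
- move=> e c s s' nz E IH a m /= /and3P[oe sz oc] R ca.
  have [m1 [r R' /code_at_cat[ca2 _]]] := reach_test (out s) oe R ca.
  rewrite (negbTE nz) in r.
  have [k [m' [h1 h2 h3]]] := IH _ m1 oc R' ca2.
  exists (size (cexp e 0) + 1 + k), m'; split=> //.
    by move: h1 => /=; lia.
  exact: reach_trans r h3.
- move=> e c s s' o s'' nz E IH E' IH' a m ok R ca.
  move: (ok) => /= /and3P[oe sz oc].
  have [m1 [r R' /code_at_cat[ca2]]] := reach_test (out s) oe R ca.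
  rewrite size_comp (negbTE nz) in r * => ca3.
  have [k [m' [h1 h2 h3]]] := IH _ m1 oc R' ca2.
  have [k' [m'' [h1' h2' h3']]] := IH' a m' ok h2 ca.
  have r2 := reach_trans r h3.
  have r3 := @reach1 _ _ _ m' (out s') ca3 (represents_bnded h2) (represents_bnded h2).
  rewrite [exec _ _ _ _]/= in r3.
  exists (size (cexp e 0) + 1 + k + 1 + k'), m''; split=> //.
    by move: h1 => /=; lia.
  exact: reach_trans (reach_trans r2 r3) h3'.
Qed.

End Sim.

(** * Binomial coefficients *)

Lemma bin_ratio n k : 'C(n, k.+1) * k.+1 = 'C(n, k) * (n - k).
Proof. by rewrite mulnC mul_bin_left mulnC. Qed.

Lemma bin_ratio_ge n k : 0 < k < n -> n <= 'C(n, k).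
Proof.
elim: n k => [|n IH] [|k] // h.
rewrite binS; have [E|nk] := eqVneq k.+1 n; first by rewrite -E binn binSn; lia.
have := IH k.+1 ltac:(lia).
have : 0 < 'C(n, k) by rewrite bin_gt0; lia.
lia.
Qed.

Lemma exp2_bin_half n k : k.*2 <= n -> 2 ^ k <= 'C(n, k).
Proof.
elim: k n => [|k IH] n h; first by rewrite bin0.
case: n h => // n h.
have hn := IH n ltac:(lia); have /= E := mul_bin_diag n.+1 k.
rewrite -(leq_pmul2l (ltn0Sn k)) -[X in _ <= X]E expnS mulnA.
by apply: leq_mul => //; lia.
Qed.

(** Log-concavity: the ratio of consecutive binomial coefficients decreases. *)
Lemma bin_concave n x y : x <= y -> 'C(n, x) * 'C(n, y.+1) <= 'C(n, x.+1) * 'C(n, y).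
Proof.
move=> xy.
rewrite -(leq_pmul2r (ltn0Sn x)) -(leq_pmul2r (ltn0Sn y)).
have E : 'C(n, x) * 'C(n, y.+1) * x.+1 * y.+1 = ('C(n,x) * 'C(n,y)) * ((n - y) * x.+1).
  by have := congr1 (fun z => z * ('C(n, x) * x.+1)) (bin_ratio n y); rewrite /=; lia.
have E' : 'C(n, x.+1) * 'C(n, y) * x.+1 * y.+1 = ('C(n,x) * 'C(n,y)) * ((n - x) * y.+1).
  by have := congr1 (fun z => z * ('C(n, y) * y.+1)) (bin_ratio n x); rewrite /=; lia.
by rewrite E E' leq_mul //; nia.
Qed.

Lemma bin_center n b i : i <= b -> 'C(n, b - i) * 'C(n, b + i) <= 'C(n, b) ^ 2.
Proof.
elim: i => [|i IH] h; first by rewrite subn0 addn0 -mulnn.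
apply: leq_trans (IH (ltnW h)).
have := @bin_concave n (b - i.+1) (b + i) ltac:(lia).
by rewrite addnS subnS prednK //; lia.
Qed.

(** Vandermonde's identity writes the left-hand side as a sum of [2 b + 1] products
    ['C(a, b - i) * 'C(a, b + i)], of which the central one is the largest. *)
Lemma bin_half_sq a b : 'C(a.*2, b.*2) <= (b.*2).+1 * 'C(a, b) ^ 2.
Proof.
rewrite -addnn -binomial.Vandermonde.
apply: (@leq_trans (\sum_(j < (b.*2).+1) 'C(a, b) ^ 2)); last first.
  by rewrite sum_nat_const card_ord.
apply: leq_sum => j _; have jb := ltn_ord j.
case: (leqP j b) => h.
  by have := @bin_center a b (b - j) ltac:(lia); rewrite subKn //; congr (_ * 'C(_, _) <= _); lia.
have := @bin_center a b (j - b) ltac:(lia); rewrite mulnC; congr ('C(_, _) * 'C(_, _) <= _); lia.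
Qed.

Lemma bin_half_sq_ge a b : 'C(a, b) ^ 2 <= 'C(a.*2, b.*2).
Proof.
rewrite -addnn -binomial.Vandermonde.
have hb : b < (b.*2).+1 by lia.
rewrite (bigD1 (Ordinal hb)) //=.
have -> : b.*2 - b = b by lia.
by rewrite mulnn leq_addr.
Qed.

(** * A small modulus that separates a set *)

(** Legendre's formula gives the exponent as a sum over [k] of terms
    [(2 r) / p ^ k - 2 (r / p ^ k)], each 0 or 1, and 0 once [p ^ k] exceeds
    [2 r]. *)
Lemma logn_bin_le p r : prime p -> logn p 'C(r.*2, r) <= trunc_log p r.*2.
Proof.
move=> pp; have p1 := prime_gt1 pp.
have E : 'C(r.*2, r) * (r`! * r`!) = (r.*2)`!.
  by have := @bin_fact (r.*2) r ltac:(lia); rewrite -addnn addnK.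
have := congr1 (logn p) E.
rewrite !lognM ?muln_gt0 ?fact_gt0 ?bin_gt0 //; last by lia.
rewrite !logn_fact // => EE.
set L := trunc_log p r.*2.
have bound (m : nat) : m <= r.*2 -> \sum_(1 <= k < m.+1) m %/ p ^ k = \sum_(1 <= k < (r.*2).+1) m %/ p ^ k.
  move=> hm; rewrite [RHS](@big_cat_nat _ _ _ m.+1) //=.
  rewrite [X in _ = _ + X]big1_seq ?addn0 // => k /andP[_]; rewrite mem_index_iota => hk.
  apply: divn_small; apply: leq_trans (ltn_expl k p1); lia.
rewrite (bound r) in EE; last by lia.
suff : \sum_(1 <= k < r.*2.+1) r.*2 %/ p ^ k <=
   L + (\sum_(1 <= k < r.*2.+1) r %/ p ^ k + \sum_(1 <= k < r.*2.+1) r %/ p ^ k) by lia.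
have -> : L = \sum_(1 <= k < L.+1) 1 by rewrite sum_nat_const_nat; lia.
have Lr : L <= r.*2.
  case: (posnP r) => [r0|r0]; first by rewrite /L r0 trunc_log0.
  apply: ltnW; apply: leq_trans (ltn_expl L p1) _; apply: trunc_logP => //; lia.
rewrite (@big_cat_nat _ _ _ L.+1 1 r.*2.+1) //= addnC.
rewrite [X in X + _]big1_seq ?add0n; last first.
  move=> k /andP[_]; rewrite mem_index_iota => hk; apply: divn_small.
  by apply: leq_trans (trunc_log_ltn _ p1) _; rewrite leq_exp2l //; lia.
rewrite addnA.
apply: (@leq_trans (\sum_(1 <= k < L.+1) (1 + (r %/ p ^ k + r %/ p ^ k)))).
  apply: leq_sum => k _; rewrite -addnn.
  have := @leq_divDl (p ^ k) r r; lia.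
rewrite big_split /= big_split /= -addnA leq_add2l.
have hsub : \sum_(1 <= k < L.+1) r %/ p ^ k <= \sum_(1 <= k < (r.*2).+1) r %/ p ^ k.
  by rewrite [X in _ <= X](@big_cat_nat _ _ _ L.+1) //= leq_addr.
lia.
Qed.

(** By the previous lemma, the prime powers in ['C(2 r, r)] are themselves numbers
    up to [2 r]. *)
Lemma bin_dvd_all r D : 0 < D -> (forall q, 0 < q <= r.*2 -> q %| D) -> 'C(r.*2, r) %| D.
Proof.
move=> D0 h; have C0 : 0 < 'C(r.*2, r) by rewrite bin_gt0; lia.
apply/(dvdn_partP _ C0) => p; rewrite mem_primes => /and3P[pp _ _].
rewrite p_part; have p1 := prime_gt1 pp.
case: (posnP r) => [->|r0]; first by rewrite bin0 logn1 expn0 dvd1n.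
apply: dvdn_trans (dvdn_exp2l p (logn_bin_le r pp)) _.
apply: h; rewrite expn_gt0 prime_gt0 //=; apply: trunc_logP; lia.
Qed.

Definition separates (q : nat) (Z : pred nat) n : Prop :=
  forall x y, x < n -> y < n -> Z x -> Z y -> x = y %[mod q] -> x = y.

(** If no [q] up to [2 r] separated [Z], each would divide some difference of two
    elements, hence the product [D] of all of them; then ['C(2 r, r)], which is
    at least [2 ^ r], would divide [D], which is smaller by the choice of [r]. *)
Lemma separating_modulus n (Z : pred nat) :
  exists q, [/\ 0 < q, q <= 2 * ((count Z (iota 0 n)) ^ 2 * (trunc_log 2 n).+1 + 1) & separates q Z n].
Proof.
(* the differences are below [2 ^ (trunc_log 2 n).+1], so [D] is below [2 ^ r] *)
set z := count _ _; set r := z ^ 2 * (trunc_log 2 n).+1 + 1.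
pose zs := [seq x <- iota 0 n | Z x].
pose D := \prod_(x <- zs) \prod_(y <- zs | x < y) (y - x).
have Dle : D <= (2 ^ (trunc_log 2 n).+1) ^ (z ^ 2).
  have n2 : n <= 2 ^ (trunc_log 2 n).+1 by apply: ltnW; apply: trunc_log_ltn.
  have szz : size zs = z by rewrite size_filter.
  apply: (@leq_trans (\prod_(x <- zs) \prod_(y <- zs) 2 ^ (trunc_log 2 n).+1)); last first.
    rewrite big_const_seq iter_muln_1 count_predT szz big_const_seq iter_muln_1 count_predT szz.
    by rewrite -expnM mulnn.
  rewrite /D; apply: (@big_ind2 _ _ leq) => //; first by move=> *; apply: leq_mul.
  move=> x _; rewrite big_mkcond /= big_seq [X in _ <= X]big_seq.
  apply: (@big_ind2 _ _ leq) => //; first by move=> *; apply: leq_mul.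
  move=> y; rewrite mem_filter mem_iota => /andP[_ hy].
  case: ifP => _; last by rewrite expn_gt0.
  by apply: leq_trans n2; lia.
have D0 : 0 < D.
  rewrite prodn_gt0 // => x; rewrite prodn_cond_gt0 // => y; lia.
pose ok q := all (fun x => all (fun y => ~~ ((x < y) && (q %| y - x))) zs) zs.
have sepok q : ok q -> separates q Z n.
  move=> /allP h x y hx hy Zx Zy E.
  have xz : x \in zs by rewrite mem_filter Zx mem_iota.
  have yz : y \in zs by rewrite mem_filter Zy mem_iota.
  case: (ltngtP x y) => // lt.
  - have /allP/(_ _ yz) := h _ xz; rewrite lt /= -eqn_mod_dvd; last by lia.
    by rewrite E eqxx.
  - have /allP/(_ _ xz) := h _ yz; rewrite lt /= -eqn_mod_dvd; last by lia.
    by rewrite E eqxx.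
case: (boolP (has ok (iota 1 r.*2))).
  case/hasP => q; rewrite mem_iota => hq /sepok s; exists q; split=> //; lia.
move/hasPn => h.
suff : 'C(r.*2, r) %| D.
  move/(dvdn_leq D0) => le.
  have := @exp2_bin_half r.*2 r (leqnn _).
  have := leq_trans le Dle; rewrite -expnM => A B.
  have := leq_trans B A; rewrite leq_exp2l // /r; lia.
apply: bin_dvd_all => // q hq.
have := h q; rewrite mem_iota => /(_ ltac:(lia)).
rewrite /ok -has_predC => /hasP[x xz] /=; rewrite -has_predC => /hasP[y yz] /=.
rewrite negbK => /andP[xy dv].
rewrite /D (big_rem x) //= dvdn_mulr // (big_rem y) //= xy dvdn_mulr //.
Qed.

(** * Subsets in colexicographic order *)

(** In this order the successor of a subset changes an initial segment only, and
    the machine can find it without storing more than the current subset. *)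
Fixpoint colex (m k : nat) : seq bitseq :=
  if m is m'.+1 then
    [seq rcons s false | s <- colex m' k] ++
    (if k is k'.+1 then [seq rcons s true | s <- colex m' k'] else [::])
  else if k is 0 then [:: [::]] else [::].

Lemma size_colex m k : size (colex m k) = 'C(m, k).
Proof.
elim: m k => [|m IH] [|k] //=; by rewrite size_cat !size_map ?IH ?bin0.
Qed.

Lemma mem_colex m k s : (s \in colex m k) = (size s == m) && (count id s == k).
Proof.
elim: m k s => [|m IH] k s; first by case: k => [|k]; case: s.
have inj b : injective (fun s : bitseq => rcons s b) by move=> x y /rcons_inj[].
case/lastP: s => [|s b] /=.
  rewrite mem_cat; apply/negP; case/orP; first by case/mapP => [[|? ?]].
  by case: k => // k; case/mapP => [[|? ?]].
rewrite size_rcons eqSS mem_cat -cats1 count_cat cats1 /= addn0.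
case: b => /=.
  have -> : (rcons s true \in [seq rcons s0 false | s0 <- colex m k]) = false.
    by apply/negP => /mapP[x _ /rcons_inj[]].
  case: k => [|k] /=; first by rewrite in_nil addn1 andbF.
  by rewrite (mem_map (inj true)) IH addn1 eqSS.
rewrite (mem_map (inj false)) IH addn0.
have -> : (rcons s false \in (if k is k'.+1 then [seq rcons s0 true | s0 <- colex m k'] else [::])) = false.
  by case: k => // k; apply/negP => /mapP[x _ /rcons_inj[]].
by rewrite orbF.
Qed.

Lemma head_colex m k : k <= m -> nth [::] (colex m k) 0 = nseq k true ++ nseq (m - k) false.
Proof.
elim: m k => [|m IH] k h; first by case: k h.
rewrite /= nth_cat size_map size_colex bin_gt0.
case: leqP => hk.
  rewrite (nth_map [::]) ?size_colex ?bin_gt0 // IH // subSn // -[(m - k).+1]addn1 nseqD.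
  by rewrite catA cats1.
have -> : k = m.+1 by lia.
rewrite bin_small // (nth_map [::]) ?size_colex ?binn // IH // !subnn !cats0.
by rewrite -[m.+1]addn1 nseqD cats1.
Qed.

Lemma last_colex m k : k <= m ->
  nth [::] (colex m k) 'C(m, k).-1 = nseq (m - k) false ++ nseq k true.
Proof.
elim: m k => [|m IH] k h; first by case: k h.
have C0 : 0 < 'C(m.+1, k) by rewrite bin_gt0.
case: k h C0 => [|k] h C0.
  rewrite bin0 /= cats0 (nth_map [::]) ?size_colex ?bin0 //.
  have := IH 0 (leq0n _); rewrite bin0 /= => ->; rewrite !subn0 !cats0.
  by rewrite -cats1 -[[:: false]]/(nseq 1 false) -nseqD addn1.
have B : 0 < 'C(m, k) by rewrite bin_gt0.
rewrite [colex _ _]/= nth_cat size_map size_colex binS ifF; last by lia.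
have -> : ('C(m, k.+1) + 'C(m, k)).-1 - 'C(m, k.+1) = 'C(m, k).-1 by lia.
rewrite (nth_map [::]) ?size_colex; last by lia.
by rewrite IH // subSS -[k.+1]addn1 nseqD -cats1 catA.
Qed.

(** The last one of the first run of ones moves up by one place, and the other
    ones of that run move to the front. *)
Lemma colex_next m k r : r.+1 < 'C(m, k) ->
  exists a b tl, nth [::] (colex m k) r = nseq b false ++ nseq a.+1 true ++ false :: tl /\
    nth [::] (colex m k) r.+1 = nseq a true ++ nseq b.+1 false ++ true :: tl.
Proof.
elim: m k r => [|m IH] k r; first by case: k => [|k]; rewrite ?bin0 ?bin0n //; lia.
case: k => [|k]; first by rewrite bin0.
rewrite binS => hr.
rewrite [colex _ _]/= !nth_cat size_map size_colex.
case: (ltngtP r.+1 'C(m, k.+1)) => h.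
- rewrite !(nth_map [::]) ?size_colex //; last by lia.
  have [a [b [tl [-> ->]]]] := IH k.+1 r h; exists a, b, (rcons tl false).
  by rewrite -!cats1 -!catA.
- rewrite !(nth_map [::]) ?size_colex; try lia.
  have [|a [b [tl [E1 E2]]]] := IH k (r - 'C(m, k.+1)); first by lia.
  exists a, b, (rcons tl true); rewrite subSn; last by lia.
  by rewrite E1 E2 -!cats1 -!catA.
- rewrite h subnn !(nth_map [::]) ?size_colex; try lia.
  have km : k.+1 <= m by rewrite -bin_gt0; lia.
  have -> : r = 'C(m, k.+1).-1 by lia.
  rewrite last_colex // head_colex; last by lia.
  exists k, (m - k.+1), [::]; rewrite -!cats1 -!catA; split=> //.
  by have -> : m - k = (m - k.+1).+1 by lia.
Qed.

(** * Arrangement by residues, and balanced cuts *)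

(** The number of elements of the residue class of [r] below [n], as [r < q]. *)
Definition class_size (q n r : nat) := (n - r + q.-1) %/ q.

Lemma ltn_class_size q n r c : 0 < q -> (c < class_size q n r) = (r + q * c < n).
Proof.
move=> q0; rewrite /class_size leq_divRL // mulSn mulnC; apply/idP/idP; lia.
Qed.

Definition residue_order (q n : nat) : seq nat :=
  [seq r + q * i | r <- iota 0 q, i <- iota 0 (class_size q n r)].

Lemma perm_residue_order q n : 0 < q -> perm_eq (residue_order q n) (iota 0 n).
Proof.
move=> q0; apply: uniq_perm; last 1 first.
- move=> z; rewrite mem_iota /= add0n; apply/idP/idP.
    case/allpairsPdep => r [i []]; rewrite !mem_iota !add0n /= => hr.
    by rewrite ltn_class_size // => hi ->.
  move=> zn; apply/allpairsPdep; exists (z %% q), (z %/ q).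
  have E : z = z %% q + q * (z %/ q) by rewrite addnC mulnC -divn_eq.
  rewrite !mem_iota /= !add0n ltn_pmod // ltn_class_size // -E; split=> //.
- apply: allpairs_uniq_dep => [|r _|]; try exact: iota_uniq.
  move=> x y /allpairsPdep[r [i []]]; rewrite !mem_iota add0n => hr hi -> /=.
  move=> /allpairsPdep[r' [i' []]]; rewrite !mem_iota add0n => hr' hi' -> /=.
  move=> E; have rr : r = r'.
    have := congr1 (modn^~ q) E; rewrite /= !(addnC _ (q * _)) !(mulnC q) !modnMDl !modn_small //; lia.
  subst r'; congr (Tagged _ _); move: E => /addnI/eqP; rewrite eqn_pmul2l // => /eqP //.
- exact: iota_uniq.
Qed.

(** A break separates two runs: the entries on both sides of it are not one stride
    [q] apart. *)
Definition is_break (q x y : nat) : nat := y != x + q.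
Definition breaks (q : nat) (l : seq nat) : nat :=
  if l is x :: l' then sumn (pairmap (is_break q) x l') else 0.

Lemma breaks_cat q l1 l2 : breaks q l1 + breaks q l2 <= breaks q (l1 ++ l2) <= breaks q l1 + 1 + breaks q l2.
Proof.
case: l1 => [|x l1]; first by rewrite /=; lia.
case: l2 => [|y l2]; first by rewrite cats0 /=; lia.
rewrite /= pairmap_cat /= sumn_cat /=.
have : is_break q (last x l1) y <= 1 by rewrite /is_break; case: eqP.
by lia.
Qed.

Lemma breaks_rot q s l : breaks q (rot s l) <= (breaks q l).+1.
Proof.
rewrite /rot; have := breaks_cat q (drop s l) (take s l).
have := breaks_cat q (take s l) (drop s l); rewrite cat_take_drop; lia.
Qed.

Lemma breaks_arith q r c j : breaks q [seq r + q * i | i <- iota j c] = 0.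
Proof.
case: c => // c /=; elim: c j => //= c IH j; rewrite IH addn0 /is_break.
by have -> : r + q * j.+1 == r + q * j + q by lia.
Qed.

(** Each residue class is a run, so breaks occur between classes only. *)
Lemma breaks_residue_order q n : breaks q (residue_order q n) <= q.
Proof.
rewrite /residue_order; set f := fun r => _.
suff H k j : breaks q (flatten [seq [seq r + q * i | i <- iota 0 (class_size q n r)] | r <- iota j k]) <= k by apply: H.
elim: k j => //= k IH j; have := breaks_cat q [seq j + q * i | i <- iota 0 (class_size q n j)]
  (flatten [seq [seq r + q * i | i <- iota 0 (class_size q n r)] | r <- iota j.+1 k]).
by rewrite breaks_arith; have := IH j.+1; lia.
Qed.

Lemma breaksE q l : breaks q l = \sum_(1 <= j < size l) is_break q (nth 0 l j.-1) (nth 0 l j).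
Proof.
case: l => [|x l] /=; first by rewrite big_geq.
rewrite big_add1 /= sumnE (big_nth 0) size_pairmap big_nat [RHS]big_nat.
apply: eq_bigr => i hi; rewrite (nth_pairmap 0) //; lia.
Qed.

(** For a cyclic list, whether one of the two windows into which it falls when cut
    at the start and in the middle begins at a break. *)
Definition cut_at_break (q : nat) (l : seq nat) : bool :=
  (nth 0 l 0 != nth 0 l (size l).-1 + q) ||
  (nth 0 l (size l)./2 != nth 0 l (size l)./2.-1 + q).

Section Split.
Variables (q h : nat) (l : seq nat).
Hypotheses (h0 : 0 < h) (q0 : 0 < q) (sl : size l = h.*2) (ul : uniq l).

(** [p] and [B] are the list and its breaks, continued periodically; [BB] tells
    where one of the two windows begins at a break. *)
Let p j := nth 0 l (j %% h.*2).
Let B j := p (j + h.*2.-1) + q != p j.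
Let BB j := B j || B (j + h).

Let p_per j : p (j + h.*2) = p j. Proof. by rewrite /p modnDr. Qed.
Let B_per j : B (j + h.*2) = B j.
Proof. by rewrite /B p_per addnAC p_per. Qed.
Let BB_per j : BB (j + h) = BB j.
Proof. by rewrite /BB -addnA addnn B_per orbC. Qed.

Lemma nth_rot_cyclic s i : s < h.*2 -> i < h.*2 -> nth 0 (rot s l) i = p (s + i).
Proof.
move=> hs hi; rewrite /rot nth_cat size_drop sl /p; case: ltnP => h1.
  by rewrite nth_drop modn_small //; lia.
rewrite nth_take; last by lia.
have -> : s + i = (i - (h.*2 - s)) + h.*2 by lia.
by rewrite modnDr modn_small //; lia.
Qed.

Lemma cut_at_break_rot s : s < h.*2 -> cut_at_break q (rot s l) = BB s.
Proof.
move=> hs; rewrite /cut_at_break size_rot sl doubleK !nth_rot_cyclic //; try lia.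
rewrite /BB /B addn0 ![_ + q == _]eq_sym.
have -> : s + h + h.*2.-1 = s + h.-1 + h.*2 by lia.
by rewrite p_per.
Qed.

(** A break is met by two rotations, one for each half; the one added to the
    breaks of [l] is for the place where [l] closes up. *)
Lemma sum_cut_at_break : \sum_(s < h.*2) cut_at_break q (rot s l) <= 2 * (breaks q l).+1.
Proof.
have SB : \sum_(0 <= s < h.*2) B s <= (breaks q l).+1.
  rewrite big_ltn ?double_gt0 // breaksE sl; have : (B 0 : nat) <= 1 by case: (B 0).
  suff : \sum_(1 <= s < h.*2) B s <= \sum_(1 <= j < h.*2) is_break q (nth 0 l j.-1) (nth 0 l j) by lia.
  rewrite big_nat [X in _ <= X]big_nat; apply: leq_sum => j hj.
  rewrite /B /is_break eq_sym /p [j %% _]modn_small; last by lia.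
  have -> : j + h.*2.-1 = j.-1 + h.*2 by lia.
  by rewrite modnDr [j.-1 %% _]modn_small //; lia.
have SBh : \sum_(0 <= s < h.*2) B (s + h) = \sum_(0 <= s < h.*2) B s.
  rewrite [LHS](@big_cat_nat _ _ _ h) //=; last by lia.
  rewrite [RHS](@big_cat_nat _ _ _ h) //=; last by lia.
  rewrite addnC; congr (_ + _).
    rewrite -[X in \sum_(X <= _ < _) _]add0n -addnn big_addn addnK.
    by apply: eq_bigr => i _; rewrite -addnA addnn B_per.
  by rewrite -[X in \sum_(X <= _ < _ ) _ = _]add0n -[X in _ = \sum_(X <= _ < _ ) _]add0n -addnn [RHS]big_addn addnK.
rewrite -(big_mkord xpredT (fun s => cut_at_break q (rot s l) : nat)) mul2n -[X in _ <= X]addnn.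
apply: (@leq_trans (\sum_(0 <= s < h.*2) (B s + B (s + h)))); last first.
  by rewrite big_split /= SBh leq_add.
rewrite big_nat [X in _ <= X]big_nat; apply: leq_sum => j hj.
by rewrite cut_at_break_rot; [rewrite /BB; case: (B j); case: (B _)|lia].
Qed.

Variables (Y : pred nat) (w : nat).
Hypothesis cY : count Y l = w.*2.
Hypothesis sepY :
  {in l &, forall x y, Y x -> Y y -> x = y %[mod q] -> x = y} \/
  {in l &, forall x y, ~~ Y x -> ~~ Y y -> x = y %[mod q] -> x = y}.

(** The number of ones in the window of length [h] that begins at [s]. *)
Let F s := \sum_(s <= j < s + h) Y (p j).

Let count_take (l' : seq nat) n : n <= size l' -> count Y (take n l') = \sum_(0 <= j < n) Y (nth 0 l' j).
Proof.
move=> hn; rewrite -sum1_count big_mkcond /= (big_nth 0) size_take.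
rewrite (_ : (if _ then _ else _) = n); last by case: ltnP => //; lia.
rewrite big_nat [RHS]big_nat; apply: eq_bigr => i hi; rewrite nth_take; last by lia.
by case: (Y _).
Qed.

Let FE s : F s = \sum_(0 <= i < h) Y (p (i + s)).
Proof. by rewrite /F -[X in \sum_(X <= _ < _) _]add0n big_addn addKn. Qed.

Lemma count_take_rot s : s < h.*2 -> count Y (take h (rot s l)) = F s.
Proof.
move=> hs; rewrite count_take ?size_rot ?sl; last by lia.
rewrite FE big_nat [RHS]big_nat.
by apply: eq_bigr => i hi; rewrite nth_rot_cyclic 1?addnC //; lia.
Qed.

Let F_per s : F (s + h.*2) = F s.
Proof. by rewrite !FE; apply: eq_bigr => i _; rewrite addnA p_per. Qed.

Let F_comp s : F s + F (s + h) = w.*2.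
Proof.
have E : \sum_(0 <= j < h.*2) Y (p j) = w.*2.
  rewrite -cY -[in RHS](take_size l) count_take // sl big_nat [RHS]big_nat.
  by apply: eq_bigr => i hi; rewrite /p modn_small //; lia.
have shift t : \sum_(t <= j < t + h.*2) Y (p j) = w.*2.
  elim: t => [|t IH] //; move: IH.
  rewrite big_ltn; last by lia.
  by rewrite addSn big_nat_recr /= ?p_per; [lia|lia].
by rewrite /F -(shift s) -addnA addnn [RHS](@big_cat_nat _ _ _ (s + h)) //; lia.
Qed.

Let run_eq s t : (forall j, s < j < t -> ~~ B j) -> forall j, s <= j < t -> p j = p s %[mod q].
Proof.
move=> nb j; elim: j => [|j IH] hj; first by have -> : s = 0 by lia.
case: (eqVneq s j.+1) => [->//|ne].
have := nb j.+1 ltac:(lia); rewrite negbK /B => /eqP <-.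
have -> : j.+1 + h.*2.-1 = j + h.*2 by lia.
by rewrite p_per modnDr; apply: IH; lia.
Qed.

Let p_inj i j : i <= j < i + h.*2 -> p i = p j -> i = j.
Proof.
move=> hij /eqP; rewrite nth_uniq ?sl ?ltn_pmod ?double_gt0 // => /eqP E.
have : (i + (j - i) = i + 0 %[mod h.*2]) by rewrite subnKC ?addn0; lia.
move/eqP; rewrite eqn_modDl mod0n modn_small; lia.
Qed.

Let atmost1 (Z : pred nat) s t : t <= s + h ->
  {in l &, forall x y, Z x -> Z y -> x = y %[mod q] -> x = y} ->
  (forall j, s < j < t -> ~~ B j) -> \sum_(s <= j < t) Z (p j) <= 1.
Proof.
move=> ts inj nb.
have pl j : p j \in l by rewrite mem_nth // sl ltn_pmod ?double_gt0.
have H i j : s <= i < t -> s <= j < t -> i <= j -> Z (p i) -> Z (p j) -> i = j.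
  move=> hi hj ij Zi Zj; apply: p_inj; first by lia.
  by apply: inj => //; rewrite (run_eq nb) // (run_eq nb).
case: (boolP (has (fun j => Z (p j)) (index_iota s t))) => [/hasP[j]|/hasPn N].
  rewrite mem_index_iota => hj Zj.
  rewrite (@big_cat_nat _ _ _ j) /=; [|lia|lia].
  rewrite (@big_ltn _ _ _ j) ?Zj; last by lia.
  rewrite big1_seq; last first.
    move=> i /andP[_]; rewrite mem_index_iota => hi.
    by case: (boolP (Z (p i))) => // Zi; have := H i j; lia.
  rewrite big1_seq // => i /andP[_]; rewrite mem_index_iota => hi.
  by case: (boolP (Z (p i))) => // Zi; have := H j i; lia.
by rewrite big1_seq // => i /andP[_ /N/negbTE->].
Qed.

(** Sliding the window across a run, what enters is part of one residue class, as
    is what leaves.  So at most one of the ones enters if [q] separates the ones;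
    if it separates the zeros, at most one zero leaves. *)
Let F_step s t : s <= t <= s + h -> (forall j, s < j < t -> ~~ BB j) -> F t <= (F s).+1.
Proof.
move=> hst nb.
have nB j : s < j < t -> ~~ B j by move/nb; rewrite negb_or => /andP[].
have nBh j : s + h < j < t + h -> ~~ B j.
  by move=> hj; have := nb (j - h) ltac:(lia); rewrite negb_or subnK; [case/andP|lia].
have E : F s + \sum_(s + h <= j < t + h) Y (p j) = \sum_(s <= j < t) Y (p j) + F t.
  by rewrite /F -!big_cat_nat //; lia.
case: sepY => inj.
  have := @atmost1 Y (s + h) (t + h) ltac:(lia) inj nBh; lia.
have C a b : \sum_(a <= j < b) Y (p j) + \sum_(a <= j < b) ~~ Y (p j) = b - a.
  rewrite -big_split /= -[b - a]muln1 -sum_nat_const_nat; apply: eq_bigr => i _.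
  by case: (Y _).
have := @atmost1 (predC Y) s t ltac:(lia) inj nB.
have := C s t; have := C (s + h) (t + h); rewrite /=; lia.
Qed.

(** Each half starts at a break for some rotation, and the opposite rotation has the
    complementary count, so the count passes from at most [w] to at least [w]
    along the rotations at breaks.  Between two consecutive ones it grows by at
    most one ([F_step]), so the first value that is at least [w] equals [w]. *)
Lemma even_split : exists s, [/\ s < h.*2, cut_at_break q (rot s l) & count Y (take h (rot s l)) = w].
Proof.
(* the predecessor of the least entry is not [q] below it *)
have [s0 B0] : exists s0, B s0.
  have P : exists x, x \in l by exists (nth 0 l 0); rewrite mem_nth // sl; lia.
  case: (ex_minnP P) => x xl xmin; exists (index x l).
  have il : index x l < h.*2 by rewrite -sl index_mem.
  have -> : B (index x l) = (p (index x l + h.*2.-1) + q != x).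
    by rewrite /B {2}/p modn_small // nth_index.
  have := xmin (p (index x l + h.*2.-1)).
  rewrite mem_nth ?sl ?ltn_pmod ?double_gt0 // => /(_ isT); lia.
have [s1 [B1 le1]] : exists s1, BB s1 /\ F s1 <= w.
  have := F_comp s0; case: (leqP (F s0) w) => h1 h2; first by exists s0; rewrite /BB B0.
  by exists (s0 + h); rewrite BB_per /BB B0; split=> //; lia.
have P : exists d, BB (s1 + d) && (w <= F (s1 + d)).
  by exists h; rewrite BB_per B1 /=; have := F_comp s1; lia.
have [d /andP[dB dw] dmin] := ex_minnP P.
have dh : d <= h by apply: dmin; rewrite BB_per B1 /=; have := F_comp s1; lia.
have Ed : F (s1 + d) = w.
  case: (posnP d) => [d0|d0].
    by move: dw; rewrite d0 addn0; lia.
  pose G e := (e < d) && BB (s1 + e).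
  have G0 : exists e, G e by exists 0; rewrite /G d0 addn0.
  have Gb e : G e -> e <= d by case/andP => /ltnW.
  have [e /andP[ed eB] emax] := ex_maxnP G0 Gb.
  have lt : F (s1 + e) < w.
    by rewrite ltnNge; apply/negP => hh; have := dmin e; rewrite eB hh => /(_ isT); lia.
  have := @F_step (s1 + e) (s1 + d) ltac:(lia).
  suff nb : forall j, s1 + e < j < s1 + d -> ~~ BB j by move=> /(_ nb); lia.
  move=> j hj; apply/negP => jB; have := emax (j - s1); rewrite /G subnKC; last by lia.
  by rewrite jB => H; have := H ltac:(lia); lia.
pose t := (s1 + d) %% h.*2.
have tlt : t < h.*2 by rewrite ltn_pmod ?double_gt0.
have tE : s1 + d = t + ((s1 + d) %/ h.*2) * h.*2 by rewrite [RHS]addnC -divn_eq.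
have Fp u c : F (u + c * h.*2) = F u.
  by elim: c => [|c IH]; rewrite ?mul0n ?addn0 // mulSnr addnA F_per.
have BBp u c : BB (u + c * h.*2) = BB u.
  elim: c => [|c IH]; rewrite ?mul0n ?addn0 // mulSnr addnA -[X in _ + X]addnn addnA.
  by rewrite !BB_per.
exists t; split=> //; first by rewrite cut_at_break_rot // -(BBp t ((s1 + d) %/ h.*2)) -tE.
by rewrite count_take_rot // -(Fp t ((s1 + d) %/ h.*2)) -tE.
Qed.

End Split.

(** * The programs *)

(** The variables [rn], [rl], [rt], [rm] and [rk] hold [n], [l], [t], [n / 4] and
    [l / 4], [rG] the sum of all weights, [rI] a key that exceeds all sums of
    two, [rq] the modulus, and [rN] the length of the lists; [roff] is the offset
    of the current block, [rtg] the sum that is looked for, and [rgo] controls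
    the merging.  The array [aP] is the current arrangement of the indices, [aO]
    the answer, [aX] the current subset as bits, [aL] the unsorted list, and
    [aPAR] the halves of the numbers, since the machine cannot divide.  Arrays 1
    to 4 are the sorted lists, 5 and 8 the tournaments, 6 and 9 the positions of
    their rows. *)
Notation rn := 0 (only parsing).
Notation rl := 1 (only parsing).
Notation rt := 2 (only parsing).
Notation rm := 3 (only parsing).
Notation rk := 4 (only parsing).
Notation rG := 5 (only parsing).
Notation rI := 6 (only parsing).
Notation rq := 7 (only parsing).
Notation rN := 11 (only parsing).
Notation rgo := 12 (only parsing).
Notation roff := 17 (only parsing).
Notation rtg := 18 (only parsing).
Notation aP := 0 (only parsing).
Notation aPAR := 7 (only parsing).
Notation aO := 10 (only parsing).
Notation aX := 11 (only parsing).
Notation aL := 12 (only parsing).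

Definition xneq (a b : exp) : exp := EAdd (ESub a b) (ESub b a).
Definition incr x := CAsg x (EV x + EC 1)%X.

(** Variable 24 is the number of ones, 23 the length of what is overwritten. *)
Definition fill : cmd :=
  25 ::= EC 0 ;;
  CWhile ($23 - $25)%X (
    CIf ($24 - $25)%X (CSto aX $25 (EC 1)) (CSto aX $25 (EC 0)) ;;
    incr 25).

Definition addup : cmd :=
  21 ::= EC 0 ;; 20 ::= EC 0 ;;
  CWhile ($rm - $20)%X (
    CIf (ELd aX $20) (21 ::= ($21 + EIn (EC 3 + ELd aP ($roff + $20)))%X) CSkip ;;
    incr 20).

Definition copy : cmd :=
  20 ::= EC 0 ;;
  CWhile ($rm - $20)%X (
    CSto aO (ELd aP ($roff + $20)) (ELd aX $20) ;;
    incr 20).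

(** Variable 20 becomes the end of the first run of ones, 22 its length. *)
Definition scan : cmd :=
  20 ::= EC 0 ;; CWhile (EC 1 - ELd aX $20)%X (incr 20) ;;
  22 ::= EC 0 ;; CWhile (ELd aX $20) (incr 20 ;; incr 22).

(** Variable 26 becomes zero after the last subset. *)
Definition next : cmd :=
  scan ;;
  CIf ($rm - $20)%X
    (CSto aX $20 (EC 1) ;; 23 ::= $20 ;; 24 ::= ($22 - EC 1)%X ;; fill)
    (26 ::= EC 0).

(** The lists keep sums only, and a subset is recovered from its sum by a second
    enumeration which copies it to the answer; this serves both purposes. *)
Definition enumerate : cmd :=
  23 ::= $rm ;; 24 ::= $rk ;; fill ;; CSto aX $rm (EC 0) ;;
  19 ::= EC 0 ;; 26 ::= EC 1 ;;
  CWhile $26 (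
    addup ;; CSto aL $19 $21 ;; incr 19 ;;
    CIf (xneq $21 $rtg) CSkip copy ;;
    next).

Lemma xneqE inp s a b : (ev inp s (xneq a b) != 0) = (ev inp s a != ev inp s b).
Proof. by rewrite /=; lia. Qed.

(** Insertion sort, whose quadratic time is within the budget.  For the last two
    blocks [fl] is set and the complements of the sums are sorted instead, so
    that increasing order of keys is decreasing order of sums. *)
Definition insert (fl : bool) (d : nat) : cmd :=
  CSto d (EC 0) (EC 0) ;; 20 ::= EC 0 ;;
  CWhile ($rN - $20)%X (
    21 ::= (if fl then $rG - ELd aL $20 else ELd aL $20)%X ;;
    22 ::= $20 ;;
    CWhile (ELd d $22 - $21)%X (
      CSto d ($22 + EC 1) (ELd d $22) ;; 22 ::= ($22 - EC 1)%X) ;;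
    CSto d ($22 + EC 1) $21 ;;
    incr 20) ;;
  CSto d ($rN + EC 1) $rI.

Definition fixup (T : nat) : cmd :=
  CIf (ELd T ($20 + $20) - ELd T ($20 + $20 + EC 1))%X
    (CSto T $20 (ELd T ($20 + $20 + EC 1)))
    (CSto T $20 (ELd T ($20 + $20))).

(** Row [i] of the tournament enumerates the keys [A i + B j] by increasing [j], and
    [Q i] is its current position.  Leaf [N + i - 1] of the tree holds the
    current key of row [i], and every inner node the minimum of its children. *)
Definition init (T Q A B PR : nat) : cmd :=
  20 ::= EC 1 ;;
  CWhile ($rN + EC 1 - $20)%X (
    CSto Q $20 (EC 1) ;;
    CSto T ($rN + $20 - EC 1) (ELd A $20 + ELd B (EC 1)) ;;
    incr 20) ;;
  20 ::= ($rN - EC 1)%X ;;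
  CWhile $20 (
    fixup T ;;
    CSto PR ($20 + $20) $20 ;; CSto PR ($20 + $20 + EC 1) $20 ;;
    20 ::= ($20 - EC 1)%X).

Definition find (T : nat) : cmd :=
  20 ::= EC 1 ;;
  CWhile ($rN - $20)%X (
    20 ::= ($20 + $20)%X ;;
    CIf (ELd T $20 - ELd T ($20 + EC 1))%X (incr 20) CSkip) ;;
  21 ::= ($20 + EC 1 - $rN)%X.

Definition pop (T Q A B PR : nat) : cmd :=
  find T ;;
  CSto Q $21 (ELd Q $21 + EC 1) ;;
  CSto T $20 (ELd A $21 + ELd B (ELd Q $21)) ;;
  CWhile ($20 - EC 1)%X (20 ::= ELd PR $20 ;; fixup T).

Definition load (off : exp) (fl : bool) (d : nat) : cmd :=
  roff ::= off ;; enumerate ;; rN ::= $19 ;; insert fl d.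

Definition recover (off : exp) (x : nat) : cmd :=
  roff ::= off ;; rtg ::= $x ;; enumerate.

Definition answer : cmd :=
  20 ::= EC 0 ;;
  CWhile ($rn - $20)%X (CWr (ELd aO $20) ;; incr 20) ;; CHalt.

Definition found : cmd :=
  find 5 ;; 13 ::= ELd 1 $21 ;; 14 ::= ELd 2 (ELd 6 $21) ;;
  find 8 ;; 15 ::= ($rG - ELd 3 $21)%X ;; 16 ::= ($rG - ELd 4 (ELd 9 $21))%X ;;
  recover (EC 0) 13 ;; recover $rm 14 ;; recover ($rm + $rm)%X 15 ;;
  recover ($rm + $rm + $rm)%X 16 ;; answer.

(** The second tournament holds twice the total minus the sum of the last two
    blocks, so the two sides agree when the four sums add up to [t]; subtraction
    being truncated, both are written without it. *)
Definition xroot1 : exp := (ELd 5 (EC 1) + ($rG + $rG))%X.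
Definition xroot2 : exp := (ELd 8 (EC 1) + $rt)%X.

(** An enumeration is exhausted when the key at its root reaches [rI]. *)
Definition merge (action : cmd) : cmd :=
  rgo ::= EC 1 ;;
  CWhile $rgo (
    CIf ($rI - ELd 5 (EC 1))%X
      (CIf ($rI - ELd 8 (EC 1))%X
        (CIf (xroot1 - xroot2)%X (pop 8 9 3 4 aPAR)
          (CIf (xroot2 - xroot1)%X (pop 5 6 1 2 aPAR) action))
        (rgo ::= EC 0))
      (rgo ::= EC 0)).

Definition attempt : cmd :=
  load (EC 0) false 1 ;; load $rm false 2 ;;
  load ($rm + $rm)%X true 3 ;; load ($rm + $rm + $rm)%X true 4 ;;
  init 5 6 1 2 aPAR ;; init 8 9 3 4 aPAR ;; merge found.

Definition rotate (eb el : exp) : cmd :=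
  21 ::= ELd aP eb ;; 20 ::= EC 0 ;;
  CWhile (el - EC 1 - $20)%X (
    CSto aP (eb + $20) (ELd aP (eb + $20 + EC 1)) ;; incr 20) ;;
  CSto aP (eb + $20) $21.

Definition xcut (eb el eh : exp) : exp :=
  (xneq (ELd aP eb) (ELd aP (eb + el - EC 1) + $rq) +
   xneq (ELd aP (eb + eh)) (ELd aP (eb + eh - EC 1) + $rq))%X.

(** Runs [body] on those rotations of the segment given by its start [eb], length
    [el] and half length [eh] that are cut at a break. *)
Definition turn (c : nat) (eb el eh : exp) (body : cmd) : cmd :=
  c ::= EC 0 ;;
  CWhile (el - $c)%X (
    CIf (xcut eb el eh) body CSkip ;; rotate eb el ;; incr c).

(** The whole arrangement is rotated, then its first and its second half. *)
Definition level3 := turn 10 ($rm + $rm) ($rm + $rm) $rm attempt.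
Definition level2 := turn 9 (EC 0) ($rm + $rm) $rm level3.
Definition level1 := turn 8 (EC 0) $rn ($rm + $rm) level2.

Definition arrange : cmd :=
  19 ::= EC 0 ;; 20 ::= EC 0 ;;
  CWhile ($rq - $20)%X (
    21 ::= $20 ;;
    CWhile ($rn - $21)%X (
      CSto aP $19 $21 ;; incr 19 ;; 21 ::= ($21 + $rq)%X) ;;
    incr 20).

(** Division by four, as the least [y] with [x <= 4 y]. *)
Definition quarter (x y : nat) : cmd :=
  y ::= EC 0 ;; CWhile ($x - ($y + $y + $y + $y))%X (incr y).

Definition search : cmd :=
  quarter rn rm ;; quarter rl rk ;;
  rG ::= EC 0 ;; 20 ::= EC 0 ;;
  CWhile ($rn - $20)%X (rG ::= ($rG + EIn (EC 3 + $20))%X ;; incr 20) ;;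
  rI ::= ($rG + $rG + EC 1)%X ;;
  rq ::= EC 1 ;;
  CWhile (EC 1) (arrange ;; level1 ;; incr rq).

(** For [l = n] the only candidate is the constant vector.  The search would be too
    slow there, since [N = 1] and its time is quadratic in [m]. *)
Definition ones : cmd :=
  20 ::= EC 0 ;; CWhile ($rn - $20)%X (CWr (EC 1) ;; incr 20) ;; CHalt.

Definition solver : cmd :=
  rn ::= EIn (EC 0) ;; rl ::= EIn (EC 1) ;; rt ::= EIn (EC 2) ;;
  CIf (xneq $rn $rl) search ones.

(** * Enumeration of the subsets of a block *)

Section Attempt.
Variables (inp : seq nat) (V Lam : nat) (H : st -> Prop).
Variables (n l t m k : nat).
Let a i := nth 0 inp (3 + i).
Let N := 'C(m, k).
Definition total := \sum_(0 <= i < n) nth 0 inp (3 + i).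
Hypotheses (hn : n = 4 * m) (hl : l = 4 * k) (k0 : 0 < k) (km : k <= m).
Hypothesis hV : 4 * total + 4 < V.
Hypothesis hV2 : 2 * N + n + 10 < V.
Hypothesis hL : 2 * N + n + 4 < Lam.

Notation wp := (wp inp V Lam H).

Definition base s := [/\ sc s rn = n, sc s rl = l, sc s rt = t &
  [/\ sc s rm = m, sc s rk = k, sc s rG = total & sc s rI = 2 * total + 1]].

Lemma base_keep x A s s' : base s -> keep x A s s' -> 7 <= x -> base s'.
Proof.
move=> [b0 b1 b2 [b3 b4 b5 b6]] K h.
by split; [..|split]; rewrite (keepS K) //; lia.
Qed.

Lemma wp_fill Q s len ones : sc s 23 = len -> sc s 24 = ones -> len <= m ->
  (forall s', keep 25 [:: aX] s s' ->
     (forall j, ar s' aX j = if j < len then (j < ones : nat) else ar s aX j) ->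
     (forall y, 25 < y -> sc s' y = sc s y) ->
     tm s' <= tm s + 4 * len + 2 -> Q s') ->
  wp fill Q s.
Proof.
move=> h23 h24 hlen hQ.
apply: wp_seq; apply: wp_asg => /=; first by lia.
apply: (@wp_for _ _ _ _ len 0 (fun i s' => [/\ keep 25 [:: aX] s s', sc s' 25 = i,
   (forall j, ar s' aX j = if j < i then (j < ones : nat) else ar s aX j) &
   (forall y, 25 < y -> sc s' y = sc s y) /\ tm s' <= tm s + 4 * i + 1])) => //.
- split=> //=; [by apply: keep_asg|split; last by lia].
  by move=> y hy; rewrite -[eqn y 25]/(y == 25) ifF //; lia.
- by move=> i s' hi [K E _ _] /=; rewrite (keepS K) // h23 E; lia.
- move=> i s' hi [K E X [F T]].
  apply: wp_seq; apply: wp_if => /=; rewrite (keepS K) // h24 E => c.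
    apply: wp_sto => /=; rewrite ?E; try lia.
    apply: wp_asg => /=; rewrite E; first by lia.
    split=> /=.
    + by apply: keep_asg => //; apply: keep_sto.
    + by lia.
    + move=> j; rewrite -[eqn j i]/(j == i) X ltnS.
      by case: (ltngtP j i) => // ->; lia.
    + by split; [move=> y hy; rewrite -[eqn y 25]/(y == 25) ifF ?F //; lia|lia].
  apply: wp_sto => /=; rewrite ?E; try lia.
  apply: wp_asg => /=; rewrite E; first by lia.
  split=> /=.
  + by apply: keep_asg => //; apply: keep_sto.
  + by lia.
  + move=> j; rewrite -[eqn j i]/(j == i) X ltnS.
    by case: (ltngtP j i) => // ->; lia.
  + by split; [move=> y hy; rewrite -[eqn y 25]/(y == 25) ifF ?F //; lia|lia].
- by move=> s' [K E X [F T]]; apply: hQ => //=; lia.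
Qed.

(** The final zero stops the scan of a run of ones that reaches the end. *)
Definition bits s (str : bitseq) :=
  (forall j, j < m -> ar s aX j = nth false str j) /\ ar s aX m = 0.

Lemma bits_keep x A s s' str : bits s str -> keep x A s s' -> aX \notin A -> bits s' str.
Proof. by move=> [b1 b2] K h; rewrite /bits (keepA K). Qed.

Lemma wp_scan Q s b c str tl : base s -> bits s str -> size str = m ->
  str = nseq b false ++ nseq c.+1 true ++ tl -> head false tl = false ->
  (forall s', keep 20 [::] s s' -> sc s' 20 = b + c.+1 -> sc s' 22 = c.+1 ->
     (forall y, 22 < y -> sc s' y = sc s y) ->
     tm s' <= tm s + 3 * m + 4 -> Q s') ->
  wp scan Q s.
Proof.
move=> bs [X X0] sz E hd hQ.
have szE : m = b + c.+1 + size tl by rewrite -sz E !size_cat !size_nseq addnA.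
have Xb j : j < b -> ar s aX j = 0.
  by move=> h; rewrite X; [rewrite E nth_cat size_nseq h nth_nseq h|lia].
have Xc j : b <= j < b + c.+1 -> ar s aX j = 1.
  move=> h; rewrite X; last by lia.
  rewrite E nth_cat size_nseq ifF; last by lia.
  rewrite nth_cat size_nseq ifT; last by lia.
  by rewrite nth_nseq ifT //; lia.
have Xe : ar s aX (b + c.+1) = 0.
  case: (posnP (size tl)) => h; first by rewrite -[RHS]X0; congr (ar s aX _); lia.
  rewrite X; last by lia.
  rewrite E nth_cat size_nseq ifF; last by lia.
  rewrite nth_cat size_nseq ifF; last by lia.
  have -> : b + c.+1 - b - c.+1 = 0 by lia.
  by rewrite nth0 hd.
apply: wp_seq; apply: wp_asg => /=; first by lia.
apply: wp_seq.
apply: (@wp_for _ _ _ _ b 0 (fun i s' => [/\ keep 20 [::] s s', sc s' 20 = i,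
   (forall y, 22 < y -> sc s' y = sc s y) & tm s' <= tm s + 2 * i + 1])) => //.
- split=> //=; [by apply: keep_asg| |by lia].
  by move=> y hy; rewrite -[eqn y 20]/(y == 20) ifF //; lia.
- move=> i s' hi [K E' _ _] /=; rewrite (keepA K) // E'.
  case: (ltngtP i b) hi => // h _; first by rewrite Xb.
  by rewrite Xc //; lia.
- move=> i s' hi [K E' F T]; apply: wp_asg => /=; rewrite E'; first by lia.
  split=> //=; [by apply: keep_asg|by lia| |by lia].
  by move=> y hy; rewrite -[eqn y 20]/(y == 20) ifF ?F //; lia.
move=> s1 [K1 E1 F1 T1]; apply: wp_seq; apply: wp_asg => /=; first by lia.
apply: (@wp_for _ _ _ _ c.+1 0 (fun i s' => [/\ keep 20 [::] s s', sc s' 20 = b + i, sc s' 22 = i,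
   (forall y, 22 < y -> sc s' y = sc s y) & tm s' <= tm s + 2 * b + 3 + 3 * i])) => //.
- split=> //=; [by apply: keep_asg|by lia| |by lia].
  by move=> y hy; rewrite -[eqn y 22]/(y == 22) ifF ?F1 //; lia.
- move=> i s' hi [K E' _ _ _] /=; rewrite (keepA K) // E'.
  case: (ltngtP i c.+1) hi => // h _; first by rewrite Xc //; lia.
  by rewrite h Xe.
- move=> i s' hi [K E2 E3 F T]; apply: wp_seq; apply: wp_asg => /=; rewrite E2; first by lia.
  apply: wp_asg => /=; rewrite E3; first by lia.
  split=> //=; [by do 2 apply: keep_asg => //|by lia|by lia| |by lia].
  move=> y hy; rewrite -[eqn y 22]/(y == 22) -[eqn y 20]/(y == 20).
  by rewrite !ifF ?F //; lia.
- by move=> s' [K E2 E3 F T]; apply: hQ => //=; lia.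
Qed.

Variable p : nat -> nat.
Hypothesis hp : perm_eq (mkseq p n) (iota 0 n).
Definition block_sum off (str : bitseq) := \sum_(0 <= j < m) a (p (off + j)) * nth false str j.

Lemma p_lt i : i < n -> p i < n.
Proof.
move=> h; have := perm_mem hp (p i); rewrite mem_iota /= add0n => <-.
by apply/mapP; exists i => //; rewrite mem_iota.
Qed.

Lemma p_inj i j : i < n -> j < n -> p i = p j -> i = j.
Proof.
move=> hi hj E; have := perm_uniq hp; rewrite iota_uniq => U.
apply/eqP; rewrite -(nth_uniq 0 _ _ U) ?size_mkseq // !nth_mkseq //; exact/eqP.
Qed.

Lemma sum_perm (f : nat -> nat) : \sum_(0 <= j < n) f (p j) = \sum_(0 <= i < n) f i.
Proof.
have := perm_big (op := addn) (x := 0) _ hp (P := xpredT) (F := f).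
by rewrite /= /mkseq big_map /index_iota subn0.
Qed.

Lemma psum_le off i : off + i <= n -> \sum_(0 <= j < i) a (p (off + j)) <= total.
Proof.
move=> h; rewrite /total -(sum_perm a) [X in _ <= X](@big_cat_nat _ _ _ off) /=; [|lia|lia].
rewrite [X in _ <= _ + X](@big_cat_nat _ _ _ (off + i)) /=; [|lia|lia].
have -> : \sum_(off <= j < off + i) a (p j) = \sum_(0 <= j < i) a (p (j + off)).
  by rewrite -[X in \sum_(X <= _ < _) _ = _]add0n big_addn addKn.
rewrite (eq_bigr (fun j => a (p (j + off)))); last by move=> j _; rewrite addnC.
lia.
Qed.

Definition ctx s := base s /\ ar s aP = p.

Lemma ctx_keep x A s s' : ctx s -> keep x A s s' -> 7 <= x -> aP \notin A -> ctx s'.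
Proof. by move=> [b e] K h hA; split; [apply: base_keep K h|rewrite (keepA K)]. Qed.

Lemma wp_addup Q s off str : ctx s -> bits s str -> sc s roff = off -> off + m <= n ->
  (forall s', keep 20 [::] s s' -> sc s' 21 = block_sum off str ->
     (forall y, 22 < y -> sc s' y = sc s y) ->
     tm s' <= tm s + 4 * m + 3 -> Q s') ->
  wp addup Q s.
Proof.
move=> [[b0 _ _ [b3 _ _ _]] hpe] [X X0] ho hoff hQ.
apply: wp_seq; apply: wp_asg => /=; first by lia.
apply: wp_seq; apply: wp_asg => /=; first by lia.
apply: (@wp_for _ _ _ _ m 0 (fun i s' => [/\ keep 20 [::] s s', sc s' 20 = i,
   sc s' 21 = \sum_(0 <= j < i) a (p (off + j)) * nth false str j,
   (forall y, 22 < y -> sc s' y = sc s y) & tm s' <= tm s + 4 * i + 2])) => //.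
- split=> //=; [by do 2 apply: keep_asg => //|by rewrite big_geq| |by lia].
  move=> y hy; rewrite -[eqn y 21]/(y == 21) -[eqn y 20]/(y == 20).
  by rewrite !ifF //; lia.
- by move=> i s' hi [K E' _ _ _] /=; rewrite (keepS K) // E' b3; lia.
- move=> i s' hi [K E1 E2 F T].
  have le : \sum_(0 <= j < i.+1) a (p (off + j)) * nth false str j <= total.
    apply: leq_trans (@psum_le off i.+1 _); last by lia.
    by apply: leq_sum => j _; case: (nth _ _ _); rewrite ?muln1 ?muln0.
  apply: wp_seq; apply: wp_if => /=; rewrite (keepA K aX isT) E1 X; try lia.
  + case N1 : (nth false str i) => // _.
    apply: wp_asg => /=; rewrite (keepS K roff isT) (keepA K aP isT) E1 E2 ho hpe -/(a _).
      by move: le; rewrite big_nat_recr //= N1 muln1; lia.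
    apply: wp_asg => /=; rewrite E1; first by lia.
    split=> //=; [by do 2 apply: keep_asg => //|by lia|by rewrite big_nat_recr //= N1 muln1| |by lia].
    move=> y hy; rewrite -[eqn y 21]/(y == 21) -[eqn y 20]/(y == 20).
    by rewrite !ifF ?F //; lia.
  + case N1 : (nth false str i) => // _.
    apply: wp_skip; apply: wp_asg => /=; rewrite E1; first by lia.
    split=> //=; [by do 2 apply: keep_asg => //|by lia|by rewrite big_nat_recr //= N1 muln0 addn0| |by lia].
    move=> y hy; rewrite -[eqn y 20]/(y == 20).
    by rewrite !ifF ?F //; lia.
- by move=> s' [K E1 E2 F T]; apply: hQ => //=; lia.
Qed.

Lemma wp_copy Q s off str : ctx s -> bits s str -> sc s roff = off -> off + m <= n ->
  (forall s', keep 20 [:: aO] s s' ->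
     (forall j, j < m -> ar s' aO (p (off + j)) = nth false str j) ->
     (forall i, (forall j, j < m -> p (off + j) != i) -> ar s' aO i = ar s aO i) ->
     (forall y, 20 < y -> sc s' y = sc s y) ->
     tm s' <= tm s + 3 * m + 2 -> Q s') ->
  wp copy Q s.
Proof.
move=> [[b0 _ _ [b3 _ _ _]] hpe] [X X0] ho hoff hQ.
apply: wp_seq; apply: wp_asg => /=; first by lia.
apply: (@wp_for _ _ _ _ m 0 (fun i s' => [/\ keep 20 [:: aO] s s', sc s' 20 = i,
   (forall j, j < i -> ar s' aO (p (off + j)) = nth false str j) /\
   (forall z, (forall j, j < m -> p (off + j) != z) -> ar s' aO z = ar s aO z),
   (forall y, 20 < y -> sc s' y = sc s y) & tm s' <= tm s + 3 * i + 1])) => //.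
- split=> //=; [by do 2 apply: keep_asg => //| |by lia].
  move=> y hy; rewrite -[eqn y 20]/(y == 20).
  by rewrite !ifF //; lia.
- by move=> i s' hi [K E' _ _ _] /=; rewrite (keepS K) // E' b3; lia.
- move=> i s' hi [K E1 [E2 E3] F T].
  have plt := @p_lt (off + i) ltac:(lia).
  apply: wp_seq; apply: wp_sto => /=; rewrite ?(keepS K roff isT) ?(keepA K aP isT) ?(keepA K aX isT) ?E1 ?ho ?hpe; try lia.
    by rewrite X; [case: nth; lia|lia].
  apply: wp_asg => /=; rewrite E1; first by lia.
  split=> //=; [by apply: keep_asg => //; apply: keep_sto|by lia|split| |by lia].
  + move=> j hj; rewrite /upd -[eqn _ _]/(p (off + j) == p (off + i)).
    case: eqP => [E|ne].
      have := @p_inj (off + j) (off + i) ltac:(lia) ltac:(lia) E => /addnI ->.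
      by rewrite X //; lia.
    apply: E2; case: (eqVneq j i) ne => [->//|]; lia.
  + move=> z hz; rewrite /upd -[eqn _ _]/(z == p (off + i)) eq_sym.
    by rewrite (negbTE (hz i _)) ?E3 //; lia.
  + move=> y hy; rewrite -[eqn y 20]/(y == 20).
    by rewrite !ifF ?F //; lia.
- by move=> s' [K E1 [E2 E3] F T]; apply: hQ => //=; lia.
Qed.

Lemma colex_shape r : r < N -> exists b c tl,
  nth [::] (colex m k) r = nseq b false ++ nseq c.+1 true ++ tl /\
  ((r.+1 = N /\ tl = [::]) \/
   r.+1 < N /\ exists tl', tl = false :: tl' /\
     nth [::] (colex m k) r.+1 = nseq c true ++ nseq b.+1 false ++ true :: tl').
Proof.
rewrite leq_eqVlt => /orP[/eqP rN|rN].
  have := last_colex km; rewrite -/N -rN /= => ->.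
  exists (m - k), k.-1, [::]; rewrite cats0; split; last by left.
  by congr (_ ++ _); case: (k) k0.
have [c [b [tl [E1 E2]]]] := colex_next rN.
by exists b, c, (false :: tl); split=> //; right; split=> //; exists tl.
Qed.

Lemma size_nth_colex r : r < N -> size (nth [::] (colex m k) r) = m.
Proof.
move=> h; have := mem_nth [::] (s := colex m k) (n := r).
by rewrite size_colex mem_colex => /(_ h) /andP[/eqP].
Qed.

Lemma wp_next Q s r : base s -> r < N -> bits s (nth [::] (colex m k) r) ->
  sc s 26 = 1 ->
  (forall s', keep 20 [:: aX] s s' -> sc s' 26 = (r.+1 < N) ->
     (r.+1 < N -> bits s' (nth [::] (colex m k) r.+1)) ->
     tm s' <= tm s + 7 * m + 10 -> Q s') ->
  wp next Q s.
Proof.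
move=> bs rN X h26 hQ; have sz := size_nth_colex rN.
have [b [c [tl [E Ht]]]] := colex_shape rN.
have szE : m = b + c.+1 + size tl by rewrite -sz E !size_cat !size_nseq addnA.
apply: wp_seq; apply: (wp_scan bs X sz E); first by case: Ht => [[_ ->]|[_ [tl' [->]]]].
move=> s1 K1 E20 E22 F T1; have [X1 X2] := X.
have bs1 := base_keep bs K1 isT; case: (bs1) => _ _ _ [b3 _ _ _].
apply: wp_if => /=; rewrite b3 E20 => c1.
- case: Ht => [[_ tl0]|[rN1 [tl' [tlE E']]]]; first by move: szE; rewrite tl0 /=; lia.
  have btl : size tl = (size tl').+1 by rewrite tlE.
  apply: wp_seq; apply: wp_sto => /=; rewrite ?E20; try lia.
  apply: wp_seq; apply: wp_asg => /=; rewrite ?E20; first by lia.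
  apply: wp_seq; apply: wp_asg => /=; rewrite ?E22; first by lia.
  apply: (@wp_fill _ _ (b + c.+1) c) => /=; try lia.
  move=> s2 K2 Y F2 T2; apply: hQ.
  + apply: (keep_weak_trans _ K2) => //.
    do 2 apply: keep_asg => //; apply: keep_sto => //; apply: keep_tick.
    by apply: (keep_weak K1).
  + by rewrite F2 //= F // h26; lia.
  + move=> _; split.
      move=> j hj; rewrite Y /= -[eqn j _]/(j == _) E' nth_cat size_nseq nth_nseq.
      rewrite nth_cat size_nseq nth_nseq.
      case: (ltnP j (b + c.+1)) => h1; case: (ltnP j c) => h2 //; try lia.
        by rewrite ifT ?if_same //; lia.
      rewrite (_ : (j - c < b.+1) = false); last by lia.
      case: eqP => [->|ne]; first by have -> : b + c.+1 - c - b.+1 = 0 by lia.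
      rewrite (keepA K1) // X1 // E nth_cat size_nseq ifF; last by lia.
      rewrite nth_cat size_nseq ifF; last by lia.
      rewrite tlE; have -> : j - b - c.+1 = (j - c - b.+1.+1).+1 by lia.
      by have -> : j - c - b.+1 = (j - c - b.+1.+1).+1 by lia.
    rewrite Y /= ifF; last by lia.
    by rewrite -[eqn m _]/(m == _) ifF ?(keepA K1) //; lia.
  + by move: T2 => /=; lia.
- case: Ht => [[rN1 tl0]|[rN1 [tl' [tlE E']]]]; last by move: szE; rewrite tlE /=; lia.
  apply: wp_asg => /=; first by lia.
  apply: hQ => /=.
  + apply: keep_asg => //; apply: keep_tick; by apply: (keep_weak K1).
  + by rewrite rN1 ltnn.
  + by rewrite rN1 ltnn.
  + by lia.
Qed.

(** The list receives the sums in colexicographic order.  If some subset has the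
    sum in [rtg], the last such subset is left in the answer, whose cells outside
    the block are unchanged. *)
Lemma wp_enumerate Q s off : ctx s -> sc s roff = off -> off + m <= n ->
  (forall s', keep 19 [:: aO; aX; aL] s s' -> sc s' 19 = N ->
     (forall r, r < N -> ar s' aL r = block_sum off (nth [::] (colex m k) r)) ->
     (forall i, (forall j, j < m -> p (off + j) != i) -> ar s' aO i = ar s aO i) ->
     ((exists2 str, str \in colex m k & block_sum off str = sc s rtg) ->
      exists str, [/\ str \in colex m k, block_sum off str = sc s rtg &
        forall j, j < m -> ar s' aO (p (off + j)) = nth false str j]) ->
     tm s' <= tm s + (14 * m + 30) * N + 4 * m + 10 -> Q s') ->
  wp enumerate Q s.
Proof.
move=> cs ho hoff hQ; have [bs hpe] := cs; have [b0 b1 b2 [b3 b4 b5 b6]] := bs.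
have N0 : 0 < N by rewrite bin_gt0.
apply: wp_seq; apply: wp_asg => /=; first by lia.
apply: wp_seq; apply: wp_asg => /=; first by lia.
apply: wp_seq; apply: (@wp_fill _ _ m k) => /=; rewrite ?b3 ?b4 //.
move=> s1 K1 X1 _ T1.
have K1' : keep 19 [:: aO; aX; aL] s s1.
  apply: (keep_weak_trans _ K1) => //.
  by do 2 apply: keep_asg => //.
have cs1 := ctx_keep cs K1' isT isT.
have [[_ _ _ [c3 _ _ _]] _] := cs1.
apply: wp_seq; apply: wp_sto => /=; rewrite ?c3; try lia.
apply: wp_seq; apply: wp_asg => /=; first by lia.
apply: wp_seq; apply: wp_asg => /=; first by lia.
pose O1 s' := forall i, (forall j, j < m -> p (off + j) != i) -> ar s' aO i = ar s aO i.
pose O2 r s' := (exists2 r', r' < r & block_sum off (nth [::] (colex m k) r') = sc s rtg) ->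
  exists r', [/\ r' < r, block_sum off (nth [::] (colex m k) r') = sc s rtg &
        forall j, j < m -> ar s' aO (p (off + j)) = nth false (nth [::] (colex m k) r') j].
pose J r s' := [/\ keep 19 [:: aO; aX; aL] s s', sc s' 19 = r, sc s' 26 = (r < N) &
   [/\ (r < N -> bits s' (nth [::] (colex m k) r)),
    (forall r', r' < r -> ar s' aL r' = block_sum off (nth [::] (colex m k) r')),
    O1 s', O2 r s' & tm s' <= tm s + 4 * m + 7 + (14 * m + 30) * r]].
apply: (@wp_for _ _ _ _ N 0 J) => //.
- split=> /=; [|by []|by rewrite N0|split=> //=].
  + by do 2 apply: keep_asg => //; apply: keep_sto.
  + move=> _; rewrite head_colex //; split; last by rewrite /= -[eqn _ _]/(m == m) eqxx.
    move=> j hj; rewrite /= -[eqn j m]/(j == m) ifF; last by lia.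
    rewrite X1 hj nth_cat size_nseq !nth_nseq; case: ltnP => //.
    by rewrite if_same.
  + by move=> i hi; rewrite /= (keepA K1 aO isT).
  + by case.
  + by move: T1 => /=; lia.
- by move=> r s' _ [_ _ E26 _] /=; rewrite E26; case: ltnP.
- move=> r s2 hr [K2 E19 E26 [X2 L2 P1 P2 T2]].
  have rN : r < N by lia.
  have X := X2 rN; set str := nth [::] _ r in X.
  have cs2 := ctx_keep cs K2 isT isT; have [bs2 hpe2] := cs2.
  apply: wp_seq; apply: (@wp_addup _ (tick s2) off str) => //=.
    by rewrite (keepS K2).
  move=> s3 K3 E21 F3 T3.
  have K3' : keep 19 [:: aO; aX; aL] s s3 by apply: (keep_weak_trans K2 K3).
  have E19' : sc s3 19 = r by rewrite (keepS K3).
  have le : block_sum off str <= total.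
    apply: leq_trans (@psum_le off m hoff).
    by apply: leq_sum => j _; case: (nth _ _ _); rewrite ?muln1 ?muln0.
  apply: wp_seq; apply: wp_sto => /=; rewrite ?E19' ?E21; try lia.
  apply: wp_seq; apply: wp_asg => /=; rewrite E19'; first by lia.
  set s4 := asg _ _ _.
  have K4 : keep 19 [:: aO; aX; aL] s s4 by apply: keep_asg => //; apply: keep_sto.
  have X3 : bits s3 str by apply: (bits_keep (s := tick s2) X K3).
  have Xs4 : bits s4 str := X3.
  have L4 r' : r' < r.+1 -> ar s4 aL r' = block_sum off (nth [::] (colex m k) r').
    rewrite ltnS /= -[eqn r' r]/(r' == r) (keepA K3) //=.
    by case: eqP => [->//|ne] h; apply: L2; lia.
  have P14 : O1 s4 by move=> i hi /=; rewrite (keepA K3) //= P1.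
  have T4 : tm s4 <= tm s2 + 4 * m + 6 by move: T3 => /=; lia.
  have E26' : sc s4 26 = 1 by rewrite /= F3 //= E26 rN.
  have E194 : sc s4 19 = r.+1 by rewrite /=; lia.
  have O4 z : ar s4 aO z = ar s2 aO z by rewrite /= (keepA K3).
  have E214 : sc s4 21 = block_sum off str by [].
  clearbody s4; clear s3 K3 E21 F3 T3 K3' E19' X3.
  have cs4 := ctx_keep cs K4 isT isT; have [bs4 hpe4] := cs4.
  have fin s5 : keep 19 [:: aO; aX; aL] s s5 -> sc s5 19 = r.+1 -> sc s5 26 = 1 ->
     bits s5 str -> ar s5 aL = ar s4 aL -> O1 s5 -> O2 r.+1 s5 ->
     tm s5 <= tm s4 + 3 * m + 4 -> wp next (J r.+1) s5.
    move=> K5 E5 E5' X5 L5 P5 P5' T5.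
    have cs5 := ctx_keep cs K5 isT isT.
    apply: (wp_next cs5.1 rN X5 E5') => s6 K6 G26 X6 T6; split=> //.
    + by apply: (keep_weak_trans K5 K6).
    + by rewrite (keepS K6).
    + split=> //.
      * by move=> r' hr'; rewrite (keepA K6) // L5 L4.
      * by move=> i hi; rewrite (keepA K6) // P5.
      * by move=> /P5'[r' [h1 h2 h3]]; exists r'; split=> // j hj; rewrite (keepA K6) // h3.
      * lia.
  apply: wp_seq; apply: wp_if => c0; have := xneqE inp s4 $21 $rtg; rewrite ?c0 => c1.
  + apply: wp_skip; apply: fin => //=; last by lia.
    move=> [r' h1 h2].
    have ne' : r' != r.
      by apply/eqP => h; move: c1; rewrite /= E214 (keepS K4 rtg isT) -h2 h -/str eqxx.
    have [r2 [g1 g2 g3]] : exists r'0, [/\ r'0 < r, block_sum off (nth [::] (colex m k) r'0) = sc s rtg &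
        forall j, j < m -> ar s2 aO (p (off + j)) = nth false (nth [::] (colex m k) r'0) j].
      by apply: P2; exists r' => //; lia.
    by exists r2; split=> //; [lia|move=> j hj; rewrite /= O4 g3].
  + have eqt : block_sum off str = sc s4 rtg.
      by apply/eqP; rewrite -E214; move: c1 => /=; lia.
    apply: (@wp_copy _ (tick s4) off str) => //=; first by rewrite (keepS K4).
    move=> s5 K5 O5 O5' F5 T5; apply: fin => //=.
    * by apply: (keep_weak_trans K4 K5).
    * by rewrite (keepS K5).
    * by rewrite F5.
    * by apply: bits_keep Xs4 K5 _.
    * by rewrite (keepA K5).
    * by move=> i hi; rewrite O5' //= P14.
    * move=> _; exists r; split=> //.
      by rewrite eqt (keepS K4).
    * by move: T5 => /=; lia.
- move=> s' [K E19 _ [_ L P1 P2 T]]; apply: hQ => //=.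
    case=> str hs hb.
    have hi : index str (colex m k) < N by rewrite -[N]size_colex index_mem.
    have [|r [h1 h2 h3]] := P2; first by exists (index str (colex m k)); rewrite ?nth_index.
    by exists (nth [::] (colex m k) r); split=> //; rewrite mem_nth ?size_colex.
  lia.
Qed.

(** * Sorted lists and tournaments *)

Let N0 : 0 < N. Proof. by rewrite bin_gt0. Qed.

(** The zero in front stops an insertion, and the sentinel behind, which exceeds
    the sum of any two keys, marks the end of a row. *)
Definition sorted_keys (D : nat -> nat) (f : nat -> nat) : Prop :=
  [/\ D 0 = 0 /\ D N.+1 = 2 * total + 1,
      forall i j, 0 < i -> i <= j -> j <= N -> D i <= D j,
      forall i, 0 < i <= N -> exists2 r, r < N & D i = f r &
      forall r, r < N -> exists2 i, 0 < i <= N & D i = f r].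

Lemma wp_insert Q s fl d g : base s -> sc s rN = N -> d < aL ->
  (forall r, r < N -> ar s aL r = g r /\ g r <= total) ->
  (forall s', keep 19 [:: d] s s' ->
     sorted_keys (ar s' d) (fun r => if fl then total - g r else g r) ->
     tm s' <= tm s + (3 * N + 8) * N + 5 -> Q s') ->
  wp (insert fl d) Q s.
Proof.
move=> bs sN dL hg hQ; have [b0 b1 b2 [b3 b4 b5 b6]] := bs.
have dd : eqn d d = true by rewrite -[eqn d d]/(d == d) eqxx.
have Ld : eqn aL d = false by rewrite -[eqn aL d]/(aL == d); lia.
pose f r := if fl then total - g r else g r.
have fle r : r < N -> f r <= total by move/hg => -[_]; rewrite /f; case: (fl); lia.
apply: wp_seq; apply: wp_sto => /=; try lia.
apply: wp_seq; apply: wp_asg => /=; first by lia.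
apply: wp_seq.
pose J r s' := [/\ keep 19 [:: d] s s', sc s' 20 = r, 
   [/\ ar s' d 0 = 0, forall i j, 0 < i -> i <= j -> j <= r -> ar s' d i <= ar s' d j,
      forall i, 0 < i <= r -> exists2 r', r' < r & ar s' d i = f r' &
      forall r', r' < r -> exists2 i, 0 < i <= r & ar s' d i = f r'] &
   tm s' <= tm s + 2 + (3 * N + 8) * r].
apply: (@wp_for _ _ _ _ N 0 J) => //.
- split=> //=; [|split=> //=; try lia|lia].
  + by apply: keep_asg => //; apply: keep_sto; rewrite ?inE.
  + by rewrite dd.
- by move=> r s' hr [K E _ _] /=; rewrite (keepS K rN isT) sN E; lia.
- move=> r s1 hr [K E [D0 Ds Dm Df] T].
  have rr : r < N by lia.
  have [gr1 gr2] := hg r rr; have frl := fle r rr.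
  have evf : ev inp (tick s1) (if fl then $rG - ELd aL $20 else ELd aL $20)%X = f r.
    have aLd : aL \notin [:: d] by rewrite inE; lia.
    by rewrite /f; case: (fl) => /=; rewrite ?(keepS K rG isT) ?b5 (keepA K aL aLd) E gr1.
  apply: wp_seq; apply: wp_asg; rewrite evf; first by lia.
  apply: wp_seq; apply: wp_asg => /=; rewrite E; first by lia.
  set s2 := asg _ _ _.
  have K2 : keep 19 [:: d] s s2 by do 2 apply: keep_asg => //.
  pose D i := ar s1 d i.
  apply: wp_seq.
  apply: (@wp_while _ _ _ _ (fun s' => [/\ keep 20 [:: d] s2 s', sc s' 20 = r /\ sc s' 21 = f r,
     sc s' 22 <= r, (forall i, i <= sc s' 22 -> ar s' d i = D i) /\
     (forall i, (sc s' 22).+1 < i <= r.+1 -> ar s' d i = D i.-1 /\ f r < D i.-1) &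
     tm s' + 3 * sc s' 22 <= tm s1 + 3 + 3 * r]) (fun s' => sc s' 22)).
  + split=> //=; [split=> //; lia|lia].
  + move=> s3 [K3 [E20 E21] le [P1 P2] T3] /= c0.
    set j := sc s3 22 in le P1 P2 T3 c0 *.
    have Dj : D j <= f r by rewrite -P1 //; lia.
    apply: wp_seq; apply: wp_sto => /=; rewrite -/j ?E21; try lia.
    apply: wp_asg => /=; rewrite E20; first by lia.
    have PD i : ar (asg (sto (tick s3) d (j + 1) (f r)) 20 (r + 1)) d i =
       if i == j.+1 then f r else ar s3 d i.
      by rewrite /= dd /= -[eqn i _]/(i == j + 1) addn1.
    set s5 := asg _ _ _ in PD *.
    split.
    * rewrite /s5; apply: keep_asg => //; apply: keep_sto; rewrite ?inE //.
      by apply: (keep_weak_trans K2 K3) => //=; rewrite inE eqxx.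
    * by rewrite /=; lia.
    * split.
      - by rewrite PD P1 // /D D0.
      - move=> i i' i0 ii hi'; rewrite !PD.
        case: (ltngtP i j.+1) => hi; case: (ltngtP i' j.+1) => hi'2; try lia.
        + by rewrite !P1; try lia; apply: Ds; lia.
        + rewrite P1; last by lia.
          by have [-> _] := P2 i' ltac:(lia); apply: Ds; lia.
        + rewrite P1; last by lia.
          by apply: leq_trans Dj; apply: Ds; lia.
        + have [-> _] := P2 i ltac:(lia); have [-> _] := P2 i' ltac:(lia).
          by apply: Ds; lia.
        + by have [-> ] := P2 i' ltac:(lia); lia.
      - move=> i hi; rewrite PD; case: (ltngtP i j.+1) => h1.
        + rewrite P1; last by lia.
          have [|r' h2 h3] := Dm i; first by lia.
          by exists r' => //; lia.
        + have [-> _] := P2 i ltac:(lia).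
          have [|r' h2 h3] := Dm i.-1; first by lia.
          by exists r' => //; lia.
        + by exists r.
      - move=> r'; rewrite ltnS leq_eqVlt => /orP[/eqP->|h].
          by exists j.+1; [lia|rewrite PD eqxx].
        have [i hi Ei] := Df _ h.
        case: (leqP i j) => h1.
          by exists i; [lia|rewrite PD ifF ?P1 //; lia].
        exists i.+1; [lia|rewrite PD ifF; last by lia].
        by have [-> _] := P2 i.+1 ltac:(lia).
    * by move: T T3 => /=; nia.
  + move=> s3 [K3 [E20 E21] le [P1 P2] T3] /= c0.
    set j := sc s3 22 in le P1 P2 T3 c0 *.
    have hD : f r < D j by rewrite -P1 //; lia.
    have j0 : 0 < j by case: (j) hD => //; rewrite /D D0.
    have [r' hr' Er'] := Dm j ltac:(lia).
    have Dle : D j <= total by rewrite /D Er'; apply: fle; lia.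
    apply: wp_seq; apply: wp_sto => /=; rewrite -/j ?P1 //; try lia.
    apply: wp_asg => /=; rewrite -/j; first by lia.
    have PD i : upd (ar s3 d) (j + 1) (D j) i = if i == j.+1 then D j else ar s3 d i.
      by rewrite /= -[eqn i _]/(i == j + 1) addn1.
    rewrite dd; split; last by lia.
    split.
    * by apply: keep_asg => //; apply: keep_sto; rewrite ?inE.
    * by [].
    * lia.
    * split=> i hi.
        by rewrite (PD i) ifF ?P1 //; lia.
      rewrite (PD i); case: eqP => [->|ne] //.
      by apply: P2; lia.
    * by rewrite /=; lia.
- move=> s1 [K E [D0 Ds Dm Df] T].
  apply: wp_sto => /=; rewrite ?(keepS K rN isT) ?(keepS K rI isT) ?sN ?b6; try lia.
  have PD i : ar (sto (tick s1) d (N + 1) (2 * total + 1)) d i =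
       if i == N.+1 then 2 * total + 1 else ar s1 d i.
    by rewrite /= dd /= -[eqn i _]/(i == N + 1) addn1.
  apply: hQ => //.
  + by apply: keep_sto; rewrite ?inE.
  + split.
    * by rewrite !PD eqxx.
    * by move=> i j i0 ij jN; rewrite !PD !ifF; [apply: Ds|lia|lia].
    * by move=> i hi; rewrite PD ifF; [apply: Dm|lia].
    * by move=> r hr; have [i hi Ei] := Df _ hr; exists i; rewrite // PD ifF //; lia.
  + by move: T => /=; lia.
Qed.

Let lg := trunc_log 2 (2 * N).

Section Side.
Variables (T Q A B PR : nat).
(** The five arrays are distinct, stated with [eqn] to match [upd]. *)
Hypothesis dis : [/\ [/\ eqn T T, eqn Q Q & eqn PR PR],
  [/\ eqn A T = false, eqn A Q = false, eqn B T = false & eqn B Q = false],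
  [/\ eqn Q T = false, eqn T Q = false, eqn T PR = false & eqn PR T = false] &
  [/\ eqn Q PR = false, eqn PR Q = false, eqn A PR = false & eqn B PR = false]].

Let ds : ((eqn T T = true) * (eqn Q Q = true) * (eqn PR PR = true)) *
  ((eqn A T = false) * (eqn A Q = false) * (eqn B T = false) * (eqn B Q = false)) *
  ((eqn Q T = false) * (eqn T Q = false) * (eqn T PR = false) * (eqn PR T = false)) *
  ((eqn Q PR = false) * (eqn PR Q = false) * (eqn A PR = false) * (eqn B PR = false)).
Proof. by case: dis => -[-> -> ->] [-> -> -> ->] [-> -> -> ->] [-> -> -> ->]. Qed.

Definition node (F : nat -> nat) (i : nat) := F i = minn (F (i + i)) (F (i + i + 1)).
Definition parents (s : st) := forall j, 1 < j < 2 * N -> ar s PR j = j./2.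
Definition lists (s : st) := exists f g,
  [/\ sorted_keys (ar s A) f, sorted_keys (ar s B) g &
      forall r, r < N -> f r <= total /\ g r <= total].
(** The invariant of one tournament. *)
Definition side (s : st) :=
  [/\ forall i, 0 < i <= N -> 0 < ar s Q i <= N.+1,
      forall i, 0 < i <= N -> ar s T (N + i - 1) = ar s A i + ar s B (ar s Q i),
      forall i, 0 < i < N -> node (ar s T) i &
      forall i, 0 < i < 2 * N -> ar s T i <= 3 * total + 1].

Lemma lists_le s : lists s ->
  [/\ forall i, 0 < i <= N -> ar s A i <= total,
      forall i, 0 < i <= N -> ar s B i <= total &
      ar s B N.+1 = 2 * total + 1].
Proof.
move=> [f [g [[_ _ Am _] [[_ Be] _ Bm _] fg]]]; split=> //.
- by move=> i /Am[r hr ->]; case: (fg _ hr).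
- by move=> i /Bm[r hr ->]; case: (fg _ hr).
Qed.

Lemma key_le s i q : lists s -> 0 < i <= N -> 0 < q <= N.+1 ->
  ar s A i + ar s B q <= 3 * total + 1.
Proof.
move=> /lists_le[hA hB hBe] hi hq; have := hA _ hi.
case: (eqVneq q N.+1) => [->|ne]; first by rewrite hBe; lia.
by have := hB q ltac:(lia); lia.
Qed.

Lemma root_min F : (forall i, 0 < i < N -> node F i) ->
  forall j, 0 < j < 2 * N -> F 1 <= F j.
Proof.
move=> h j; have [d] := ubnP j; elim: d j => // d IH j jd hj.
case: (eqVneq j 1) => [->//|j1].
apply: leq_trans (IH j./2 _ _) _; try lia.
rewrite (h j./2); last by lia.
have [E|E] : j = j./2 + j./2 \/ j = j./2 + j./2 + 1 by lia.
  have -> : F j = F (j./2 + j./2) by rewrite -E.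
  exact: geq_minl.
have -> : F j = F (j./2 + j./2 + 1) by rewrite -E.
exact: geq_minr.
Qed.

Lemma wp_fixup P s i : sc s 20 = i -> 0 < i < N ->
  ar s T (i + i) <= 3 * total + 1 -> ar s T (i + i + 1) <= 3 * total + 1 ->
  (forall s', keep 25 [:: T] s s' ->
     (forall y, sc s' y = sc s y) ->
     (forall j, ar s' T j = if j == i then minn (ar s T (i + i)) (ar s T (i + i + 1)) else ar s T j) ->
     tm s' = (tm s).+2 -> P s') ->
  wp (fixup T) P s.
Proof.
move=> E hi le1 le2 hP.
apply: wp_if => /=; rewrite E => c; apply: wp_sto => /=; rewrite E; try lia.
- apply: hP => //; first by apply: keep_sto; rewrite ?inE.
  move=> j /=; rewrite !ds /= -[eqn j i]/(j == i).
  by case: eqP => // _; apply/esym/minn_idPr; lia.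
- apply: hP => //; first by apply: keep_sto; rewrite ?inE.
  move=> j /=; rewrite !ds /= -[eqn j i]/(j == i).
  by case: eqP => // _; apply/esym/minn_idPl; lia.
Qed.

Lemma wp_init P s : base s -> sc s rN = N -> lists s ->
  (forall s', keep 19 [:: T; Q; PR] s s' -> side s' -> parents s' ->
     (forall i, 0 < i <= N -> ar s' Q i = 1) ->
     tm s' <= tm s + 10 * N + 10 -> P s') ->
  wp (init T Q A B PR) P s.
Proof.
move=> bs sN ls hP.
apply: wp_seq; apply: wp_asg => /=; first by lia.
pose J r s' := [/\ keep 19 [:: T; Q; PR] s s', sc s' 20 = r,
  (forall i, 0 < i < r -> ar s' Q i = 1 /\ ar s' T (N + i - 1) = ar s A i + ar s B 1) &
  tm s' <= tm s + 4 * r].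
apply: wp_seq; apply: (@wp_for _ _ _ _ N.+1 1 J) => //.
- split=> //=; [by apply: keep_asg|lia|lia].
- by move=> r s' hr [K E _ _] /=; rewrite (keepS K rN isT) sN E; lia.
- move=> r s1 hr [K E L Tm].
  have nA : A \notin [:: T; Q; PR] by rewrite !inE -![_ == _]/(eqn _ _) !ds.
  have nB : B \notin [:: T; Q; PR] by rewrite !inE -![_ == _]/(eqn _ _) !ds.
  have kl := @key_le s r 1 ls ltac:(lia) ltac:(lia).
  apply: wp_seq; apply: wp_sto => /=; rewrite ?E; try lia.
  apply: wp_seq; apply: wp_sto => /=; rewrite ?ds ?(keepS K rN isT) ?E ?sN ?(keepA K A nA) ?(keepA K B nB); try lia.
  apply: wp_asg => /=; rewrite E; first by lia.
  split=> /=; [|lia| |lia].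
  + by apply: keep_asg => //; do 2 (apply: keep_sto; rewrite ?inE ?eqxx ?orbT //).
  + move=> i hi; rewrite !ds /= -[eqn i r]/(i == r) -[eqn (N + i - 1) _]/(N + i - 1 == N + r - 1).
    case: (eqVneq i r) => [->|ne]; first by rewrite eqxx.
    by rewrite ifF; [apply: L|]; lia.
- move=> s1 [K E L Tm].
  apply: wp_seq; apply: wp_asg => /=; rewrite (keepS K rN isT) sN; first by lia.
  pose J2 c s' := [/\ keep 19 [:: T; Q; PR] s s', sc s' 20 = N - c.+1,
    (forall i, 0 < i <= N -> ar s' Q i = 1 /\ ar s' T (N + i - 1) = ar s A i + ar s B 1),
    (forall i, N - c.+1 < i < N -> node (ar s' T) i) /\
    (forall i, 2 * (N - c) <= i < 2 * N -> ar s' PR i = i./2) &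
    tm s' <= tm s + 4 * N + 6 + 6 * c /\
    (forall i, N - c.+1 < i < 2 * N -> ar s' T i <= 3 * total + 1)].
  have kl i : 0 < i <= N -> ar s A i + ar s B 1 <= 3 * total + 1.
    by move=> hi; apply: key_le => //; lia.
  apply: (@wp_for _ _ _ _ N.-1 0 J2) => //.
  + split=> //=; [by apply: keep_asg|split=> i hi; lia|split; first lia].
    move=> i hi; have := (L (i + 1 - N) ltac:(lia)).2.
    have -> : N + (i + 1 - N) - 1 = i by lia.
    by move=> ->; apply: kl; lia.
  + by move=> c s' hc [_ E' _ _ _] /=; rewrite E'; lia.
  + move=> c s2 hc [K2 E2 L2 [N2 R2] [T2 le2]].
    have nA : A \notin [:: T; Q; PR] by rewrite !inE -![_ == _]/(eqn _ _) !ds.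
    have nB : B \notin [:: T; Q; PR] by rewrite !inE -![_ == _]/(eqn _ _) !ds.
    have [i Ei] : {i | i = N - c.+1} by eexists.
    rewrite -Ei in E2 N2 le2.
    have iN : 0 < i < N by lia.
    apply: wp_seq; apply: (@wp_fixup _ (tick s2) i) => //=; try (apply: le2; lia).
    move=> s3 K3 F3 T3 Tm3.
    have [nQ nP] : Q \notin [:: T] /\ PR \notin [:: T].
      by rewrite !inE -![_ == _]/(eqn _ _) !ds.
    apply: wp_seq; apply: wp_sto => /=; rewrite ?F3 /= ?E2; try lia.
    apply: wp_seq; apply: wp_sto => /=; rewrite ?F3 /= ?E2; try lia.
    apply: wp_asg => /=; rewrite F3 /= E2; first by lia.
    have lei : minn (ar s2 T (i + i)) (ar s2 T (i + i + 1)) <= 3 * total + 1.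
      by rewrite geq_min le2 //; lia.
    have T3' z : z != i -> ar s3 T z = ar s2 T z by move=> ne; rewrite T3 (negbTE ne).
    split=> /=; rewrite ?ds ?(keepA K3 Q nQ) ?(keepA K3 PR nP) /=.
    * apply: keep_asg => //; do 2 (apply: keep_sto; rewrite ?inE ?eqxx ?orbT //).
      by apply: (keep_weak_trans K2 K3) => //=; rewrite inE eqxx.
    * by move: Ei hc; clear; lia.
    * move=> z hz; rewrite T3' ?(L2 z hz).2; [|by lia].
      by split=> //; rewrite (L2 z hz).1.
    * split.
        move=> z hz; rewrite /node.
        case: (eqVneq z i) => [->|ne].
          by rewrite T3 eqxx !T3' //; move: iN; clear; lia.
        by rewrite !T3' //; [apply: N2|..]; move: Ei hz ne hc; clear; lia.
      move=> z hz; rewrite -![eqn z _]/(z == _).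
      case: (eqVneq z (i + i + 1)) => [->|ne1]; first by lia.
      case: (eqVneq z (i + i)) => [->|ne2]; first by lia.
      by rewrite R2 //; lia.
    * split; first by lia.
      move=> z hz; rewrite T3; case: eqP => // ne; apply: le2; lia.
  + move=> s2 [K2 E2 L2 [N2 R2] [T2 le2]]; apply: hP => //=.
    * split=> //.
      - by move=> i hi; rewrite (L2 i hi).1.
      - move=> i hi; rewrite (L2 i hi).2 (L2 i hi).1.
        have nA : A \notin [:: T; Q; PR] by rewrite !inE -![_ == _]/(eqn _ _) !ds.
        have nB : B \notin [:: T; Q; PR] by rewrite !inE -![_ == _]/(eqn _ _) !ds.
        by rewrite (keepA K2 A nA) (keepA K2 B nB).
      - by move=> i hi; apply: N2; lia.
      - by move=> i hi; apply: le2; lia.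
    * by move=> i hi; apply: R2; lia.
    * by move=> i hi; rewrite (L2 i hi).1.
    * lia.
Qed.

(** A leaf with the minimal key is reached from the root by going to a child with
    the same key; each step doubles the number of the node. *)
Lemma wp_find P s : base s -> sc s rN = N -> side s ->
  (forall s', keep 20 [::] s s' -> N <= sc s' 20 < 2 * N ->
     ar s T (sc s' 20) = ar s T 1 -> sc s' 21 = sc s' 20 + 1 - N ->
     tm s' <= tm s + 4 * lg + 4 -> P s') ->
  wp (find T) P s.
Proof.
move=> bs sN [_ _ tr _] hP.
apply: wp_seq; apply: wp_asg => /=; first by lia.
apply: wp_seq.
apply: (@wp_while _ _ _ _ (fun s' => [/\ keep 20 [::] s s', 0 < sc s' 20 < 2 * N,
  ar s T (sc s' 20) = ar s T 1 & exists c, 2 ^ c <= sc s' 20 /\ tm s' <= tm s + 1 + 4 * c])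
  (fun s' => 2 * N - sc s' 20)).
- by split=> //=; [apply: keep_asg|lia|exists 0; lia].
- move=> s1 [K hi E [c [hc Tc]]] /=; rewrite (keepS K rN isT) sN => c0.
  apply: wp_asg => /=; rewrite (keepS K rN isT) sN; first by lia.
  have cl : c <= lg by apply: trunc_log_max => //; lia.
  by apply: hP => //=; [apply: keep_asg|lia|lia].
- move=> s1 [K hi E [c [hc Tc]]] /=; rewrite (keepS K rN isT) sN => c0.
  have iN : 0 < sc s1 20 < N by lia.
  have nd : ar s T 1 = minn (ar s T (sc s1 20 + sc s1 20)) (ar s T (sc s1 20 + sc s1 20 + 1)).
    by rewrite -E; apply: tr.
  have hc2 : 2 ^ c.+1 <= sc s1 20 + sc s1 20 by rewrite expnS; lia.
  apply: wp_seq; apply: wp_asg => /=; first by lia.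
  apply: wp_if => /=; rewrite (keepA K) // => c1.
  + apply: wp_asg => /=; first by lia.
    split=> /=; last by lia.
    split=> //=; [by do 2 apply: keep_asg => //|lia|by rewrite nd; apply/esym/minn_idPr; lia|].
    by exists c.+1; lia.
  + apply: wp_skip.
    split=> /=; last by lia.
    split=> //=; [by do 2 apply: keep_asg => //|lia|by rewrite nd; apply/esym/minn_idPl; lia|].
    by exists c.+1; lia.
Qed.

(** After the row that attains the minimum has advanced, only the nodes above its
    leaf are out of date, and the loop repairs them from the leaf upwards: the
    invariant exempts the parent of the current node. *)
Lemma wp_pop P s : base s -> sc s rN = N -> lists s -> side s -> parents s ->
  ar s T 1 <= 2 * total ->
  (forall s' w, keep 20 [:: T; Q] s s' -> side s' -> 0 < w <= N -> ar s Q w <= N ->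
     ar s T 1 = ar s A w + ar s B (ar s Q w) ->
     (forall i, ar s' Q i = if i == w then (ar s Q w).+1 else ar s Q i) ->
     tm s' <= tm s + 8 * lg + 8 -> P s') ->
  wp (pop T Q A B PR) P s.
Proof.
move=> bs sN ls sd pr hT hP.
have [_ _ Be] := lists_le ls.
apply: wp_seq; apply: (wp_find bs sN sd) => s1 K1 hi E Ew T1.
have [Qr L tr le] := sd.
have [i0 Ei0] : {i | i = sc s1 20} by eexists.
rewrite -Ei0 in hi E Ew.
have [w Hw] : {w | w = i0 + 1 - N} by eexists.
rewrite -Hw in Ew.
have wN : 0 < w <= N by lia.
have Lw : ar s T i0 = ar s A w + ar s B (ar s Q w).
  by rewrite -L //; congr (ar s T _); lia.
have qw : ar s Q w <= N.
  rewrite leqNgt; apply/negP => h; have := Qr _ wN => h2.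
  have qe : ar s Q w = N.+1 by lia.
  by move: Lw; rewrite qe Be E; lia.
have kl := @key_le s w (ar s Q w).+1 ls ltac:(lia) ltac:(lia).
apply: wp_seq; apply: wp_sto => /=; rewrite ?Ew ?(keepA K1) //; try lia.
apply: wp_seq; apply: wp_sto => /=; rewrite ?Ew ?(keepA K1) // -?Ei0 ?ds /= -?[eqn w w]/(w == w) ?eqxx ?addn1; try lia.
set s2 := sto _ _ _ _.
have K2 : keep 20 [:: T; Q] s s2.
  do 2 (apply: keep_sto; rewrite ?inE ?eqxx ?orbT //).
  by apply: (keep_weak K1).
have Q2 i : ar s2 Q i = if i == w then (ar s Q w).+1 else ar s Q i.
  by rewrite /s2 /= !ds /= -[eqn i w]/(i == w) (keepA K1).
have T2 i : ar s2 T i = if i == i0 then ar s A w + ar s B (ar s Q w).+1 else ar s T i.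
  by rewrite /s2 /= !ds /= -[eqn i i0]/(i == i0) (keepA K1).
have E2 : sc s2 20 = i0 by [].
have tm2 : tm s2 <= tm s + 4 * lg + 6 by rewrite /=; lia.
clearbody s2; clear s1 K1 Ew T1 Ei0.
have nA : A \notin [:: T; Q] by rewrite !inE -![_ == _]/(eqn _ _) !ds.
have nB : B \notin [:: T; Q] by rewrite !inE -![_ == _]/(eqn _ _) !ds.
have nP : PR \notin [:: T; Q] by rewrite !inE -![_ == _]/(eqn _ _) !ds.
apply: (@wp_while _ _ _ _ (fun s' => [/\ keep 20 [:: T; Q] s s', 0 < sc s' 20 < 2 * N,
   ar s' Q = ar s2 Q /\ (forall i, 0 < i <= N -> ar s' T (N + i - 1) = ar s A i + ar s B (ar s2 Q i)),
   (forall j, 0 < j < N -> j != (sc s' 20)./2 -> node (ar s' T) j) /\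
   (forall j, 0 < j < 2 * N -> ar s' T j <= 3 * total + 1) &
   exists c, sc s' 20 * 2 ^ c < 2 * N /\ tm s' <= tm s + 4 * lg + 6 + 4 * c]) (fun s' => sc s' 20)).
- split=> //.
  + by rewrite E2; lia.
  + split=> // i hi'; rewrite T2 Q2; case: (eqVneq i w) => [->|ne].
      by rewrite ifT //; lia.
    by rewrite ifF ?L //; lia.
  + rewrite E2; split=> j hj.
      move=> ne; rewrite /node !T2 !ifF; try lia.
      exact: tr.
    by rewrite T2; case: eqP => _; [|apply: le].
  + by exists 0; rewrite E2; lia.
- move=> s1 [K hi1 [Eq L1] [N1 le1] [c [hc Tc]]] /= c0.
  have i1 : sc s1 20 = 1 by lia.
  rewrite i1 in N1 hc.
  have cl : c <= lg by apply: trunc_log_max => //; lia.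
  apply: (hP _ w) => //=.
  + split=> //=.
    * move=> i hi'; rewrite Eq Q2; have := Qr i hi'; case: eqP => [->|]; lia.
    * by move=> i hi'; rewrite Eq (keepA K A nA) (keepA K B nB) L1.
    * by move=> i hi'; apply: N1 => //; lia.
  + by rewrite -E.
  + by move=> i; rewrite Eq.
  + lia.
- move=> s1 [K hi1 [Eq L1] [N1 le1] [c [hc Tc]]] /= c0.
  have [i Ei] : {i | i = sc s1 20} by eexists.
  rewrite -Ei in hi1 N1 hc c0 *.
  have i1 : 1 < i by lia.
  apply: wp_seq; apply: wp_asg => /=; rewrite (keepA K PR nP) -Ei pr; try lia.
  have iN : 0 < i./2 < N by lia.
  apply: (@wp_fixup _ _ i./2) => //=; try (apply: le1; lia).
  move=> s3 K3 F3 T3 Tm3.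
  have T3' z : z != i./2 -> ar s3 T z = ar s1 T z by move=> ne; rewrite T3 (negbTE ne).
  have nQ : Q \notin [:: T] by rewrite !inE -![_ == _]/(eqn _ _) !ds.
  have lei : minn (ar s1 T (i./2 + i./2)) (ar s1 T (i./2 + i./2 + 1)) <= 3 * total + 1.
    by rewrite geq_min le1 //; lia.
  rewrite !F3 /=; split; last by lia.
  split; rewrite ?F3 //=.
  + have K3' : keep 20 [:: T; Q] s (asg (tick s1) 20 i./2) by apply: keep_asg.
    by apply: (keep_weak_trans K3' K3) => //=; rewrite inE eqxx.
  + by lia.
  + split; first by rewrite (keepA K3 Q nQ).
    by move=> z hz; rewrite T3' ?L1 //; lia.
  + split.
      move=> j hj ne; rewrite /node; case: (eqVneq j i./2) => [->|ne1].
        by rewrite T3 eqxx !T3' //; move: iN; clear; lia.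
      have [a1 a2] : j + j != i./2 /\ j + j + 1 != i./2 by move: ne; clear; lia.
      by rewrite !T3' //; apply: N1.
    by move=> j hj; rewrite T3; case: eqP => // _; apply: le1.
  + exists c.+1; split; last by lia.
    rewrite expnS; apply: leq_ltn_trans hc; rewrite mulnA leq_mul2r; apply/orP; right; lia.
Qed.

End Side.
Arguments root_min {F}.
Arguments wp_init {T Q A B PR} dis {P s}.
Arguments wp_find {T Q A B P s}.
Arguments wp_pop {T Q A B PR} dis {P s}.

(** * Merging two tournaments *)

Definition key (o r : nat) := block_sum o (nth [::] (colex m k) r).

Lemma block_sum_le o str : o + m <= n -> block_sum o str <= total.
Proof.
move=> h; apply: leq_trans (@psum_le o m h).
by apply: leq_sum => j _; rewrite -[X in _ <= X]muln1 leq_mul2l; case: (nth false _ _); rewrite orbT.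
Qed.

Definition tenum := (14 * m + 30) * N + 4 * m + 10.
Definition tins := (3 * N + 8) * N + 5.

Lemma wp_load P s off o fl d : ctx s -> ev inp s off = o -> o + m <= n -> 0 < d < 5 ->
  (forall s', keep 11 [:: d; aO; aX; aL] s s' -> sc s' rN = N ->
     sorted_keys (ar s' d) (fun r => if fl then total - key o r else key o r) ->
     tm s' <= tm s + tenum + tins + 2 -> P s') ->
  wp (load off fl d) P s.
Proof.
move=> cs eo ho hd hP.
apply: wp_seq; apply: wp_asg; rewrite eo; first by lia.
have K1 : keep 11 [:: d; aO; aX; aL] s (asg s roff o) by apply: keep_asg.
have nd0 : 0 \notin [:: d; aO; aX; aL] by rewrite !inE; lia.
have cs1 := ctx_keep cs K1 isT nd0.
apply: wp_seq; apply: (@wp_enumerate _ _ o) => //.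
move=> s2 K2 E2 L2 _ _ T2.
apply: wp_seq; apply: wp_asg => /=; rewrite E2; first by lia.
set s3 := asg _ _ _.
have K3 : keep 11 [:: d; aO; aX; aL] s s3.
  apply: keep_asg => //; apply: (keep_weak_trans K1 K2) => //=.
  by rewrite !inE !orbT.
have cs3 := ctx_keep cs K3 isT nd0.
apply: (@wp_insert _ s3 fl d (key o)) => //.
- by case: cs3.
- lia.
- move=> r hr; split; first exact: L2.
  exact: block_sum_le.
- move=> s4 K4 L4 T4; apply: hP => //.
  + by apply: (keep_weak_trans K3 K4) => //=; rewrite !inE eqxx.
  + by rewrite (keepS K4).
  + by move: T2 T4; rewrite /= /tenum /tins; lia.
Qed.

Definition merging s := [/\ ctx s, sc s rN = N, lists 1 2 s /\ lists 3 4 s,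
  side 5 6 1 2 s /\ side 8 9 3 4 s & parents aPAR s].

(** Four positions, one in each sorted list, whose sums add up to [t]. *)
Definition matching s i j u v := [/\ 0 < i <= N, 0 < j <= N, 0 < u <= N & 0 < v <= N] /\
  ar s 1 i + ar s 2 j + (total + total) = ar s 3 u + ar s 4 v + t.

Lemma side_eq T Q A B s s' : side T Q A B s ->
  ar s' T = ar s T -> ar s' Q = ar s Q -> ar s' A = ar s A -> ar s' B = ar s B ->
  side T Q A B s'.
Proof. by rewrite /side => h -> -> -> ->. Qed.

Lemma lists_eq A B s s' : lists A B s -> ar s' A = ar s A -> ar s' B = ar s B -> lists A B s'.
Proof. by rewrite /lists => h -> ->. Qed.

(** The number of pops that are still possible. *)
Definition potential s := \sum_(1 <= i < N.+1) (N.+1 - ar s 6 i) + \sum_(1 <= i < N.+1) (N.+1 - ar s 9 i).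

Lemma sum_dec (F G : nat -> nat) w : 0 < w <= N -> F w <= N ->
  (forall i, G i = if i == w then (F w).+1 else F i) ->
  \sum_(1 <= i < N.+1) (N.+1 - F i) = (\sum_(1 <= i < N.+1) (N.+1 - G i)).+1.
Proof.
move=> hw hF hG.
rewrite (@big_cat_nat _ _ _ w) /=; [|lia|lia].
rewrite [in RHS](@big_cat_nat _ _ _ w) /=; [|lia|lia].
rewrite (@big_ltn _ _ _ w); last by lia.
rewrite [in RHS](@big_ltn _ _ _ w); last by lia.
have -> : \sum_(1 <= i < w) (N.+1 - G i) = \sum_(1 <= i < w) (N.+1 - F i).
  by apply: eq_big_nat => i hi; rewrite hG ifF //; lia.
have -> : \sum_(w.+1 <= i < N.+1) (N.+1 - G i) = \sum_(w.+1 <= i < N.+1) (N.+1 - F i).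
  by apply: eq_big_nat => i hi; rewrite hG ifF //; lia.
rewrite hG eqxx; lia.
Qed.

(** As long as a pair has not been passed, the root is at most its key. *)
Lemma root_key T Q A B s i j : side T Q A B s -> lists A B s -> 0 < i <= N -> 0 < j <= N ->
  ar s Q i <= j -> ar s T 1 <= ar s A i + ar s B j.
Proof.
move=> [Qr L tr _] [f [g [_ [_ Bs _ _] _]]] hi hj qj.
have := root_min tr (N + i - 1) ltac:(lia); rewrite L //.
have [q0 _] := andP (Qr i hi).
have := Bs _ _ q0 qj ltac:(lia); lia.
Qed.

(** No matching quadruple is ever passed ([alive]).  Suppose that the pop moves a row
    past a component of one; then the root that was popped is the key of that
    pair, while the other root is at most the key of the other pair, so the
    comparison would not have chosen this pop.  If an enumeration is exhausted,
    no matching quadruple remains. *)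
Lemma wp_merge action P s : merging s ->
  (forall i, 0 < i <= N -> ar s 6 i = 1) -> (forall i, 0 < i <= N -> ar s 9 i = 1) ->
  (forall s', keep 12 [:: 5; 6; 8; 9] s s' -> (forall i j u v, ~ matching s i j u v) ->
     tm s' <= tm s + (8 * lg + 14) * (2 * N * N + 1) + 2 -> P s') ->
  (forall s', keep 12 [:: 5; 6; 8; 9] s s' -> merging s' ->
     ar s' 5 1 <= 2 * total -> ar s' 8 1 <= 2 * total ->
     ar s' 5 1 + (total + total) = ar s' 8 1 + t ->
     tm s' <= tm s + (8 * lg + 14) * (2 * N * N + 1) + 10 -> wp action (fun=> False) s') ->
  wp (merge action) P s.
Proof.
move=> ms q6 q9 hP hF; have [[bs _] _ _ _ _] := ms.
have hK : exists K, K = 8 * lg + 14 by eexists.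
case: hK => K EK; rewrite -EK in hP hF.
have pot0 : potential s = 2 * N * N.
  have E F : (forall i, 0 < i <= N -> F i = 1) -> \sum_(1 <= i < N.+1) (N.+1 - F i) = N * N.
    move=> hF1; rewrite (eq_big_nat _ _ (F2 := fun=> N)).
      by rewrite sum_nat_const_nat subSS subn0.
    by move=> i hi; rewrite hF1 ?subSS ?subn0.
  by rewrite /potential !E //; lia.
apply: wp_seq; apply: wp_asg => /=; first by lia.
(* a row is at a position not yet beyond that of any matching quadruple *)
pose alive s' := forall i j u v, matching s i j u v -> ar s' 6 i <= j /\ ar s' 9 u <= v.
pose I s' := [/\ keep 12 [:: 5; 6; 8; 9] s s', merging s',
   (sc s' rgo = 1 /\ alive s') \/ (sc s' rgo = 0 /\ forall i j u v, ~ matching s i j u v) &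
   tm s' + K * (potential s' + sc s' rgo) <= tm s + 1 + K * (2 * N * N + 1)].
have mkeep s1 s' : merging s1 -> keep 12 [::] s1 s' -> merging s'.
  move=> [c1 c2 [c3 c4] [c5 c6] c7] Kp; split.
  - exact: ctx_keep c1 Kp isT isT.
  - by rewrite (keepS Kp).
  - by split; [apply: lists_eq c3 _ _|apply: lists_eq c4 _ _]; rewrite (keepA Kp).
  - by split; [apply: side_eq c5 _ _ _ _|apply: side_eq c6 _ _ _ _]; rewrite (keepA Kp).
  - by move=> j hj; rewrite (keepA Kp) // c7.
apply: (@wp_while _ _ _ _ I (fun s' => potential s' + sc s' rgo)).
- split.
  + by apply: keep_asg.
  + by apply: mkeep ms _; apply: keep_asg.
  + left; split=> // i j u v [[hi hj hu hv] _] /=.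
    by rewrite q6 // q9 //; lia.
  + by rewrite /= -[potential _]/(potential s) pot0; lia.
- move=> s1 [K1 ms1 alt T1] /= c0.
  case: alt => [[h _]|[E nq]]; first by rewrite h in c0.
  apply: hP => //=; move: T1.
  by rewrite E addn0; lia.
- move=> s1 [K1 ms1 alt T1] /= c0.
  have [E1 al] : sc s1 rgo = 1 /\ alive s1 by case: alt => // -[h]; rewrite h in c0.
  have [c1 c2 [c3 c4] [c5 c6] c7] := ms1.
  have [[_ _ b2 [_ _ b5 b6]] _] := c1.
  have stop s2 : keep 12 [::] s1 s2 -> tm s2 <= tm s1 + 4 ->
      (forall i j u v, ~ matching s i j u v) -> sc s2 rgo = 0 ->
      I s2 /\ potential s2 + sc s2 rgo < potential s1 + sc s1 rgo.
    move=> K2 T2 nq E2.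
    have pe : potential s2 = potential s1 by rewrite /potential !(keepA K2).
    rewrite /I E2 E1 pe addn0; split; last by lia.
    split; [|exact: mkeep ms1 K2|by right|].
      by apply: (keep_weak_trans K1 K2).
    by move: T1; rewrite E1 mulnDr; lia.
  have A1 i : ar s1 1 i = ar s 1 i by rewrite (keepA K1).
  have A2 i : ar s1 2 i = ar s 2 i by rewrite (keepA K1).
  have A3 i : ar s1 3 i = ar s 3 i by rewrite (keepA K1).
  have A4 i : ar s1 4 i = ar s 4 i by rewrite (keepA K1).
  have [le1 le2 _] := lists_le c3.
  have [le3 le4 _] := lists_le c4.
  apply: wp_if => /=; rewrite b6 => d1; last first.
    apply: wp_asg => //=; first by lia.
    apply: stop => //=; [by apply: keep_asg|by lia|].
    move=> i j u v q; have [q1 q2] := al _ _ _ _ q; have [[hi hj hu hv] _] := q.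
    have := root_key c5 c3 hi hj q1; have := le1 _ hi; have := le2 _ hj; lia.
  apply: wp_if => /=; rewrite b6 => d2; last first.
    apply: wp_asg => //=; first by lia.
    apply: stop => //=; [by apply: keep_asg|by lia|].
    move=> i j u v q; have [q1 q2] := al _ _ _ _ q; have [[hi hj hu hv] _] := q.
    have := root_key c6 c4 hu hv q2; have := le3 _ hu; have := le4 _ hv; lia.
  apply: wp_if => /=; rewrite b5 b2 => d3.
    have ms2 : merging (tick (tick (tick (tick s1)))) := ms1.
    have [e1 e2 [e3 e4] [e5 e6] e7] := ms2.
    apply: (@wp_pop 8 9 3 4 7 _ _ _ e1.1 e2 e4 e6 e7) => //=; first by lia.
    move=> s2 w K2 sd2 hw qw Tw Q2 T2.
    have pe : potential s1 = (potential s2).+1.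
      by have := sum_dec hw qw Q2; rewrite /potential (keepA K2 6 isT) /= => ->; rewrite addnS.
    have E2 : sc s2 rgo = 1 by rewrite (keepS K2).
    rewrite E2 E1 pe; split; last by lia.
    split.
    + by apply: (keep_weak_trans K1 K2).
    + split.
      * exact: ctx_keep e1 K2 isT isT.
      * by rewrite (keepS K2).
      * by split; [apply: lists_eq e3 _ _|apply: lists_eq e4 _ _]; rewrite (keepA K2).
      * by split; [apply: side_eq e5 _ _ _ _; rewrite (keepA K2)|].
      * by move=> j hj; rewrite (keepA K2) // e7.
    + left; split=> // i j u v q; have [q1 q2] := al _ _ _ _ q; have [[hi hj hu hv] qe] := q.
      rewrite (keepA K2) //=; split=> //; rewrite Q2 /=.
      case: eqP => // uw; rewrite ltn_neqAle -{2}uw q2 andbT; apply/eqP => vq.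
      have := root_key c5 c3 hi hj q1; rewrite !A1 !A2 => rk.
      move: Tw; rewrite /= -uw A3 A4; rewrite -uw /= in vq; rewrite vq => Tw.
      lia.
    + by move: T1 T2; rewrite E1 E2 pe /= -/lg; lia.
  apply: wp_if => /=; rewrite b5 b2 => d4.
    have ms2 : merging (tick (tick (tick (tick (tick s1))))) := ms1.
    have [e1 e2 [e3 e4] [e5 e6] e7] := ms2.
    apply: (@wp_pop 5 6 1 2 7 _ _ _ e1.1 e2 e3 e5 e7) => //=; first by lia.
    move=> s2 w K2 sd2 hw qw Tw Q2 T2.
    have pe : potential s1 = (potential s2).+1.
      by have := sum_dec hw qw Q2; rewrite /potential (keepA K2 9 isT) /= => ->; rewrite addSn.
    have E2 : sc s2 rgo = 1 by rewrite (keepS K2).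
    rewrite E2 E1 pe; split; last by lia.
    split.
    + by apply: (keep_weak_trans K1 K2).
    + split.
      * exact: ctx_keep e1 K2 isT isT.
      * by rewrite (keepS K2).
      * by split; [apply: lists_eq e3 _ _|apply: lists_eq e4 _ _]; rewrite (keepA K2).
      * by split; [|apply: side_eq e6 _ _ _ _; rewrite (keepA K2)].
      * by move=> j hj; rewrite (keepA K2) // e7.
    + left; split=> // i j u v q; have [q1 q2] := al _ _ _ _ q; have [[hi hj hu hv] qe] := q.
      rewrite (keepA K2 9) //=; split=> //; rewrite Q2 /=.
      case: eqP => // uw; rewrite ltn_neqAle -{2}uw q1 andbT; apply/eqP => vq.
      have := root_key c6 c4 hu hv q2; rewrite !A3 !A4 => rk.
      move: Tw; rewrite /= -uw A1 A2; rewrite -uw /= in vq; rewrite vq => Tw.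
      lia.
    + by move: T1 T2; rewrite E1 E2 pe /= -/lg; lia.
  apply: (@wp_mono _ _ _ _ _ (fun=> False)) => //.
  apply: hF => //=; [lia|lia|lia|].
  by move: T1; lia.
Qed.

Variable TT : nat.
(** The output is stored in reverse order. *)
Definition good_out (o : seq nat) := exists x : nat -> bool,
  [/\ rev o = mkseq (fun i => x i : nat) n, \sum_(0 <= i < n) x i = l &
      \sum_(0 <= i < n) nth 0 inp (3 + i) * x i = t].
Hypothesis hH : forall s, good_out (out s) -> tm s <= TT -> H s.

(** Some solution puts [k] ones into each block of the arrangement [p]. *)
Definition balanced := exists x : nat -> bool,
  \sum_(0 <= i < n) nth 0 inp (3 + i) * x i = t /\
  forall b, b < 4 -> \sum_(0 <= j < m) x (p (b * m + j)) = k.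

Lemma sum_blocks (f : nat -> nat) : \sum_(0 <= i < n) f i =
  \sum_(0 <= j < m) f (p (0 * m + j)) + \sum_(0 <= j < m) f (p (1 * m + j)) +
  \sum_(0 <= j < m) f (p (2 * m + j)) + \sum_(0 <= j < m) f (p (3 * m + j)).
Proof.
rewrite -sum_perm.
have S c : \sum_(0 <= j < c.+1 * m) f (p j) =
    \sum_(0 <= j < c * m) f (p j) + \sum_(0 <= j < m) f (p (c * m + j)).
  rewrite (@big_cat_nat _ _ _ (c * m)) //=; last by rewrite leq_mul2r; lia.
  congr (_ + _); rewrite -[X in \sum_(X <= _ < _) _ = _]add0n mulSn big_addn addnK.
  by apply: eq_bigr => j _; rewrite addnC.
by rewrite hn !S !mul0n big_geq // add0n.
Qed.

Lemma block_lt b j : b < 4 -> j < m -> b * m + j < n.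
Proof. by move=> hb hj; rewrite hn; have : b <= 3 by []; nia. Qed.

Lemma block_inj b j b' j' : b < 4 -> j < m -> b' < 4 -> j' < m ->
  p (b * m + j) = p (b' * m + j') -> b = b'.
Proof.
move=> hb hj hb' hj' /(p_inj (block_lt hb hj) (block_lt hb' hj')) E.
have := congr1 (divn^~ m) E; rewrite !divnMDl; try lia.
by rewrite !divn_small // !addn0.
Qed.

Definition placed b v s := exists str, [/\ str \in colex m k, block_sum (b * m) str = v &
  forall j, j < m -> ar s aO (p (b * m + j)) = nth false str j].

Lemma wp_recover P s b off x : ctx s -> b < 4 -> ev inp s off = b * m -> 
  12 < x < 17 -> (exists2 r, r < N & key (b * m) r = sc s x) ->
  (forall s', keep 17 [:: aO; aX; aL] s s' -> placed b (sc s x) s' ->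
     (forall b' v, b' < 4 -> b' != b -> placed b' v s -> placed b' v s') ->
     tm s' <= tm s + tenum + 2 -> P s') ->
  wp (recover off x) P s.
Proof.
move=> cs hb eo hx [r hr Er] hP.
have bm : b * m + m <= n by rewrite hn; have : b <= 3 by []; nia.
have vle : sc s x <= total by rewrite -Er; apply: block_sum_le.
apply: wp_seq; apply: wp_asg; rewrite eo; first by lia.
have xn : eqn x 17 = false by rewrite -[eqn _ _]/(x == 17); lia.
apply: wp_seq; apply: wp_asg => /=; rewrite xn; first by lia.
set s1 := asg _ _ _.
have K1 : keep 17 [:: aO; aX; aL] s s1 by do 2 apply: keep_asg => //.
have cs1 := ctx_keep cs K1 isT isT.
apply: (@wp_enumerate _ s1 (b * m)) => //.
move=> s2 K2 _ _ O1 O2 T2; apply: hP.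
- by apply: (keep_weak_trans K1 K2).
- have [|str [h1 h2 h3]] := O2.
    exists (nth [::] (colex m k) r); first by rewrite mem_nth // size_colex.
    by rewrite /s1 /= -Er.
  by exists str.
- move=> b' v hb' ne [str [h1 h2 h3]]; exists str; split=> // j hj.
  rewrite O1; first by rewrite h3.
  move=> j' hj'; apply/eqP => E; move/eqP: ne; apply.
  by have := block_inj hb hj' hb' hj E.
- by move: T2; rewrite /tenum /=; lia.
Qed.

Lemma sum_str (str : bitseq) : size str = m -> \sum_(0 <= j < m) nth false str j = count id str.
Proof.
move=> <-; rewrite -sum1_count [RHS]big_mkcond /= (big_nth false).
by apply: eq_bigr => i _; case: (nth _ _ _).
Qed.

Lemma placed_good v0 v1 v2 v3 s : placed 0 v0 s -> placed 1 v1 s ->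
  placed 2 v2 s -> placed 3 v3 s -> v0 + v1 + v2 + v3 = t ->
  exists x : nat -> bool, [/\ forall i, i < n -> ar s aO i = x i,
    \sum_(0 <= i < n) x i = l & \sum_(0 <= i < n) nth 0 inp (3 + i) * x i = t].
Proof.
move=> P0 P1 P2 P3 vt.
pose x i := ar s aO i == 1; exists x.
have xb b v j : b < 4 -> j < m -> placed b v s -> ar s aO (p (b * m + j)) = x (p (b * m + j)).
  by move=> hb hj [str [_ _ h]]; rewrite /x h //; case: (nth _ _ _).
have Sx b v : placed b v s -> \sum_(0 <= j < m) x (p (b * m + j)) = k.
  move=> [str [h1 h2 h3]]; move: h1; rewrite mem_colex => /andP[/eqP sz /eqP <-].
  rewrite -sum_str // big_nat [RHS]big_nat; apply: eq_bigr => j hj.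
  by rewrite /x h3 //; case: (nth _ _ _).
have Sv b v : placed b v s ->
    \sum_(0 <= j < m) nth 0 inp (3 + p (b * m + j)) * x (p (b * m + j)) = v.
  move=> [str [h1 <- h3]]; rewrite /block_sum big_nat [RHS]big_nat; apply: eq_bigr => j hj.
  by rewrite /x h3 //; case: (nth false _ _).
split.
- move=> i hi.
  have : i \in mkseq p n by rewrite (perm_mem hp) mem_iota.
  case/mapP => j; rewrite mem_iota add0n /= => hj ->.
  have m0 : 0 < m by lia.
  have jb : j = j %/ m * m + j %% m by rewrite -divn_eq.
  have hb : j %/ m < 4 by rewrite ltn_divLR // -hn.
  have hr : j %% m < m by rewrite ltn_pmod.
  rewrite jb; move: (j %/ m) hb => [|[|[|[|//]]]] hb.
  + exact: xb P0.
  + exact: xb P1.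
  + exact: xb P2.
  + exact: xb P3.
- by rewrite (sum_blocks (fun i => x i : nat)) (Sx 0 v0) // (Sx 1 v1) // (Sx 2 v2) // (Sx 3 v3) //; lia.
- rewrite (sum_blocks (fun i => nth 0 inp (3 + i) * x i)) /=.
  by rewrite (Sv 0 v0) // (Sv 1 v1) // (Sv 2 v2) // (Sv 3 v3).
Qed.

Lemma wp_answer P s (x : nat -> bool) : base s -> out s = [::] -> (forall i, i < n -> ar s aO i = x i) ->
  \sum_(0 <= i < n) x i = l -> \sum_(0 <= i < n) nth 0 inp (3 + i) * x i = t ->
  tm s + 3 * n + 3 <= TT -> wp answer P s.
Proof.
move=> bs os hx S1 S2 hT; have [b0 _ _ _] := bs.
apply: wp_seq; apply: wp_asg => /=; first by lia.
pose J i s' := [/\ sc s' rn = n, sc s' 20 = i, ar s' aO = ar s aO,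
  rev (out s') = mkseq (fun i => x i : nat) i & tm s' <= tm s + 1 + 3 * i].
apply: wp_seq; apply: (@wp_for _ _ _ _ n 0 J) => //.
- by split=> //=; [rewrite os|lia].
- by move=> i s' hi [E1 E2 _ _ _] /=; rewrite E1 E2; lia.
- move=> i s1 hi [E1 E2 E3 E4 T1].
  apply: wp_seq; apply: wp_wr; apply: wp_asg => /=; rewrite E2; first by lia.
  split=> //=; [lia| |lia].
  by rewrite E3 hx // rev_cons E4 -[i.+1]addn1 /mkseq iotaD map_cat cats1.
- move=> s1 [E1 E2 E3 E4 T1]; apply: wp_halt; apply: hH => /=; last by lia.
  by exists x.
Qed.

Definition tfound := 8 * lg + 3 * n + 4 * tenum + 40.

Definition four s := [/\ sorted_keys (ar s 1) (key (0 * m)), sorted_keys (ar s 2) (key (1 * m)),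
  sorted_keys (ar s 3) (fun r => total - key (2 * m) r) & 
  sorted_keys (ar s 4) (fun r => total - key (3 * m) r)].

Lemma key_le_total b r : b < 4 -> key (b * m) r <= total.
Proof. by move=> hb; apply: block_sum_le; rewrite hn; have : b <= 3 by []; nia. Qed.

(** The positions found give four sums; recovering a subset for each sum yields
    possibly other subsets than those met, but with the same sums, and that is
    all a solution needs. *)
Lemma wp_found s : merging s -> four s -> out s = [::] ->
  ar s 5 1 <= 2 * total -> ar s 8 1 <= 2 * total ->
  ar s 5 1 + (total + total) = ar s 8 1 + t ->
  tm s + tfound <= TT -> wp found (fun=> False) s.
Proof.
move=> [cs sN [l12 l34] [s1 s2] pr] [f1 f2 f3 f4] os h5 h8 E hT.
have row T Q A B s' : side T Q A B s -> lists A B s -> ar s T 1 <= 2 * total ->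
   N <= sc s' 20 < 2 * N -> ar s T (sc s' 20) = ar s T 1 -> sc s' 21 = sc s' 20 + 1 - N ->
   [/\ 0 < sc s' 21 <= N, 0 < ar s Q (sc s' 21) <= N &
       ar s T 1 = ar s A (sc s' 21) + ar s B (ar s Q (sc s' 21))].
  move=> [Qr L _ _] ls hT1 hi Ei Ew.
  have wN : 0 < sc s' 21 <= N by lia.
  have Lw : ar s T 1 = ar s A (sc s' 21) + ar s B (ar s Q (sc s' 21)).
    by rewrite -Ei -L //; congr (ar s T _); lia.
  split=> //; have [q0 qN] := andP (Qr _ wN); rewrite q0 /= leqNgt; apply/negP => h.
  have [_ _ Be] := lists_le ls.
  have qe : ar s Q (sc s' 21) = N.+1 by lia.
  by move: Lw; rewrite qe Be; lia.
have [_ _ fe1 _] := f1; have [_ _ fe2 _] := f2; have [_ _ fe3 _] := f3; have [_ _ fe4 _] := f4.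
have tb : 4 * total + 4 < V := hV.
apply: wp_seq; apply: (wp_find cs.1 sN s1) => sa Ka hi Ei Ew Ta.
have [w1 w2 w3] := row 5 6 1 2 sa s1 l12 h5 hi Ei Ew.
have [r1 r1N e1] := fe1 _ w1; have [r2 r2N e2] := fe2 _ w2.
have k1 := @key_le_total 0 r1 isT; have k2 := @key_le_total 1 r2 isT.
apply: wp_seq; apply: wp_asg => /=; rewrite (keepA Ka) // e1; first by lia.
apply: wp_seq; apply: wp_asg => /=; rewrite !(keepA Ka) // e2; first by lia.
set sb := asg _ _ _.
have Kb : keep 13 [::] s sb.
  by do 2 apply: keep_asg => //; apply: (keep_weak Ka).
have csb := ctx_keep cs Kb isT isT.
apply: wp_seq; apply: (@wp_find 8 9 3 4 _ _ csb.1).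
- by rewrite (keepS Kb).
- by apply: side_eq s2 _ _ _ _; rewrite (keepA Kb).
move=> sc1 cmd_steps hic Eic Ewc Tc.
rewrite !(keepA Kb 8 isT) in Eic.
have [u1 u2 u3] := row 8 9 3 4 sc1 s2 l34 h8 hic Eic Ewc.
have [r3 r3N e3] := fe3 _ u1; have [r4 r4N e4] := fe4 _ u2.
have k3 := @key_le_total 2 r3 isT; have k4 := @key_le_total 3 r4 isT.
have Kbc : keep 13 [::] s sc1 by apply: (keep_weak_trans Kb cmd_steps).
have [[_ _ _ [_ _ g5 _]] _] := ctx_keep cs Kbc isT isT.
apply: wp_seq; apply: wp_asg => /=; rewrite (keepA Kbc) // g5 e3; first by lia.
apply: wp_seq; apply: wp_asg => /=; rewrite !(keepA Kbc) // g5 e4; first by lia.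
set sd := asg _ _ _.
have Kd : keep 13 [::] s sd by do 2 apply: keep_asg => //.
have csd := ctx_keep cs Kd isT isT.
have V13 : sc sd 13 = key (0 * m) r1 by rewrite /= (keepS cmd_steps).
have V14 : sc sd 14 = key (1 * m) r2 by rewrite /= (keepS cmd_steps).
have V15 : sc sd 15 = key (2 * m) r3 by rewrite /= subKn.
have V16 : sc sd 16 = key (3 * m) r4 by rewrite /= subKn.
have Td : tm sd <= tm s + 8 * lg + 12 by move: Tc Ta => /=; rewrite -/lg; lia.
have vt : key (0 * m) r1 + key (1 * m) r2 + key (2 * m) r3 + key (3 * m) r4 = t.
  by move: E; rewrite w3 u3 e1 e2 e3 e4; lia.
have od : out sd = [::] by rewrite (keepO Kd).
clearbody sd; clear sa Ka hi Ei Ew Ta w1 w2 w3 e1 e2 sb Kb csb sc1 cmd_steps hic Eic Ewc Tc u1 u2 u3 e3 e4 Kbc g5 row fe1 fe2 fe3 fe4.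
have [[_ _ _ [bm _ _ _]] _] := csd.
apply: wp_seq; apply: (@wp_recover _ sd 0) => //; first by exists r1.
move=> se Ke O0 _ Te; have cse := ctx_keep csd Ke isT isT.
have [[_ _ _ [bme _ _ _]] _] := cse.
apply: wp_seq; apply: (@wp_recover _ se 1) => //=; first by rewrite bme mul1n.
  by exists r2; rewrite // (keepS Ke) // V14.
move=> sf Kf O1 Pf Tf; have csf := ctx_keep cse Kf isT isT.
have [[_ _ _ [bmf _ _ _]] _] := csf.
have Kef := keep_trans Ke Kf.
apply: wp_seq; apply: (@wp_recover _ sf 2) => //=; first by rewrite bmf; lia.
  by exists r3; rewrite // (keepS Kef) // V15.
move=> sg Kg O2 Pg Tg; have csg := ctx_keep csf Kg isT isT.
have [[_ _ _ [bmg _ _ _]] _] := csg.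
have Keg := keep_trans Kef Kg.
apply: wp_seq; apply: (@wp_recover _ sg 3) => //=; first by rewrite bmg; lia.
  by exists r4; rewrite // (keepS Keg) // V16.
move=> sh Kh O3 Ph Th; have csh := ctx_keep csg Kh isT isT.
have Keh := keep_trans Keg Kh.
have Q0 : placed 0 (key (0 * m) r1) sh.
  by rewrite -V13; apply: Ph => //; apply: Pg => //; apply: Pf.
have Q1 : placed 1 (key (1 * m) r2) sh.
  by rewrite -V14 -(keepS Ke 14 isT); apply: Ph => //; apply: Pg.
have Q2 : placed 2 (key (2 * m) r3) sh.
  by rewrite -V15 -(keepS Kef 15 isT); apply: Ph.
have Q3 : placed 3 (key (3 * m) r4) sh.
  by rewrite -V16 -(keepS Keg 16 isT).
have [x [x1 x2 x3]] := placed_good Q0 Q1 Q2 Q3 vt.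
apply: (@wp_answer _ sh x) => //; [by case: csh|by rewrite (keepO Keh)|].
by move: hT Td Te Tf Tg Th; rewrite /tfound; lia.
Qed.

Definition tattempt := 4 * (tenum + tins + 2) + 2 * (10 * N + 10) +
  (8 * lg + 14) * (2 * N * N + 1) + 10 + tfound.

(** Either the attempt halts with a solution, or there is no balanced one.  The
    frame starts with variable 11 so that the counters 8, 9 and 10 of the
    enclosing loops survive. *)
Lemma wp_attempt P s : ctx s -> out s = [::] -> tm s + tattempt <= TT ->
  (forall s', keep 11 (iota 1 12) s s' -> ~ balanced -> tm s' <= tm s + tattempt -> P s') ->
  wp attempt P s.
Proof.
move=> cs os hT hP; have [[_ _ _ [bm _ _ _]] _] := cs.
apply: wp_seq; apply: (@wp_load _ s _ (0 * m)) => //; first by lia.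
move=> s1 K1 N1 L1 T1; have c1 := ctx_keep cs K1 isT isT.
have [[_ _ _ [b1 _ _ _]] _] := c1.
apply: wp_seq; apply: (@wp_load _ s1 _ (1 * m)) => //=; [by rewrite b1 mul1n|by lia|].
move=> s2 K2 N2 L2 T2; have c2 := ctx_keep c1 K2 isT isT.
have [[_ _ _ [b2 _ _ _]] _] := c2.
apply: wp_seq; apply: (@wp_load _ s2 _ (2 * m)) => //=; [by rewrite b2; lia|by lia|].
move=> s3 K3 N3 L3 T3; have c3 := ctx_keep c2 K3 isT isT.
have [[_ _ _ [b3 _ _ _]] _] := c3.
apply: wp_seq; apply: (@wp_load _ s3 _ (3 * m)) => //=; [by rewrite b3; lia|by lia|].
move=> s4 K4 N4 L4 T4; have c4 := ctx_keep c3 K4 isT isT.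
have F4 : four s4.
  split=> //; first by rewrite (keepA K4 1 isT) (keepA K3 1 isT) (keepA K2 1 isT).
    by rewrite (keepA K4 2 isT) (keepA K3 2 isT).
  by rewrite (keepA K4 3 isT).
have KK4 : keep 11 (iota 1 12) s s4.
  have e1 : keep 11 (iota 1 12) s s1 by apply: (keep_weak K1).
  have e2 : keep 11 (iota 1 12) s s2 by apply: (keep_weak_trans e1 K2).
  have e3 : keep 11 (iota 1 12) s s3 by apply: (keep_weak_trans e2 K3).
  by apply: (keep_weak_trans e3 K4).
have TT4 : tm s4 <= tm s + 4 * (tenum + tins + 2) by lia.
have LL s' : four s' -> lists 1 2 s' /\ lists 3 4 s'.
  move=> [g1 g2 g3 g4]; split.
    by exists (key (0 * m)), (key (1 * m)); split=> // r _; split; apply: key_le_total.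
  exists (fun r => total - key (2 * m) r), (fun r => total - key (3 * m) r).
  by split=> // r _; split; rewrite leq_subr.
have [l1 l2] := LL _ F4.
have d1 : [/\ [/\ eqn 5 5, eqn 6 6 & eqn aPAR aPAR],
    [/\ eqn 1 5 = false, eqn 1 6 = false, eqn 2 5 = false & eqn 2 6 = false],
    [/\ eqn 6 5 = false, eqn 5 6 = false, eqn 5 aPAR = false & eqn aPAR 5 = false]
  & [/\ eqn 6 aPAR = false, eqn aPAR 6 = false, eqn 1 aPAR = false & eqn 2 aPAR = false]] by [].
have d2 : [/\ [/\ eqn 8 8, eqn 9 9 & eqn aPAR aPAR],
    [/\ eqn 3 8 = false, eqn 3 9 = false, eqn 4 8 = false & eqn 4 9 = false],
    [/\ eqn 9 8 = false, eqn 8 9 = false, eqn 8 aPAR = false & eqn aPAR 8 = false]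
  & [/\ eqn 9 aPAR = false, eqn aPAR 9 = false, eqn 3 aPAR = false & eqn 4 aPAR = false]] by [].
apply: wp_seq; apply: (wp_init d1 c4.1 N4 l1) => s5 K5 S5 P5 Q5 T5.
have c5 := ctx_keep c4 K5 isT isT.
have F5 : four s5 by rewrite /four !(keepA K5).
have N5 : sc s5 rN = N by rewrite (keepS K5).
apply: wp_seq; apply: (wp_init d2 c5.1 N5 (LL _ F5).2) => s6 K6 S6 P6 Q6 T6.
have c6 := ctx_keep c5 K6 isT isT.
have F6 : four s6 by rewrite /four !(keepA K6).
have N6 : sc s6 rN = N by rewrite (keepS K6).
have KK6 : keep 11 (iota 1 12) s s6.
  have e5 : keep 11 (iota 1 12) s s5 by apply: (keep_weak_trans KK4 K5).
  by apply: (keep_weak_trans e5 K6).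
have S56 : side 5 6 1 2 s6 by apply: side_eq S5 _ _ _ _; rewrite (keepA K6).
have T6' : tm s6 <= tm s + 4 * (tenum + tins + 2) + 2 * (10 * N + 10) by move: T5 T6; lia.
apply: (@wp_merge found _ s6) => //.
- by split=> //; apply: LL.
- by move=> i hi; rewrite (keepA K6) // Q5.
- move=> s7 K7 nq T7; apply: hP.
  + by apply: (keep_weak_trans KK6 K7).
  + move=> [x [Sx Bx]].
    pose str b := mkseq (fun j => x (p (b * m + j))) m.
    have sE b : b < 4 -> str b \in colex m k.
      move=> hb; rewrite mem_colex size_mkseq eqxx /=.
      rewrite -sum_str ?size_mkseq // -(Bx b hb); apply/eqP.
      by rewrite big_nat [RHS]big_nat; apply: eq_bigr => j hj; rewrite nth_mkseq.
    pose r b := index (str b) (colex m k).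
    have rN b : b < 4 -> r b < N by move=> hb; rewrite -[N]size_colex index_mem sE.
    have kr b : b < 4 -> key (b * m) (r b) =
        \sum_(0 <= j < m) nth 0 inp (3 + p (b * m + j)) * x (p (b * m + j)).
      move=> hb; rewrite /key nth_index ?sE // /block_sum big_nat [RHS]big_nat.
      by apply: eq_bigr => j hj; rewrite nth_mkseq.
    have kt : key (0 * m) (r 0) + key (1 * m) (r 1) + key (2 * m) (r 2) + key (3 * m) (r 3) = t.
      rewrite -Sx (sum_blocks (fun i => nth 0 inp (3 + i) * x i)) /=.
      by rewrite !kr.
    have [[_ _ _ h1] [_ _ _ h2] [_ _ _ h3] [_ _ _ h4]] := F6.
    have [i hi Ei] := h1 _ (rN 0 isT); have [j hj Ej] := h2 _ (rN 1 isT).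
    have [u hu Eu] := h3 _ (rN 2 isT); have [v hv Ev] := h4 _ (rN 3 isT).
    apply: (nq i j u v); split=> //; rewrite Ei Ej Eu Ev.
    have k2 := @key_le_total 2 (r 2) isT; have k3 := @key_le_total 3 (r 3) isT.
    by move: kt k2 k3; clear; lia.
  + by move: T7 T6'; rewrite /tattempt; lia.
- move=> s7 K7 m7 h5 h8 E T7; apply: wp_found => //.
  + by rewrite /four !(keepA K7).
  + by rewrite (keepO K7) (keepO KK6).
  + by move: T7 T6' hT; rewrite /tattempt; lia.
Qed.

End Attempt.

(** * The search over arrangements *)

Lemma balanced_ext inp n t m k p p' : n = 4 * m -> (forall i, i < n -> p i = p' i) ->
  balanced inp n t m k p -> balanced inp n t m k p'.
Proof.
move=> hn e [x [S B]]; exists x; split=> // b hb; rewrite -(B b hb) big_nat [RHS]big_nat.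
apply: eq_bigr => j hj; rewrite e //; have : b <= 3 by []; nia.
Qed.

Lemma count_rot (Y : pred nat) i (L : seq nat) : count Y (rot i L) = count Y L.
Proof. by rewrite /rot count_cat addnC -count_cat cat_take_drop. Qed.

Lemma count_take_sum (Y : nat -> bool) (L : seq nat) o c : o + c <= size L ->
  count Y (take c (drop o L)) = \sum_(0 <= j < c) Y (nth 0 L (o + j)).
Proof.
move=> h; rewrite -sum1_count big_mkcond /= (big_nth 0) size_take size_drop.
rewrite (_ : (if _ then _ else _) = c); last by case: ltnP => //; lia.
rewrite big_nat [RHS]big_nat; apply: eq_bigr => i hi.
by rewrite nth_take ?nth_drop; [case: (Y _)|lia].
Qed.

Section Separation.
Variables (inp : seq nat) (n l t m k : nat).
Hypotheses (hn : n = 4 * m) (hl : l = 4 * k) (m0 : 0 < m).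
Definition balanced_layout (L : seq nat) := balanced inp n t m k (nth 0 L).

(** [even_split] is applied to the whole list and to both halves, since a modulus
    that separates a set also separates its subsets. *)
Lemma separated_balanced q (Y : nat -> bool) (L : seq nat) : 0 < q -> perm_eq L (iota 0 n) ->
  separates q Y n \/ separates q (predC Y) n ->
  \sum_(0 <= i < n) Y i = l -> \sum_(0 <= i < n) nth 0 inp (3 + i) * Y i = t ->
  exists h, [/\ h < n, cut_at_break q (rot h L) &
    let p1 := take m.*2 (rot h L) in let p2 := drop m.*2 (rot h L) in
    exists i j, [/\ i < m.*2, cut_at_break q (rot i p1), j < m.*2, cut_at_break q (rot j p2) &
      balanced_layout (rot i p1 ++ rot j p2)]].
Proof.
move=> q0 hp hs Sl St.
have szL : size L = n by rewrite (perm_size hp) size_iota.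
have uL : uniq L by rewrite (perm_uniq hp) iota_uniq.
have split4 (w h : nat) (L' : seq nat) : 0 < h -> size L' = h.*2 -> uniq L' -> {subset L' <= L} ->
    count Y L' = w.*2 -> exists s, [/\ s < h.*2, cut_at_break q (rot s L') & count Y (take h (rot s L')) = w].
  move=> h0 sL' uL' sub cY; apply: even_split => //.
  have ltL x : x \in L' -> x < n by move/sub; rewrite (perm_mem hp) mem_iota.
  by case: hs => hs; [left|right] => x y hx hy; apply: hs; apply: ltL.
have cL : count Y L = k.*2.*2.
  rewrite (permP hp Y) -sum1_count big_mkcond /=.
  have -> : k.*2.*2 = l by rewrite hl; lia.
  rewrite -Sl /index_iota subn0; apply: eq_bigr => i _; by case: (Y i).
have sz2 : size L = m.*2.*2 by rewrite szL hn; lia.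
have [h [hh hb hc]] := split4 k.*2 m.*2 L ltac:(lia) sz2 uL (fun _ => id) cL.
rewrite -sz2 szL in hh; exists h; split=> // p1 p2.
have s1 : size p1 = m.*2 by rewrite size_takel // size_rot sz2; lia.
have s2 : size p2 = m.*2 by rewrite size_drop size_rot sz2; lia.
have /and3P[u1 _ u2] : [&& uniq p1, ~~ has (mem p1) p2 & uniq p2].
  by rewrite -cat_uniq cat_take_drop rot_uniq.
have c2 : count Y p2 = k.*2.
  have := cL; rewrite -(count_rot Y h) -(cat_take_drop m.*2 (rot h L)) count_cat hc -/p2; lia.
have [i [hi ib1 ic]] := split4 k m p1 ltac:(lia) s1 u1 ltac:(by move=> x /mem_take; rewrite mem_rot) hc.
have [j [hj ib2 jc]] := split4 k m p2 ltac:(lia) s2 u2 ltac:(by move=> x /mem_drop; rewrite mem_rot) c2.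
exists i, j; split=> //; exists Y; split=> // b hb'.
set M := _ ++ _.
have sM : size M = m * 4 by rewrite size_cat !size_rot s1 s2; lia.
rewrite -count_take_sum; last by rewrite sM; have : b <= 3 by []; nia.
have t1 : take m M = take m (rot i p1) by rewrite takel_cat // size_rot s1; lia.
have d2 : drop m.*2 M = rot j p2 by rewrite drop_size_cat // size_rot s1.
have cc1 : count Y (rot i p1) = k.*2 by rewrite count_rot.
have cc2 : count Y (rot j p2) = k.*2 by rewrite count_rot.
have d1 : count Y (drop m (rot i p1)) = k.
  by move: cc1; rewrite -{1}(cat_take_drop m (rot i p1)) count_cat ic; lia.
have d3 : count Y (drop m (rot j p2)) = k.
  by move: cc2; rewrite -{1}(cat_take_drop m (rot j p2)) count_cat jc; lia.
case: b hb' => [|[|[|[|//]]]] _.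
- by rewrite mul0n drop0 t1.
- rewrite mul1n -d1; congr (count Y _).
  rewrite /M drop_cat size_rot s1 ifT; last by lia.
  by rewrite take_size_cat // size_drop size_rot s1; lia.
- by rewrite mul2n d2.
- have -> : 3 * m = m + m.*2 by lia.
  rewrite -drop_drop d2 take_oversize //; rewrite size_drop size_rot s2; lia.
Qed.

End Separation.

(** The bounds of a segment must not depend on the counters of the loops. *)
Definition stable (e : exp) := forall inp s s', (forall y, y < 8 -> sc s' y = sc s y) ->
  ev inp s' e = ev inp s e.

Section Search.
Variables (inp : seq nat) (V Lam : nat) (H : st -> Prop).
Variables (n l t m k : nat).
Let N := 'C(m, k).
Hypotheses (hn : n = 4 * m) (hl : l = 4 * k) (k0 : 0 < k) (km : k <= m).
Hypothesis hV : 4 * total inp n + 4 < V.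
Hypothesis hV2 : 2 * N + n + 10 < V.
Hypothesis hL : 2 * N + n + 4 < Lam.
Notation wp := (wp inp V Lam H).
Notation base := (base inp n l t m k).
Notation ctx := (ctx inp n l t m k).
Let base_kept := @base_keep inp V Lam n l t m k hn hl k0 km hV hV2 hL.
Arguments base_kept {x A s s'}.
Notation good_out := (good_out inp n l t).
Notation tattempt := (tattempt n m k).
Variable TT : nat.
Hypothesis hH : forall s, good_out (out s) -> tm s <= TT -> H s.

Definition layout s := mkseq (ar s aP) n.
Notation well_laid := (balanced_layout inp n t m k).

Lemma nth_layout s i : i < n -> nth 0 (layout s) i = ar s aP i.
Proof. by move=> h; rewrite nth_mkseq. Qed.

Lemma layout_lt s i : perm_eq (layout s) (iota 0 n) -> i < n -> ar s aP i < n.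
Proof. by move=> h hi; exact: (p_lt h). Qed.

Lemma wp_rotate P s eb el pre x q post : stable eb -> stable el ->
  perm_eq (layout s) (iota 0 n) ->
  ev inp s eb = size pre -> ev inp s el = (size q).+1 -> layout s = pre ++ (x :: q) ++ post ->
  (forall s', keep 20 [:: aP] s s' -> layout s' = pre ++ (rcons q x) ++ post ->
     tm s' <= tm s + 3 * size q + 4 -> P s') ->
  wp (rotate eb el) P s.
Proof.
move=> sb sl hp eb0 el0 E hP.
have szE : n = size pre + (size q).+1 + size post.
  by rewrite -[LHS](size_mkseq (ar s aP)) -/(layout s) E !size_cat addnA.
have [B EB] : {B | B = size pre} by eexists.
have [L EL] : {L | L = size q} by eexists.
rewrite -EB in eb0 szE; rewrite -EL in el0 szE hP.
have lt i : i < n -> ar s aP i < n by apply: layout_lt.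
have Keb s' : keep 20 [:: aP] s s' -> ev inp s' eb = B /\ ev inp s' el = L.+1.
  by move=> K; rewrite (sb inp s s') ?(sl inp s s') //; move=> y hy; rewrite (keepS K) //; lia.
apply: wp_seq; apply: wp_asg => /=; rewrite eb0.
  by apply: (@ltn_trans n); [apply: lt|]; lia.
apply: wp_seq; apply: wp_asg => /=; first by lia.
pose J i s' := [/\ keep 20 [:: aP] s s', sc s' 20 = i, sc s' 21 = ar s aP B,
  (forall j, ar s' aP j = if (B <= j) && (j < B + i) then ar s aP j.+1 else ar s aP j)
  & tm s' <= tm s + 2 + 3 * i].
apply: wp_seq; apply: (@wp_for _ _ _ _ L 0 J) => //.
- split=> //=; [by do 2 apply: keep_asg => //| |lia].
  by move=> j; rewrite ifF //; lia.
- by move=> i s' hi [K Ei _ _ _] /=; rewrite (Keb _ K).2 Ei; lia.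
- move=> i s1 hi [K Ei E1 D T1].
  have e1 : ev inp (tick s1) eb = B by exact: (Keb (tick s1) K).1.
  have Bi : ar s1 aP (B + i + 1) = ar s aP (B + i).+1 by rewrite D ifF ?addn1 //; lia.
  have ltB := lt (B + i).+1 ltac:(lia).
  apply: wp_seq; apply: wp_sto => /=; rewrite ?e1 ?Ei ?Bi; try lia.
  apply: wp_asg => /=; rewrite Ei; first by lia.
  split=> //=; [by apply: keep_asg => //; apply: keep_sto|lia| |lia].
  move=> j; rewrite -[eqn j _]/(j == B + i) D.
  case: (eqVneq j (B + i)) => [->|ne]; first by rewrite ifT //; lia.
  by congr (if _ then _ else _); lia.
- move=> s1 [K Ei E1 D T1].
  have e1 : ev inp (tick s1) eb = B by exact: (Keb (tick s1) K).1.
  have ltB := lt B ltac:(lia).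
  apply: wp_sto => /=; rewrite ?e1 ?Ei ?E1; try lia.
  apply: hP.
  + by apply: keep_sto.
  + have nE i : i < n -> ar s aP i = nth 0 (pre ++ (x :: q) ++ post) i.
      by move=> hi; rewrite -E nth_layout.
    apply: (@eq_from_nth _ 0).
      by rewrite size_mkseq !size_cat size_rcons szE EB EL addnA.
    move=> i; rewrite size_mkseq => hi; rewrite nth_layout //=.
    rewrite -[eqn i _]/(i == B + L) D nth_cat -EB nth_cat size_rcons -EL.
    case: (eqVneq i (B + L)) => [->|ne].
      rewrite ifF; last by lia.
      rewrite ifT; last by lia.
      rewrite nth_rcons -EL addKn ltnn eqxx nE; last by lia.
      by rewrite nth_cat -EB ltnn subnn.
    case: (ltnP i B) => h1.
      rewrite /= nE; last by lia.
      by rewrite nth_cat -EB h1.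
    case: (ltnP i (B + L)) => h2.
      rewrite /= nE; last by lia.
      rewrite nth_cat -EB ifF; last by lia.
      rewrite ifT; last by lia.
      rewrite nth_rcons -EL ifT; last by lia.
      rewrite subSn //= nth_cat -EL ifT //; lia.
    rewrite /=.
    rewrite (_ : (i - B < L.+1) = false); last by lia.
    rewrite nE // nth_cat -EB ifF; last by lia.
    by rewrite nth_cat /= -EL ifF //; lia.
  + by rewrite /=; lia.
Qed.

(** [G j] is what a run of [body] that does not halt establishes about rotation [j],
    [Tb] its time, and [Bd] the number of rotations for which it is run.  A full
    turn restores the arrangement. *)
Lemma wp_turn P s c eb el eh body pre seg post (G : nat -> Prop) Tb q Bd :
  7 < c < 11 -> stable eb -> stable el -> stable eh -> base s -> sc s rq = q ->
  perm_eq (layout s) (iota 0 n) -> 1 < size seg ->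
  ev inp s eb = size pre -> ev inp s el = size seg -> ev inp s eh = (size seg)./2 ->
  layout s = pre ++ seg ++ post -> 
  \sum_(j < size seg) cut_at_break q (rot j seg) <= Bd ->
  (forall s1 j, j < size seg -> keep c (iota 0 13) s s1 -> layout s1 = pre ++ rot j seg ++ post ->
     cut_at_break q (rot j seg) -> tm s1 + Tb <= tm s + (Bd * Tb + (3 * size seg + 8) * size seg + 3) ->
     wp body (fun s2 => [/\ keep c.+1 (iota 0 13) s1 s2, layout s2 = layout s1, G j &
       tm s2 <= tm s1 + Tb]) s1) ->
  (forall s', keep c (iota 0 13) s s' -> layout s' = layout s ->
     (forall j, j < size seg -> cut_at_break q (rot j seg) -> G j) ->
     tm s' <= tm s + (Bd * Tb + (3 * size seg + 8) * size seg + 3) -> P s') ->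
  wp (turn c eb el eh body) P s.
Proof.
move=> hc sb sl sh bs hq hp L0 eb0 el0 eh0 E hBd hb hP.
have szE : n = size pre + size seg + size post.
  by rewrite -[LHS](size_mkseq (ar s aP)) -/(layout s) E !size_cat addnA.
have cc : eqn c c by rewrite -[eqn c c]/(c == c).
apply: wp_seq; apply: wp_asg => /=; first by lia.
have Kev e s' : stable e -> keep c (iota 0 13) s s' -> ev inp s' e = ev inp s e.
  by move=> he K; apply: he => y hy; rewrite (keepS K) //; lia.
have hL0 : exists L, L = size seg by eexists.
have [L EL] := hL0; clear hL0; rewrite -EL in L0 el0 eh0 hBd hb hP szE.
pose bn j : nat := cut_at_break q (rot j seg).
pose cnt j := \sum_(0 <= i < j) bn i.
have hBd' : cnt L <= Bd by rewrite /cnt big_mkord.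
pose J j s' := [/\ keep c (iota 0 13) s s', sc s' c = j, layout s' = pre ++ rot j seg ++ post,
  (forall i, i < j -> cut_at_break q (rot i seg) -> G i) & 
  tm s' <= tm s + 1 + cnt j * Tb + (3 * L + 7) * j].
apply: (@wp_for _ _ _ _ L 0 J) => //.
- split=> //=; [by apply: keep_asg|by rewrite cc|by rewrite rot0|lia].
- by move=> j s' hj [K Ej _ _ _] /=; rewrite (Kev _ _ sl K) el0 Ej; lia.
- move=> j s1 hj [K Ej Pj Gj Tj].
  have bs1 := base_kept bs K ltac:(lia).
  have cntS : cnt j.+1 = cnt j + bn j by rewrite /cnt big_nat_recr.
  have cntL : cnt j.+1 <= Bd.
    by apply: leq_trans hBd'; rewrite /cnt [X in _ <= X](@big_cat_nat _ _ _ j.+1) //= ?leq_addr //; lia.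
  have szr : size (rot j seg) = L by rewrite size_rot.
  have [x [r Er]] : exists x r, rot j seg = x :: r.
    by move: szr; case: (rot j seg) => [|x r]; [move=> /=; lia|exists x, r].
  have Lr : L = (size r).+1 by rewrite -szr Er.
  have pp : perm_eq (layout s1) (iota 0 n).
    by apply: perm_trans hp; rewrite Pj E perm_cat2l perm_cat2r perm_rot perm_refl.
  have test : (ev inp (tick s1) (xcut eb el eh) != 0) = cut_at_break q (rot j seg).
    have nthr i : i < L -> ar s1 aP (size pre + i) = nth 0 (rot j seg) i.
      move=> hi; rewrite -nth_layout ?Pj; last by lia.
      rewrite nth_cat ltnNge leq_addr /= addKn nth_cat szr hi //.
    rewrite /= !(Kev _ (tick s1)) // eb0 el0 eh0 (_ : sc s1 7 = q); last by rewrite (keepS K) //; lia.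
    have n0 : ar s1 aP (size pre) = nth 0 (rot j seg) 0 by rewrite -nthr ?addn0 //; lia.
    have n1 : ar s1 aP (size pre + L - 1) = nth 0 (rot j seg) L.-1.
      by rewrite -nthr; [congr (ar s1 aP _)|]; lia.
    have n2 : ar s1 aP (size pre + L./2) = nth 0 (rot j seg) L./2 by rewrite -nthr //; lia.
    have n3 : ar s1 aP (size pre + L./2 - 1) = nth 0 (rot j seg) L./2.-1.
      by rewrite -nthr; [congr (ar s1 aP _)|]; lia.
    by rewrite n0 n1 n2 n3 /cut_at_break szr; lia.
  have cont s2 : keep c.+1 (iota 0 13) s1 s2 -> layout s2 = layout s1 -> 
      (cut_at_break q (rot j seg) -> G j) -> tm s2 <= tm s1 + 3 + bn j * Tb -> 
      wp (rotate eb el ;; incr c) (J j.+1) s2.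
    move=> K2 P2 G2 T2.
    have K2' : keep c (iota 0 13) s s2 by apply: (keep_weak_trans K K2) => //; lia.
    apply: wp_seq; apply: (@wp_rotate _ s2 eb el pre x r post) => //.
    + by rewrite P2.
    + by rewrite (Kev _ _ sb K2').
    + by rewrite (Kev _ _ sl K2') el0.
    + by rewrite P2 Pj Er.
    move=> s3 K3 P3 T3.
    have E3 : sc s3 c = j by rewrite (keepS K3) ?(keepS K2) //; lia.
    apply: wp_asg => /=; rewrite E3; first by lia.
    split=> /=; rewrite ?cc.
    + apply: keep_asg => //.
      by apply: (keep_weak_trans K2' K3) => //; lia.
    + lia.
    + have -> : rot j.+1 seg = rot 1 (rot j seg) by rewrite rotS // -EL; lia.
      by rewrite Er rot1_cons; rewrite -[RHS]P3.
    + by move=> i; rewrite ltnS leq_eqVlt => /orP[/eqP->|]; [apply: G2|apply: Gj].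
    + by rewrite cntS mulnDl; lia.
  apply: wp_seq; apply: wp_if; rewrite -?test => t1.
    have bj : cut_at_break q (rot j seg) by rewrite -test.
    have bn1 : bn j = 1 by rewrite /bn bj.
    apply: (@wp_mono _ _ _ _ _ (fun s2 => [/\ keep c.+1 (iota 0 13) (tick (tick s1)) s2,
       layout s2 = layout (tick (tick s1)), G j & tm s2 <= tm (tick (tick s1)) + Tb])).
      apply: hb => //=.
      have : cnt j.+1 * Tb <= Bd * Tb by rewrite leq_mul2r cntL orbT.
      rewrite cntS bn1 mulnDl mul1n.
      have : (3 * L + 7) * j <= (3 * L + 8) * L by apply: leq_mul; lia.
      by lia.
    move=> s2 [K2 P2 G2 T2]; apply: cont => //; move: T2 => /=; rewrite bn1; lia.
  have bj : cut_at_break q (rot j seg) = false by rewrite -test t1.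
  apply: wp_skip; apply: cont => //=; last by rewrite /bn bj; lia.
  by rewrite bj.
- move=> s1 [K Ej Pj Gj Tj]; apply: hP => //.
  + by rewrite -[layout (tick s1)]/(layout s1) Pj EL rot_size.
  + have : cnt L * Tb <= Bd * Tb by rewrite leq_mul2r hBd' orbT.
    rewrite /=; have : (3 * L + 7) * L <= (3 * L + 8) * L by rewrite leq_mul2r; lia.
    by lia.
Qed.

(** Twice [q + 2]: rotating the arrangement and cutting it in two adds at most one
    break to the [q] there are, closing up a part adds another, and each break
    is met by two rotations. *)
Definition turns q := 2 * q.+2.
Definition tlevel3 q := turns q * tattempt + (3 * m.*2 + 8) * m.*2 + 3.
Definition tlevel2 q := turns q * tlevel3 q + (3 * m.*2 + 8) * m.*2 + 3.
Definition tlevel1 q := turns q * tlevel2 q + (3 * n + 8) * n + 3.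

Let m0 : 0 < m. Proof. by lia. Qed.

Lemma cuts_le_turns q h (L : seq nat) : 0 < q -> 0 < h -> size L = h.*2 -> uniq L -> breaks q L <= q.+1 ->
  \sum_(j < size L) cut_at_break q (rot j L) <= turns q.
Proof.
move=> q0 h0 sL uL iL; rewrite sL.
by apply: leq_trans (sum_cut_at_break h0 q0 sL uL) _; rewrite /turns; lia.
Qed.

Lemma wp_level3 P s p1 p2 q : base s -> sc s rq = q -> 0 < q -> out s = [::] ->
  perm_eq (layout s) (iota 0 n) -> layout s = p1 ++ p2 -> size p1 = m.*2 -> size p2 = m.*2 ->
  breaks q p2 <= q.+1 -> tm s + tlevel3 q <= TT ->
  (forall s', keep 10 (iota 0 13) s s' -> layout s' = layout s ->
     (forall j, j < m.*2 -> cut_at_break q (rot j p2) -> ~ well_laid (p1 ++ rot j p2)) ->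
     tm s' <= tm s + tlevel3 q -> P s') ->
  wp level3 P s.
Proof.
move=> bs sq q0 os hp E s1 s2 i2 hT hP; have [_ _ _ [bm _ _ _]] := bs.
have /and3P[_ _ u2] : [&& uniq p1, ~~ has (mem p1) p2 & uniq p2].
  by rewrite -cat_uniq -E (perm_uniq hp) iota_uniq.
apply: (@wp_turn _ s 10 _ _ _ _ p1 p2 [::] (fun j => ~ well_laid (p1 ++ rot j p2)) tattempt q (turns q)) => //.
- by move=> i sa sb h /=; rewrite !h.
- by move=> i sa sb h /=; rewrite !h.
- by move=> i sa sb h /=; rewrite !h.
- by rewrite s2; lia.
- by rewrite /= bm s1 addnn.
- by rewrite /= bm s2 addnn.
- by rewrite /= bm s2 doubleK.
- by rewrite cats0.
- exact: cuts_le_turns s2 u2 i2.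
- move=> sa j hj K Ea b Ta.
  have pa : perm_eq (layout sa) (iota 0 n).
    by apply: perm_trans hp; rewrite Ea E cats0 perm_cat2l perm_rot.
  apply: (wp_attempt hn hl k0 km hV hV2 hL pa hH).
  + by split=> //; apply: base_kept bs K isT.
  + by rewrite (keepO K).
  + by apply: leq_trans Ta _; rewrite s2 -/(tlevel3 q).
  + move=> sb Kb ns Tb; split=> //.
    * by apply: (keep_weak Kb).
    * by rewrite /layout (keepA Kb).
    * rewrite -[rot j p2]cats0 -Ea => so; apply: ns; apply: balanced_ext so => // i hi.
      by rewrite nth_layout.
- move=> sa K Ea G Ta; apply: hP => //.
    by move=> j hj; apply: G; rewrite s2.
  by move: Ta; rewrite s2.
Qed.

Lemma wp_level2 P s p1 p2 q : base s -> sc s rq = q -> 0 < q -> out s = [::] ->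
  perm_eq (layout s) (iota 0 n) -> layout s = p1 ++ p2 -> size p1 = m.*2 -> size p2 = m.*2 ->
  breaks q p1 <= q.+1 -> breaks q p2 <= q.+1 -> tm s + tlevel2 q <= TT ->
  (forall s', keep 9 (iota 0 13) s s' -> layout s' = layout s ->
     (forall i, i < m.*2 -> cut_at_break q (rot i p1) ->
      forall j, j < m.*2 -> cut_at_break q (rot j p2) -> ~ well_laid (rot i p1 ++ rot j p2)) ->
     tm s' <= tm s + tlevel2 q -> P s') ->
  wp level2 P s.
Proof.
move=> bs sq q0 os hp E s1 s2 i1 i2 hT hP; have [_ _ _ [bm _ _ _]] := bs.
have /and3P[u1 _ _] : [&& uniq p1, ~~ has (mem p1) p2 & uniq p2].
  by rewrite -cat_uniq -E (perm_uniq hp) iota_uniq.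
apply: (@wp_turn _ s 9 _ _ _ _ [::] p1 p2 (fun i => forall j, j < m.*2 ->
   cut_at_break q (rot j p2) -> ~ well_laid (rot i p1 ++ rot j p2)) (tlevel3 q) q (turns q)) => //.
- by move=> i sa sb h /=; rewrite !h.
- by move=> i sa sb h /=; rewrite !h.
- by rewrite s1; lia.
- by rewrite /= bm s1 addnn.
- by rewrite /= bm s1 doubleK.
- exact: cuts_le_turns s1 u1 i1.
- move=> sa i hi K Ea b Ta.
  have pa : perm_eq (layout sa) (iota 0 n).
    by apply: perm_trans hp; rewrite Ea E cat0s perm_cat2r perm_rot.
  apply: (@wp_level3 _ sa (rot i p1) p2 q) => //.
  + exact: base_kept bs K isT.
  + by rewrite (keepS K).
  + by rewrite (keepO K).
  + by rewrite size_rot.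
  + by apply: leq_trans Ta _; rewrite s1 -/(tlevel2 q).
- move=> sa K Ea G Ta; apply: hP => //.
    by move=> i hi; apply: G; rewrite s1.
  by move: Ta; rewrite s1.
Qed.

Lemma wp_level1 P s q : base s -> sc s rq = q -> 0 < q -> out s = [::] ->
  perm_eq (layout s) (iota 0 n) -> breaks q (layout s) <= q -> tm s + tlevel1 q <= TT ->
  (forall s', keep 8 (iota 0 13) s s' -> layout s' = layout s ->
     (forall h, h < n -> cut_at_break q (rot h (layout s)) ->
      let p1 := take m.*2 (rot h (layout s)) in let p2 := drop m.*2 (rot h (layout s)) in
      forall i, i < m.*2 -> cut_at_break q (rot i p1) ->
      forall j, j < m.*2 -> cut_at_break q (rot j p2) -> ~ well_laid (rot i p1 ++ rot j p2)) ->
     tm s' <= tm s + tlevel1 q -> P s') ->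
  wp level1 P s.
Proof.
move=> bs sq q0 os hp i0 hT hP; have [b0 _ _ [bm _ _ _]] := bs.
have u0 : uniq (layout s) by rewrite (perm_uniq hp) iota_uniq.
have sz : size (layout s) = n by rewrite size_mkseq.
have sz2 : size (layout s) = m.*2.*2 by rewrite sz hn; lia.
apply: (@wp_turn _ s 8 _ _ _ _ [::] (layout s) [::] (fun h => 
  let p1 := take m.*2 (rot h (layout s)) in let p2 := drop m.*2 (rot h (layout s)) in
      forall i, i < m.*2 -> cut_at_break q (rot i p1) ->
      forall j, j < m.*2 -> cut_at_break q (rot j p2) -> ~ well_laid (rot i p1 ++ rot j p2))
   (tlevel2 q) q (turns q)) => //.
- by move=> i sa sb h /=; rewrite !h.
- by move=> i sa sb h /=; rewrite !h.
- by rewrite sz; lia.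
- by rewrite /= b0 sz.
- by rewrite /= bm sz2 doubleK addnn.
- by rewrite cats0.
- by apply: cuts_le_turns sz2 u0 _ => //; lia.
- move=> sa h hh K Ea b Ta.
  have pa : perm_eq (layout sa) (iota 0 n).
    by apply: perm_trans hp; rewrite Ea cat0s cats0 perm_rot.
  have ir := breaks_rot q h (layout s).
  have ic := breaks_cat q (take m.*2 (rot h (layout s))) (drop m.*2 (rot h (layout s))).
  rewrite cat_take_drop in ic.
  apply: (@wp_level2 _ sa (take m.*2 (rot h (layout s))) (drop m.*2 (rot h (layout s))) q) => //.
  + exact: base_kept bs K isT.
  + by rewrite (keepS K).
  + by rewrite (keepO K).
  + by rewrite cat_take_drop Ea cats0.
  + by rewrite size_takel // size_rot sz2; lia.
  + by rewrite size_drop size_rot sz2; lia.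
  + by lia.
  + by lia.
  + by apply: leq_trans Ta _; rewrite sz -/(tlevel1 q).
- move=> sa K Ea G Ta; apply: hP => //.
    by move=> h hh; apply: G; rewrite sz.
  by move: Ta; rewrite sz.
Qed.

Lemma wp_arrange P s q : base s -> sc s rq = q -> 0 < q -> q + n + 10 < V ->
  (forall s', keep 19 [:: aP] s s' -> layout s' = residue_order q n -> 
     tm s' <= tm s + 4 * n + 4 * q + 5 -> P s') ->
  wp arrange P s.
Proof.
move=> bs sq q0 hq hP; have [b0 _ _ _] := bs.
pose O r := [seq x + q * i | x <- iota 0 r, i <- iota 0 (class_size q n x)].
have OS r : O r.+1 = O r ++ [seq r + q * i | i <- iota 0 (class_size q n r)].
  by rewrite /O -[r.+1]addn1 iotaD map_cat flatten_cat /= cats0.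
have szO r c : r < q -> c <= class_size q n r -> size (O r) + c <= n.
  move=> hr hc; have : size (residue_order q n) = n by rewrite (perm_size (perm_residue_order n q0)) size_iota.
  have <- : O q = residue_order q n by [].
  have E c0 d : size (O c0) <= size (O (c0 + d)).
    by elim: d => [|d IH]; rewrite ?addn0 // addnS OS size_cat; lia.
  move=> <-; apply: (@leq_trans (size (O r.+1))).
    by rewrite OS size_cat size_map size_iota leq_add2l.
  by have := E r.+1 (q - r.+1); rewrite subnKC.
apply: wp_seq; apply: wp_asg => /=; first by lia.
apply: wp_seq; apply: wp_asg => /=; first by lia.
pose J r s' := [/\ keep 19 [:: aP] s s', sc s' 20 = r, sc s' 19 = size (O r),
  mkseq (ar s' aP) (size (O r)) = O r & tm s' <= tm s + 2 + 4 * r + 4 * size (O r)].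
apply: (@wp_for _ _ _ _ q 0 J) => //.
- by split=> //=; [do 2 apply: keep_asg => //|lia].
- by move=> r s' hr [K E _ _ _] /=; rewrite (keepS K) // sq E; lia.
- move=> r s1 hr [K E1 E2 M T1].
  have rq' : r < q by lia.
  apply: wp_seq; apply: wp_asg => /=; rewrite E1; first by lia.
  pose J2 c s' := [/\ keep 19 [:: aP] s s', sc s' 20 = r /\ sc s' 21 = r + q * c,
    sc s' 19 = size (O r) + c,
    mkseq (ar s' aP) (size (O r) + c) = O r ++ [seq r + q * i | i <- iota 0 c] &
    tm s' <= tm s + 4 + 4 * r + 4 * (size (O r) + c)].
  apply: wp_seq; apply: (@wp_for _ _ _ _ (class_size q n r) 0 J2) => //.
  + split=> //=; [by apply: keep_asg|by rewrite muln0 addn0|by rewrite addn0|by rewrite addn0 cats0|lia].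
  + move=> c s' hc [K' [_ E'] _ _ _] /=; rewrite (keepS K') // b0 E' ltn_class_size //.
    by rewrite subn_eq0 -ltnNge.
  + move=> c s2 hc [K2 [E3 E4] E5 M2 T2].
    have lt : r + q * c < n by rewrite -ltn_class_size //; case/andP: hc.
    have ltn' := szO r c.+1 rq' ltac:(by case/andP: hc).
    apply: wp_seq; apply: wp_sto => /=; rewrite ?E4 ?E5; try lia.
    apply: wp_seq; apply: wp_asg => /=; rewrite ?E5; first by lia.
    apply: wp_asg => /=; rewrite ?E4 ?(keepS K2 rq isT) ?sq; first by lia.
    split=> //=.
    * by do 2 apply: keep_asg => //; apply: keep_sto.
    * by split=> //; rewrite mulnS; lia.
    * lia.
    * transitivity (O r ++ [seq r + q * i | i <- iota 0 c.+1]); last by [].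
      have -> : iota 0 c.+1 = iota 0 c ++ [:: c] by rewrite -[c.+1]addn1 iotaD.
      rewrite map_cat catA -M2 cats1 addnS mkseqS.
      have U i : upd (ar s2 aP) (size (O r) + c) (r + q * c) i =
          if i == size (O r) + c then r + q * c else ar s2 aP i by [].
      rewrite U eqxx; congr rcons; apply/eq_in_map => i; rewrite mem_iota add0n => /andP[_ hi].
      by rewrite U ifF //; lia.
    * lia.
  + move=> s2 [K2 [E3 E4] E5 M2 T2]; apply: wp_asg => /=; rewrite E3; first by lia.
    have sOS : size (O r.+1) = size (O r) + class_size q n r by rewrite OS size_cat size_map size_iota.
    split=> /=; rewrite ?sOS.
    * by apply: keep_asg.
    * lia.
    * by [].
    * by rewrite OS.
    * by lia.
- move=> s1 [K E1 E2 M T1].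
  have so : size (O q) = n by rewrite (perm_size (perm_residue_order n q0)) size_iota.
  rewrite so in M T1; apply: hP => //.
  by rewrite /=; lia.
Qed.

Variable Qm : nat.
Definition tround := 4 * n + 4 * Qm + 8 + tlevel1 Qm.

Lemma tlevel1_mono q : q <= Qm -> tlevel1 q <= tlevel1 Qm.
Proof.
move=> h; have ht : turns q <= turns Qm by rewrite /turns; lia.
have h3 : tlevel3 q <= tlevel3 Qm by rewrite /tlevel3 !leq_add2r leq_mul.
have h2 : tlevel2 q <= tlevel2 Qm by rewrite /tlevel2 !leq_add2r leq_mul.
by rewrite /tlevel1 !leq_add2r leq_mul.
Qed.

Lemma wp_quarter P s x y w : 6 < V -> y < 7 -> y != x -> sc s x = 4 * w -> 4 * w + 6 < V ->
  (forall s', (forall z, z != y -> sc s' z = sc s z) -> ar s' = ar s -> out s' = out s ->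
     sc s' y = w -> tm s' <= tm s + 2 * w + 2 -> P s') ->
  wp (quarter x y) P s.
Proof.
move=> V6 hy ne hx hw hP; have yy : eqn y y by rewrite -[eqn y y]/(y == y).
apply: wp_seq; apply: wp_asg => /=; first by lia.
apply: (@wp_for _ _ _ _ w 0 (fun i s' => [/\ forall z, z != y -> sc s' z = sc s z,
  ar s' = ar s, out s' = out s, sc s' y = i & tm s' <= tm s + 1 + 2 * i])) => //.
- split=> //=; [|by rewrite yy|lia].
  by move=> z hz; rewrite -[eqn z y]/(z == y) (negbTE hz).
- by move=> i s' hi [h1 _ _ h4 _] /=; rewrite h4 h1 1?eq_sym // hx; lia.
- move=> i s1 hi [h1 h2 h3 h4 h5]; apply: wp_asg => /=; rewrite h4; first by lia.
  split=> //=; [|by rewrite yy; lia|lia].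
  by move=> z hz; rewrite -[eqn z y]/(z == y) (negbTE hz) h1.
- by move=> s1 [h1 h2 h3 h4 h5]; apply: hP => //=; lia.
Qed.

(** The loop has no exit of its own.  If the body with modulus [q0] fell through,
    there would be no balanced rotation at breaks, against
    [separated_balanced]; so the variant [q0 - q] decreases. *)
Lemma wp_search s q0 (Y : nat -> bool) : sc s rn = n -> sc s rl = l -> sc s rt = t -> out s = [::] ->
  0 < q0 <= Qm -> Qm + n + 10 < V -> l <= n -> t < V -> 
  separates q0 Y n \/ separates q0 (predC Y) n ->
  \sum_(0 <= i < n) Y i = l -> \sum_(0 <= i < n) nth 0 inp (3 + i) * Y i = t ->
  tm s + 6 * n + 20 + Qm * tround <= TT -> wp search (fun=> False) s.
Proof.
move=> s0 s1 s2 os hq hQV ln tV hsep Sl St hT.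
apply: wp_seq; apply: (@wp_quarter _ s 0 3 m) => //; [lia|by rewrite s0|lia|].
move=> sa a1 a2 a3 a4 a5.
apply: wp_seq; apply: (@wp_quarter _ sa 1 4 k) => //; [lia|by rewrite a1 ?s1|lia|].
move=> sb c1 c2 c3 c4 c5.
apply: wp_seq; apply: wp_asg => /=; first by lia.
apply: wp_seq; apply: wp_asg => /=; first by lia.
pose J i s' := [/\ (forall y, y < 5 -> sc s' y = sc sb y), out s' = [::], sc s' 20 = i,
  sc s' 5 = \sum_(0 <= j < i) nth 0 inp (3 + j) & tm s' <= tm sb + 2 + 3 * i].
apply: wp_seq; apply: (@wp_for _ _ _ _ n 0 J) => //.
- split=> //=; [|by rewrite c3 a3|by rewrite big_geq|lia].
  by move=> y hy; rewrite -[eqn y 20]/(y == 20) -[eqn y 5]/(y == 5) !ifF //; lia.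
- by move=> i s' hi [h1 _ h3 _ _] /=; rewrite h1 // c1 // a1 // s0 h3; lia.
- move=> i s' hi [h1 h2 h3 h4 h5].
  have le : \sum_(0 <= j < i.+1) nth 0 inp (3 + j) <= total inp n.
    by rewrite /total [X in _ <= X](@big_cat_nat _ _ _ i.+1) //= ?leq_addr //; lia.
  apply: wp_seq; apply: wp_asg => /=; rewrite h4 h3.
    by move: le; rewrite big_nat_recr //=; lia.
  apply: wp_asg => /=; rewrite h3; first by lia.
  split=> //=; [|lia|by rewrite big_nat_recr|lia].
  by move=> y hy; rewrite -[eqn y 20]/(y == 20) -[eqn y 5]/(y == 5) !ifF ?h1 //; lia.
move=> sd [h1 h2 h3 h4 h5].
apply: wp_seq; apply: wp_asg => /=; rewrite h4 -/(total inp n); first by lia.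
apply: wp_seq; apply: wp_asg => /=; first by lia.
set s3 := asg _ _ _.
have bs3 : base s3.
  split; [| | |split] => /=; try by rewrite h1 // c1 // a1.
  - exact: h4.
  - by lia.
have os3 : out s3 = [::] by [].
have q3 : sc s3 rq = 1 by [].
have T3 : tm s3 <= tm s + 5 * n + 13 by move: a5 c5 h5 => /=; lia.
clearbody s3.
apply: (@wp_while _ _ _ _ (fun s' => [/\ base s', out s' = [::], 0 < sc s' rq <= q0 &
  tm s' <= tm s3 + (sc s' rq).-1 * tround]) (fun s' => q0 - sc s' rq)).
- by split=> //; rewrite ?q3; lia.
- by [].
- move=> s4 [bs4 os4 hq4 T4] _.
  have [q Eq] : {q | q = sc s4 rq} by eexists.
  rewrite -Eq in hq4 T4 *.
  have qQ : q <= Qm by lia.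
  have tl := tlevel1_mono qQ.
  have TT4 : tm s4 + tround <= TT.
    apply: leq_trans hT; have : q.-1 * tround + tround <= Qm * tround.
      by rewrite -mulSnr leq_mul2r; lia.
    by lia.
  apply: wp_seq; apply: (@wp_arrange _ (tick s4) q) => //=; [lia|lia|].
  move=> s5 K5 P5 T5.
  have pe : perm_eq (layout s5) (iota 0 n) by rewrite P5; apply: perm_residue_order; lia.
  apply: wp_seq; apply: (@wp_level1 _ s5 q) => //.
  + exact: base_kept bs4 K5 isT.
  + by rewrite (keepS K5).
  + lia.
  + by rewrite (keepO K5).
  + by rewrite P5 breaks_residue_order.
  + by move: T5 => /=; rewrite /tround in TT4; lia.
  move=> s6 K6 P6 G T6.
  have q6 : sc s6 rq = q by rewrite (keepS K6) // (keepS K5).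
  apply: wp_asg => /=; rewrite q6; first by lia.
  have qne : q != q0.
    apply/eqP => qq; have q0p : 0 < q0 by lia.
    have [h [g1 g2 [i [j [i1 i2 j1 j2 so]]]]] := separated_balanced hn hl m0 q0p pe hsep Sl St.
    by rewrite -qq in g2 i2 j2; apply: (G h g1 g2 i i1 i2 j j1 j2 so).
  split; last by lia.
  split=> //=.
  + have K56 : keep 7 (iota 0 13) s4 s6.
      have k5 : keep 7 (iota 0 13) s4 s5 by apply: (keep_weak K5).
      by apply: (keep_weak_trans k5 K6).
    have K7 : keep 7 (iota 0 13) s4 (asg s6 7 (q + 1)) by apply: keep_asg.
    exact: base_kept bs4 K7 isT.
  + by rewrite (keepO K6) (keepO K5).
  + lia.
  + have -> : (q + 1).-1 = q.-1.+1 by lia.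
    by move: T5 T6 T4 => /=; rewrite mulSnr /tround; lia.
Qed.

End Search.

(** * Running the compiled solver *)

Lemma wp_ones inp V Lam (H : st -> Prop) n s : sc s rn = n -> out s = [::] -> n + 2 < V ->
  (forall s', rev (out s') = nseq n 1 -> tm s' <= tm s + 3 * n + 4 -> H s') ->
  wp inp V Lam H ones (fun=> False) s.
Proof.
move=> s0 os nV hH; apply: wp_seq; apply: wp_asg => /=; first by lia.
apply: wp_seq; apply: (@wp_for _ _ _ _ n 0 (fun i s' => [/\ sc s' rn = n, sc s' 20 = i,
  rev (out s') = nseq i 1 & tm s' <= tm s + 1 + 3 * i])) => //.
- by split=> //=; [rewrite os|lia].
- by move=> i s' hi [h1 h2 _ _] /=; rewrite h1 h2; lia.
- move=> i s' hi [h1 h2 h3 h4]; apply: wp_seq; apply: wp_wr; apply: wp_asg => /=; rewrite h2; first by lia.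
  split=> //=; [lia| |lia].
  by rewrite rev_cons h3 -cats1 -[[:: 1]]/(nseq 1 1) -nseqD addn1.
- by move=> s' [h1 h2 h3 h4]; apply: wp_halt; apply: hH => //=; lia.
Qed.

Definition st0 := St (fun=> 0) (fun _ _ => 0) [::] 0.

Lemma wp_solver_full inp V Lam (H : st -> Prop) n t :
  nth 0 inp 0 = n -> nth 0 inp 1 = n -> nth 0 inp 2 = t -> n + 2 < V -> t < V ->
  (forall s', rev (out s') = nseq n 1 -> tm s' <= 3 * n + 8 -> H s') ->
  wp inp V Lam H solver (fun=> False) st0.
Proof.
move=> i0 i1 i2 nV tV hH.
apply: wp_seq; apply: wp_asg => /=; rewrite i0; first by lia.
apply: wp_seq; apply: wp_asg => /=; rewrite i1; first by lia.
apply: wp_seq; apply: wp_asg => /=; rewrite i2; first by lia.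
apply: wp_if => /=; first by rewrite subnn.
by move=> _; apply: (@wp_ones _ _ _ _ n) => //= s' h1 h2; apply: hH => //; lia.
Qed.

Lemma wp_solver_search inp V Lam (H : st -> Prop) n l t m k q0 Qm (Y : nat -> bool) TT :
  nth 0 inp 0 = n -> nth 0 inp 1 = l -> nth 0 inp 2 = t ->
  n = 4 * m -> l = 4 * k -> 0 < k -> k < m ->
  4 * total inp n + 4 < V -> 2 * 'C(m, k) + n + 10 < V -> 2 * 'C(m, k) + n + 4 < Lam ->
  0 < q0 <= Qm -> Qm + n + 10 < V -> t < V ->
  separates q0 Y n \/ separates q0 (predC Y) n ->
  \sum_(0 <= i < n) Y i = l -> \sum_(0 <= i < n) nth 0 inp (3 + i) * Y i = t ->
  6 * n + 24 + Qm * tround n m k Qm <= TT ->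
  (forall s, good_out inp n l t (out s) -> tm s <= TT -> H s) ->
  wp inp V Lam H solver (fun=> False) st0.
Proof.
move=> i0 i1 i2 hn hl k0 km hV hV2 hL hq hQ tV hs Sl St hT hH.
apply: wp_seq; apply: wp_asg => /=; rewrite i0; first by lia.
apply: wp_seq; apply: wp_asg => /=; rewrite i1; first by lia.
apply: wp_seq; apply: wp_asg => /=; rewrite i2; first by lia.
apply: wp_if => /=; last by lia.
move=> _; apply: (@wp_search _ _ _ _ n l t m k hn hl k0 (ltnW km) hV hV2 hL TT hH Qm _ q0 Y) => //=; lia.
Qed.

Definition compile (c : cmd) : program := comp (csize c) 0 c.

Lemma det_step p inp w s : deterministic p -> step p inp w s = step p inp false s.
Proof.
rewrite /deterministic => /(all_nthP (IJump 0)) dp; rewrite /step /halted; case: leqP => // h.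
have := dp _ h.
by case: (nth _ _ _).
Qed.

Lemma det_run p inp w k : deterministic p ->
  run p inp w k = iter k (det_stp inp p) (Config 0 [fsfun] [::]).
Proof. by move=> dp; elim: k => //= k ->; rewrite det_step. Qed.

Lemma halted_det_stp inp p s : halted p s -> det_stp inp p s = s.
Proof. by rewrite /det_stp /step => ->. Qed.

Lemma halted_iter inp p s k : halted p s -> iter k (det_stp inp p) s = s.
Proof. by move=> h; elim: k => //= k ->; apply: halted_det_stp. Qed.

Lemma reach_iter inp V Lam p k c c' : reach inp V Lam p k c c' ->
  iter k (det_stp inp p) c = c' /\ forall j, j <= k -> bnded V Lam (Defs.mem (iter j (det_stp inp p) c)).
Proof.
elim: k c => [|k IH] c /=; first by move=> [<- b]; split=> // j; rewrite leqn0 => /eqP->.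
move=> [b /IH[h1 h2]]; split; first by rewrite -iterS iterSr.
by case=> [|j] hj //; rewrite iterSr; apply: h2.
Qed.

Lemma bitsize_lt x w : 0 < w -> x < 2 ^ w -> bitsize x <= w.
Proof.
rewrite /bitsize => w0 h; case: (posnP x) => [->|x0]; first by rewrite trunc_log0.
by rewrite -(ltn_exp2l _ _ (ltnSn 1)); apply: leq_ltn_trans (trunc_logP _ _) h.
Qed.

(** At most [48 + 16 * Lam] registers are in use, each with an address and a content
    of at most [w] bits; an instruction has at most two operands of this size.
    The bounds hold for every coin sequence because the code has no coin. *)
Lemma machine_run (cm : cmd) inp V Lam w TT (G : seq nat -> Prop) :
  fits cm -> 0 < V -> (forall i, nth 0 inp i < V) -> 1024 * V <= 2 ^ w -> 0 < w ->
  48 + 16 * Lam <= 2 ^ w ->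
  wp inp V Lam (fun s => G (rev (out s)) /\ tm s <= TT) cm (fun=> False) st0 ->
  let prog := compile cm in
  exists K, [/\ K <= 200 * TT,
    forall c k, K <= k -> halted prog (run prog inp c k),
    forall c k, halted prog (run prog inp c k) -> G (output (run prog inp c k)),
    forall c k, step_cost prog inp (run prog inp c k) <= 2 * w &
    forall c k, mem_bits (Defs.mem (run prog inp c k)) <= (48 + 16 * Lam) * (2 * w)].
Proof.
move=> okcm V0 iV Vw w0 Aw [halts [s' [E P]]] prog.
case: halts E P => // E [Gs Ts].
have R0 : represents V Lam [fsfun] st0.
  split=> [x hx|al i hal|]; rewrite ?fsfunE //; split=> // r; rewrite ?fsfunE ?/val_bound //; lia.
have ca : code_at prog 0 (comp (csize cm) 0 cm) by exists [::], [::]; rewrite cats0.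
have [K [m' [hK R' rc]]] := sim V0 iV E okcm R0 ca.
have [hi hb] := reach_iter rc.
have hh : halted prog (Config (csize cm) m' (out s')) by rewrite /halted size_comp.
have dp : deterministic prog := deterministic_comp _ _ _.
have runE c k : run prog inp c k = iter (minn k K) (det_stp inp prog) (Config 0 [fsfun] [::]).
  rewrite (det_run _ _ _ dp); case: (leqP k K) => h //.
  by rewrite -(subnK (ltnW h)) iterD hi halted_iter.
have bk c k : bnded V Lam (Defs.mem (run prog inp c k)) by rewrite runE; apply: hb; rewrite geq_minr.
have bs x : x < 1024 * V -> bitsize x <= w by move=> h; apply: bitsize_lt => //; apply: leq_trans Vw.
exists K; split.
- by move: hK => /=; rewrite /cmd_steps; lia.
- by move=> c k h; rewrite runE (minn_idPr h) hi.
- move=> c k h.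
  have -> : run prog inp c k = Config (csize cm) m' (out s').
    by rewrite -(halted_iter inp K h) (det_run _ _ _ dp) -iterD addnC iterD hi halted_iter.
  exact: Gs.
- move=> c k; have [b1 _] := bk c k; have [b3 _] := bk c k.+1; move: b3 => /=.
  set cf := run _ _ _ _ in b1 *.
  have bm r : bitsize (Defs.mem cf r) <= w by apply/bs/b1.
  have bi j : bitsize (nth 0 inp j) <= w by apply: bs; have := iV j; lia.
  rewrite /step_cost /step; case: ifP => // nh.
  have l2 x y : x <= w -> y <= w -> x + y <= 2 * w by lia.
  have l1 x : x <= w -> x <= 2 * w by lia.
  case: (nth _ _ _) => [r v|r s1 u|r s1 u|r s1|r s1|r s1|r|s1|q|s1 q] /= b3;
    rewrite ?l2 ?bm ?bi //; try (by apply/l1/bm); try lia.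
  by apply/l1/bs; have := b3 r; rewrite fsfun_withE eqxx.
- move=> c k; have [b1 b2] := bk c k; set m := Defs.mem _ in b1 b2 *.
  have sub : {subset finsupp m <= iota 0 (48 + 16 * Lam)}.
    move=> r; rewrite mem_finsupp mem_iota /= => nz; rewrite ltnNge; apply/negP => h.
    by rewrite b2 ?eqxx in nz.
  have sz : size (finsupp m) <= 48 + 16 * Lam.
    by rewrite -[X in _ <= X](size_iota 0); apply: uniq_leq_size => //; apply: fset_uniq.
  apply: (@leq_trans (\sum_(r <- finsupp m) 2 * w)).
    rewrite /mem_bits big_seq [X in _ <= X]big_seq; apply: leq_sum => r /sub.
    rewrite mem_iota /= => hr; have h1 : bitsize r <= w by apply: bitsize_lt => //; lia.
    have h2 : bitsize (m r) <= w by apply/bs/b1.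
    by lia.
  by rewrite big_const_seq count_predT iter_addn_0 mulnC leq_mul2r sz orbT.
Qed.

Lemma fits_solver : fits solver. Proof. by vm_compute. Qed.

(** * Bounds in terms of one binomial coefficient *)

Lemma pow2_le e x : 1 < x -> 2 ^ e <= x ^ e.
Proof. by move=> h; case: e => // e; rewrite leq_exp2r. Qed.

Section Bounds.
Variables (n m k : nat).
Let N := 'C(m, k).
Hypotheses (hn : n = 4 * m) (k0 : 0 < k) (km : k < m).
(** All overheads are expressed as powers of this quantity, which is at least 2, so
    that a numerical constant is absorbed by raising the exponent. *)
Definition log_factor (N : nat) := (trunc_log 2 N).+2.
Let L := log_factor N.

Let mN : m <= N. Proof. by apply: bin_ratio_ge; rewrite k0. Qed.
Let N0 : 1 < N. Proof. by apply: leq_trans mN; lia. Qed.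
Let L2 : 1 < L. Proof. by []. Qed.
Let lgL : trunc_log 2 (2 * N) <= L.
Proof.
have [t Et] : {t | t = trunc_log 2 N} by eexists.
rewrite mul2n trunc_log2_double; [by rewrite /L /log_factor; lia|lia].
Qed.

Let M := N * N.
Let M1 : 0 < M. Proof. by rewrite muln_gt0; lia. Qed.
Let NM : N <= M. Proof. by rewrite leq_pmulr //; lia. Qed.
Let mNM : m * N <= M. Proof. by rewrite leq_mul2r mN orbT. Qed.
Let mmM : m * m <= M. Proof. by apply: leq_mul. Qed.

Lemma tattempt_le : tattempt n m k <= M * L ^ 11.
Proof.
apply: (@leq_trans (M * (32 * L + 900))).
  have h1 : (8 * trunc_log 2 (2 * N) + 14) * (2 * N * N + 1) <= (8 * L + 14) * (3 * M).
    by apply: leq_mul; have := M1; have := lgL; rewrite /M; lia.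
  rewrite /tattempt /tfound /tenum /tins -/N.
  have := M1; have := NM; have := mNM; have := mmM; move: h1.
  have LM : L <= L * (N * N) by apply: leq_pmulr; exact: M1.
  have lL := lgL; have mN' := mN.
  by rewrite /M hn; lia.
rewrite leq_mul2l; apply/orP; right.
have := pow2_le 10 L2; rewrite [L ^ 11]expnS => h.
have h2 : 1024 <= L ^ 10 by apply: leq_trans h.
by apply: (@leq_trans (L * 1024)); [lia|rewrite leq_mul2l h2 orbT].
Qed.

(** One level of rotation multiplies the time by at most [L ^ 12] and adds the time
    of the rotations themselves. *)
Lemma grow e x y : 7 <= e -> x <= M * L ^ e -> y <= 100 * M ->
  L ^ 12 * x + y <= M * L ^ (e + 13).
Proof.
move=> he hx hy.
have h1 : L ^ 12 * x <= M * L ^ (e + 12).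
  by apply: (@leq_trans (L ^ 12 * (M * L ^ e))); [rewrite leq_mul2l hx orbT|rewrite mulnCA -expnD addnC].
have h2 : 100 * M <= M * L ^ (e + 12).
  rewrite mulnC leq_mul2l; apply/orP; right.
  apply: leq_trans (pow2_le (e + 12) L2).
  by apply: (@leq_trans (2 ^ 7)); [|rewrite leq_exp2l //; lia].
have -> : M * L ^ (e + 13) = M * L ^ (e + 12) * L by rewrite -mulnA -expnSr addnS.
apply: (@leq_trans (M * L ^ (e + 12) * 2)); [lia|by rewrite leq_mul2l L2 orbT].
Qed.

Variable Qm : nat.
Hypothesis hQ : Qm <= L ^ 10.

Let turns_le : turns Qm <= L ^ 12.
Proof.
rewrite /turns (expnD _ 10 2); have h : 4 <= L ^ 2 by apply: (pow2_le 2 L2).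
have h10 : 2 <= L ^ 10 by apply: leq_trans (pow2_le 10 L2).
by apply: (@leq_trans (L ^ 10 * 4)); [lia|rewrite leq_mul2l h orbT].
Qed.

Lemma search_time_le : 6 * n + 24 + Qm * tround n m k Qm <= M * L ^ 62.
Proof.
have rest : (3 * m.*2 + 8) * m.*2 + 3 <= 100 * M by rewrite -mul2n; lia.
have restn : (3 * n + 8) * n + 3 <= 100 * M by rewrite hn; lia.
have l3 : tlevel3 n m k Qm <= M * L ^ 24.
  rewrite /tlevel3 -addnA; apply: (@leq_trans (L ^ 12 * tattempt n m k + ((3 * m.*2 + 8) * m.*2 + 3))).
    by rewrite leq_add2r leq_mul2r turns_le orbT.
  exact: (@grow 11 _ _ _ tattempt_le rest).
have l2 : tlevel2 n m k Qm <= M * L ^ 37.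
  rewrite /tlevel2 -addnA; apply: (@leq_trans (L ^ 12 * tlevel3 n m k Qm + ((3 * m.*2 + 8) * m.*2 + 3))).
    by rewrite leq_add2r leq_mul2r turns_le orbT.
  exact: (@grow 24 _ _ _ l3 rest).
have l1 : tlevel1 n m k Qm <= M * L ^ 50.
  rewrite /tlevel1 -addnA; apply: (@leq_trans (L ^ 12 * tlevel2 n m k Qm + ((3 * n + 8) * n + 3))).
    by rewrite leq_add2r leq_mul2r turns_le orbT.
  exact: (@grow 37 _ _ _ l2 restn).
have ML e : M <= M * L ^ e by rewrite leq_pmulr // expn_gt0.
have LM e : L ^ e <= M * L ^ e by rewrite leq_pmull.
have lr : tround n m k Qm <= M * L ^ 51.
  rewrite /tround expnS mulnCA.
  have h1 := LM 10; have h3 : 24 + 4 * L ^ 10 <= L ^ 50.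
    have -> : L ^ 50 = L ^ 40 * L ^ 10 by rewrite -expnD.
    have h4 : 28 <= L ^ 40.
      by apply: leq_trans (pow2_le 40 L2); apply: (@leq_trans (2 ^ 5)) => //; rewrite leq_exp2l.
    have h5 : 0 < L ^ 10 by rewrite expn_gt0.
    by apply: (@leq_trans (28 * L ^ 10)); [lia|rewrite leq_mul2r h4 orbT].
  have h6 : M * (24 + 4 * L ^ 10) <= M * L ^ 50 by rewrite leq_mul2l h3 orbT.
  apply: (@leq_trans (2 * (M * L ^ 50))); last by rewrite leq_mul2r L2 orbT.
  have aux (x y q tl u v : nat) : u <= v -> 0 < v -> q <= x -> x <= v * x ->
      v * (24 + 4 * x) <= y -> tl <= y -> 4 * (4 * u) + 4 * q + 8 + tl <= 2 * y by clear; lia.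
  by rewrite hn in l1 *; apply: (aux (L ^ 10) _ _ _ m M) => //; apply: leq_trans mN NM.
apply: (@leq_trans (48 * M + M * L ^ 61)).
  apply: leq_add; first by rewrite hn; lia.
  apply: (@leq_trans (L ^ 10 * (M * L ^ 51))); first by apply: leq_mul.
  by rewrite mulnCA -expnD.
have h7 : 48 * M <= M * L ^ 61.
  rewrite mulnC leq_mul2l; apply/orP; right.
  by apply: leq_trans (pow2_le 61 L2); apply: (@leq_trans (2 ^ 6)) => //; rewrite leq_exp2l.
have -> : M * L ^ 62 = M * L ^ 61 * L by rewrite -mulnA -expnSr.
apply: (@leq_trans (M * L ^ 61 * 2)); [lia|by rewrite leq_mul2l L2 orbT].
Qed.

End Bounds.

Lemma exp2_bin n k : k <= n -> 2 ^ minn k (n - k) <= 'C(n, k).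
Proof.
move=> h; case: (leqP k (n - k)) => h'; first by apply: exp2_bin_half; lia.
by rewrite -bin_sub //; apply: exp2_bin_half; lia.
Qed.

Definition modulus_bound (n z : nat) := 2 * (z ^ 2 * (trunc_log 2 n).+1 + 1).

(** [2 ^ minn k (m - k) <= 'C(m, k)] makes the smaller of [l] and [n - l] at most
    [4 * log2 N], and [n <= 4 * N] takes care of the logarithm of [n]. *)
Lemma modulus_bound_le n l m k z : n = 4 * m -> l = 4 * k -> 0 < k -> k < m -> z <= minn l (n - l) ->
  modulus_bound n z <= log_factor 'C(m, k) ^ 10.
Proof.
move=> hn hl k0 km hz; set N := 'C(m, k).
have mN : m <= N by apply: bin_ratio_ge; rewrite k0.
have N1 : 0 < N by lia.
have mk : minn k (m - k) <= trunc_log 2 N.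
  by apply: trunc_log_max => //; apply: exp2_bin; lia.
have ln : trunc_log 2 n <= (trunc_log 2 N).+2.
  apply: (@leq_trans (trunc_log 2 (N.*2.*2))); first by apply: leq_trunc_log; rewrite hn; lia.
  by rewrite !trunc_log2_double //; lia.
have [T ET] : {T | T = trunc_log 2 N} by eexists.
rewrite /modulus_bound /log_factor -ET in mk ln *; set L := T.+2.
have zL : z <= 4 * L by lia.
have z2 : z ^ 2 <= 16 * L ^ 2.
  have -> : 16 * L ^ 2 = (4 * L) ^ 2 by rewrite expnMn.
  by rewrite leq_exp2r.
have h : z ^ 2 * (trunc_log 2 n).+1 <= 16 * L ^ 2 * (2 * L) by apply: leq_mul; lia.
have h3 : L ^ 3 = L ^ 2 * L by rewrite expnSr.
have h7 : 2 ^ 7 <= L ^ 7 by apply: pow2_le.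
have -> : L ^ 10 = L ^ 3 * L ^ 7 by rewrite -expnD.
apply: (@leq_trans (L ^ 3 * 2 ^ 7)); last by rewrite leq_mul2l h7 orbT.
have : 0 < L ^ 3 by rewrite expn_gt0.
have -> : 2 ^ 7 = 128 by [].
by lia.
Qed.

Section Instance.
Variable i : instance.
Hypothesis vi : valid_instance i.
Let n := inst_n i. Let l := inst_l i. Let t := inst_t i.
Let m := n %/ 4. Let k := l %/ 4.
Let N := 'C(m, k).
Let b := inst_bits i.
Let L := log_factor N.
Let inp := inst_input i.

Let hn : n = 4 * m.
Proof. by case: vi => h _ _ _ _; rewrite /m mulnC divnK. Qed.
Let hl : l = 4 * k.
Proof. by case: vi => _ h _ _ _; rewrite /k mulnC divnK. Qed.
Let t0 : 0 < t. Proof. by case: vi. Qed.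

Lemma solution_fun : exists Y : nat -> bool, \sum_(0 <= j < n) Y j = l /\
  \sum_(0 <= j < n) nth 0 inp (3 + j) * Y j = t.
Proof.
case: vi => _ _ _ _ [x [cx mem_after]]; exists (nth false x); split.
  rewrite -[RHS]cx -sum1_count [RHS]big_mkcond /= (big_nth false) size_tuple.
  by apply: eq_bigr => j _; case: (nth _ _ _).
rewrite -[RHS]mem_after big_mkord; apply: eq_bigr => j _.
by rewrite (tnth_nth 0) (tnth_nth false).
Qed.

Lemma weight_pos j : j < n -> 0 < nth 0 inp (3 + j).
Proof. by move=> hj; case: vi => _ _ _ /(_ (Ordinal hj)) + _; rewrite (tnth_nth 0). Qed.

Lemma inst_l_le_t : l <= t.
Proof.
have [Y [<- <-]] := solution_fun; rewrite big_nat [X in _ <= X]big_nat.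
by apply: leq_sum => j hj; have := weight_pos hj; case: (Y j); lia.
Qed.

Lemma inst_l_le_n : l <= n.
Proof.
have [Y [<- _]] := solution_fun; apply: (@leq_trans (\sum_(0 <= j < n) 1)).
  by apply: leq_sum => j _; case: (Y j).
by rewrite sum_nat_const_nat; lia.
Qed.

Lemma quarter_pos : 0 < k.
Proof.
rewrite lt0n; apply/eqP => kz; have [Y [Sl St]] := solution_fun.
have l0 : l = 0 by rewrite hl kz.
have Y0 j : j < n -> Y j = false.
  move=> hj; move: Sl; rewrite l0 big_mkord => /eqP; rewrite sum_nat_eq0.
  by move=> /forallP/(_ (Ordinal hj)) /=; case: (Y j).
move: t0; rewrite -St big_nat big1 // => j hj.
by rewrite Y0 // muln0.
Qed.

Lemma bitsize_ge x : x < 2 ^ bitsize x.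
Proof. exact: trunc_log_ltn. Qed.

Lemma target_bits : t < 2 ^ b.
Proof.
apply: leq_trans (bitsize_ge t) _; rewrite leq_exp2l //.
by apply: (leq_bigmax_seq (F := bitsize)) => //; rewrite mem_head.
Qed.

Lemma weight_bits j : nth 0 inp (3 + j) < 2 ^ b.
Proof.
case: (ltnP j n) => hj; last first.
  by rewrite nth_default ?expn_gt0 //= size_tuple -/n; lia.
apply: leq_trans (bitsize_ge _) _; rewrite leq_exp2l //.
apply: (leq_bigmax_seq (F := bitsize)) => //=; rewrite inE mem_nth ?orbT //.
by rewrite size_tuple.
Qed.

Lemma inst_bits_pos : 0 < b.
Proof. by have := target_bits; case: b => //; lia. Qed.

Lemma total_bits : total inp n <= n * 2 ^ b.
Proof.
apply: (@leq_trans (\sum_(0 <= j < n) 2 ^ b)); last by rewrite sum_nat_const_nat subn0.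
by apply: leq_sum => j _; apply/ltnW/weight_bits.
Qed.

Lemma good_output o : good_out inp n l t o -> output_solves i (rev o).
Proof.
move=> [x [ho Sl St]]; exists [tuple x j | j < n].
  split.
    rewrite -[RHS]Sl -sum1_count big_mkcond /= big_map enumT -/(index_enum _) [RHS]big_mkord.
    by apply: eq_bigr => j _; case: (x j).
  rewrite -[RHS]St [RHS]big_mkord; apply: eq_bigr => j _.
  by rewrite tnth_mktuple (tnth_nth 0).
by rewrite ho /mkseq -val_enum_ord -map_comp /= -map_comp.
Qed.

(** [K] bounds the number of steps and [c] the cost of each of them.  The factor [l]
    pays for the case [l = n], where [N = 1] but all [n] bits are printed. *)
Definition resources (p : program) := exists K c,
  [/\ K * c <= l * (N ^ 2 * b * L ^ 77),
    forall w j, K <= j -> halted p (run p inp w j),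
    forall w j, halted p (run p inp w j) -> output_solves i (output (run p inp w j)),
    forall w j, step_cost p inp (run p inp w j) <= c &
    forall w j, mem_bits (Defs.mem (run p inp w j)) <= N * b * L ^ 22].

Lemma resources_full : l = n -> resources (compile solver).
Proof.
move=> ln; have b0 := inst_bits_pos; have tb := target_bits; have lt := inst_l_le_t.
have mk : m = k by rewrite /m /k -/n -ln.
have N1 : N = 1 by rewrite /N mk binn.
have L2 : L = 2 by rewrite /L N1.
pose V := 2 ^ b + 4; pose w := b + 13.
have b2 : 2 <= 2 ^ b by rewrite -{1}[2]expn1 leq_exp2l.
have [] := @machine_run solver inp V 0 w (3 * n + 8) (output_solves i) fits_solver.
- by rewrite /V; lia.
- move=> [|[|[|j]]]; rewrite /V.
  + by rewrite /= -/n; lia.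
  + by rewrite /= -/l; lia.
  + by rewrite /= -/t; lia.
  + by have := weight_bits j; rewrite -[j.+3]/(3 + j); lia.
- have -> : 2 ^ w = 1024 * (2 ^ b * 8) by rewrite /w (expnD 2 b 13) (expnD 2 10 3) -[2 ^ 10]/1024 -[2 ^ 3]/8; lia.
  by rewrite leq_mul2l /V; lia.
- by rewrite /w; lia.
- by rewrite (@leq_trans (2 ^ 6)) // leq_exp2l // /w; lia.
- apply: (@wp_solver_full _ _ _ _ n t) => //; [by rewrite /V; lia|by rewrite /V; lia|].
  move=> s' E T; split=> //.
  case: vi => _ _ _ _ [x [cx mem_after]]; exists x => //.
  rewrite E; apply: (@eq_from_nth _ 0); first by rewrite size_nseq size_map size_tuple.
  move=> j; rewrite size_nseq => hj; rewrite nth_nseq hj (nth_map false) ?size_tuple //.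
  have /all_nthP H : all (pred1 true) x by rewrite all_count cx size_tuple -/l ln.
  by have /eqP -> := H false j ltac:(by rewrite size_tuple).
- move=> K [hK h1 h2 h3 h4]; exists K, (2 * w); split=> //.
    rewrite ln N1 L2 exp1n mul1n.
    apply: (@leq_trans (200 * (3 * n + 8) * (2 * w))); first by rewrite leq_mul2r hK orbT.
    have n0 : 0 < n by rewrite -ln hl; have := quarter_pos; lia.
    apply: (@leq_trans (n * (b * 2 ^ 16))); last first.
      by rewrite leq_mul2l; apply/orP; right; rewrite leq_mul2l leq_exp2l ?orbT.
    have -> : 2 ^ 16 = 256 * 256 by rewrite (expnD 2 8 8).
    apply: (@leq_trans (2200 * n * (28 * b))); first by apply: leq_mul; rewrite /w; lia.
    by lia.
  move=> w' j; apply: leq_trans (h4 w' j) _; rewrite N1 L2 mul1n muln0 addn0.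
  apply: (@leq_trans (b * 2 ^ 11)); last by rewrite leq_mul2l leq_exp2l ?orbT.
  have -> : 2 ^ 11 = 48 * 28 + 704 by [].
  by rewrite /w; lia.
Qed.

Lemma resources_search : l <> n -> resources (compile solver).
Proof.
move=> ln; have b0 := inst_bits_pos; have tb := target_bits; have lt := inst_l_le_t; have k0 := quarter_pos.
have lelt := inst_l_le_n.
have km : k < m by lia.
have [Y [Sl St]] := solution_fun.
have mN : m <= N by apply: bin_ratio_ge; rewrite k0.
have N1 : 1 < N by lia.
have cY : count Y (iota 0 n) = l.
  rewrite -sum1_count big_mkcond /= -[RHS]Sl /index_iota subn0.
  by apply: eq_bigr => j _; case: (Y j).
pose z := minn l (n - l).
have [q0 [q1 q2 q3]] : exists q, [/\ 0 < q, q <= modulus_bound n z & separates q Y n \/ separates q (predC Y) n].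
  rewrite /modulus_bound /z; case: (leqP l (n - l)) => h.
    by have [q [h1 h2 h3]] := separating_modulus n Y; exists q; rewrite -cY; split=> //; left.
  have [q [h1 h2 h3]] := separating_modulus n (predC Y); exists q.
  have cC : count (predC Y) (iota 0 n) = n - l.
    by have := count_predC Y (iota 0 n); rewrite size_iota cY; lia.
  by rewrite -cC; split=> //; right.
set Qm := modulus_bound n z in q2.
have hQ : Qm <= L ^ 10 by apply: modulus_bound_le hn hl k0 km _.
have tl := search_time_le hn k0 km hQ.
have L1 : 1 < L by [].
(* [V] exceeds all numbers that occur, and [w] is a word length for it *)
pose V := 4 * n.+1 * 2 ^ b + 2 * N + Qm + n + 20.
pose Lam := 2 * N + n + 5.
have [T ET] : {T | T = trunc_log 2 N} by eexists.
have NT : N < 2 ^ T.+1 by rewrite ET; apply: trunc_log_ltn.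
have LT : L = T.+2 by rewrite /L /log_factor ET.
have N2L : N <= 2 ^ L by rewrite LT expnS; lia.
have L2L : L < 2 ^ L by apply: ltn_expl.
have b2 : 2 <= 2 ^ b by rewrite -{1}[2]expn1 leq_exp2l.
have tb2 := total_bits.
pose w := b + 12 * L + 10.
have hV : 1024 * V <= 2 ^ w.
  have -> : 2 ^ w = 1024 * (2 ^ b * 2 ^ (12 * L)) by rewrite /w !expnD -[2 ^ 10]/1024; lia.
  rewrite leq_mul2l /=.
  apply: (@leq_trans (2 ^ b * (20 * N + 26 * N + L ^ 10))).
    rewrite /V; have h1 : 2 * N + Qm + n + 20 <= 2 ^ b * (26 * N + L ^ 10).
      by apply: (@leq_trans (1 * (26 * N + L ^ 10))); [lia|rewrite leq_mul2r; lia].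
    have h2 : 4 * n.+1 * 2 ^ b <= 2 ^ b * (20 * N) by rewrite mulnC leq_mul2l; lia.
    by rewrite -[20 * N + _ + _]addnA mulnDr; lia.
  rewrite leq_mul2l; apply/orP; right.
  have -> : 12 * L = L + (L * 10 + L) by lia.
  rewrite !expnD expnM.
  have h3 : L ^ 10 <= (2 ^ L) ^ 10 by rewrite leq_exp2r //; lia.
  have h4 : 64 <= (2 ^ L) ^ 10.
    by rewrite -expnM; apply: (@leq_trans (2 ^ 6)) => //; rewrite leq_exp2l //; lia.
  have h5 : 2 <= 2 ^ L by apply: ltn_trans L2L.
  apply: (@leq_trans (2 ^ L * (2 * (2 ^ L) ^ 10))); last first.
    by rewrite leq_mul2l [X in _ <= X]mulnC leq_mul2r h5 !orbT.
  apply: (@leq_trans (N * (2 * (2 ^ L) ^ 10))); last by rewrite leq_mul2r N2L orbT.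
  have h6 : N * 64 <= N * (2 ^ L) ^ 10 by rewrite leq_mul2l h4 orbT.
  have h7 : L ^ 10 <= N * (2 ^ L) ^ 10 by apply: leq_trans h3 _; rewrite leq_pmull //; lia.
  by lia.
have nV : n <= V by rewrite /V; lia.
have bV : 2 ^ b <= 4 * n.+1 * 2 ^ b by rewrite leq_pmull.
have tV x : x < 2 ^ b -> x < V by move=> h; apply: leq_trans h (leq_trans bV _); rewrite /V; clear; lia.
have [] := @machine_run solver inp V Lam w (N * N * L ^ 62) (output_solves i) fits_solver.
- by rewrite /V; lia.
- move=> [|[|[|j]]].
  + by rewrite /= -/n /V; lia.
  + by rewrite /= -/l /V; lia.
  + exact: tV.
  + exact/tV/weight_bits.
- exact: hV.
- by rewrite /w; lia.
- apply: leq_trans hV; rewrite /Lam /V.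
  have : 4 * n.+1 * 2 <= 4 * n.+1 * 2 ^ b by rewrite leq_mul2l b2 orbT.
  by lia.
- apply: (@wp_solver_search _ _ _ _ n l t m k q0 Qm Y (N * N * L ^ 62)) => //.
  + apply: (@leq_trans (4 * (n * 2 ^ b) + 5)); first by rewrite -addnS leq_add2r leq_mul2l tb2 orbT.
    have : 4 * (n * 2 ^ b) <= 4 * n.+1 * 2 ^ b by rewrite mulnA leq_mul2r leq_mul2l leqnSn !orbT.
    by rewrite /V; clear; lia.
  + by rewrite /V -/N; lia.
  + by rewrite /Lam -/N; lia.
  + by rewrite q1.
  + by rewrite /V; lia.
  + exact: tV.
  + by move=> s g T'; split=> //; apply: good_output.
- move=> K [hK h1 h2 h3 h4]; exists K, (2 * w).
  have wb : 2 * w <= b * L ^ 7.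
    have h5 : 2 ^ 6 <= L ^ 6 by apply: pow2_le.
    have -> : b * L ^ 7 = b * L * L ^ 6 by rewrite -mulnA -expnS.
    apply: (@leq_trans (b * L * 64)); last by rewrite leq_mul2l h5 orbT.
    have h6 : L <= b * L by rewrite leq_pmull.
    have h7 : b <= b * L by rewrite leq_pmulr //; lia.
    have aux x y u : u <= x -> y <= x -> 1 < u -> 2 * (y + 12 * u + 10) <= x * 64 by clear; lia.
    exact: aux.
  split=> //.
    have l0 : 0 < l by rewrite hl muln_gt0.
    apply: (@leq_trans (N ^ 2 * b * L ^ 77)); last by rewrite leq_pmull.
    apply: (@leq_trans (200 * (N * N * L ^ 62) * (b * L ^ 7))); first by apply: leq_mul.
    have -> : 200 * (N * N * L ^ 62) * (b * L ^ 7) = N ^ 2 * b * (L ^ 69 * 200).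
      by rewrite (expnD L 62 7) -mulnn; lia.
    rewrite leq_mul2l; apply/orP; right; rewrite (expnD L 69 8) leq_mul2l; apply/orP; right.
    by apply: leq_trans (pow2_le 8 L1).
  move=> w' j; apply: leq_trans (h4 w' j) _.
  have hA : 48 + 16 * Lam <= N * L ^ 8.
    have aux x y : y <= x -> 0 < x -> 48 + 16 * (2 * x + 4 * y + 5) <= x * 256 by clear; lia.
    apply: (@leq_trans (N * 2 ^ 8)); first by rewrite /Lam hn; apply: aux => //; apply: ltnW.
    by rewrite leq_mul2l pow2_le ?orbT.
  apply: (@leq_trans (N * L ^ 8 * (b * L ^ 7))); first by apply: leq_mul.
  have -> : N * L ^ 8 * (b * L ^ 7) = N * b * L ^ 15 by rewrite (expnD L 8 7); lia.
  by rewrite leq_mul2l leq_exp2l ?orbT.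
Qed.

Lemma solver_resources : resources (compile solver).
Proof. by case: (eqVneq l n) => [/resources_full|/eqP/resources_search]. Qed.

End Instance.

(** * From natural numbers to the resource classes *)

(** With [m = n / 4] and [k = l / 4], two doublings lead from ['C(m, k)] to ['C(n, l)];
    they lose [4 k + 1] and the square of [2 k + 1], each factor at most [n ^ 2]. *)
Lemma tradeoff_curve : eq_up_to_poly
  (fun n l => 'C(n %/ 4, l %/ 4) ^ 2 * 'C(n %/ 4, l %/ 4) ^ 2)%N (fun n l => 'C(n, l)).
Proof.
exists 6, 2 => n l n2 /dvdnP[m E] /dvdnP[k ->]; rewrite {}E in n2 * => ln; rewrite !mulnK //.
have E4 x : (x * 4 = x.*2.*2)%N by lia.
set C := 'C(m, k); set D := 'C(m.*2, k.*2).
have h1 : (C ^ 2 <= D)%N := bin_half_sq_ge m k.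
have h2 : (D <= (k.*2).+1 * C ^ 2)%N := bin_half_sq m k.
have h3 : (D ^ 2 <= 'C(m * 4, k * 4))%N by rewrite !E4; apply: bin_half_sq_ge.
have h4 : ('C(m * 4, k * 4) <= (k * 4).+1 * D ^ 2)%N by rewrite !E4; apply: bin_half_sq.
have n0 e : (0 < (m * 4) ^ e)%N by rewrite expn_gt0 (ltnW n2).
split.
  rewrite (@leq_trans (D ^ 2)) ?(leq_trans h3) ?leq_pmull // -mulnn.
  exact: leq_mul.
apply: leq_trans h4 _.
have s : ((k * 4).+1 <= (m * 4) ^ 2)%N.
  by apply: (@leq_trans (2 * (m * 4))); [lia|rewrite -mulnn leq_mul].
have s' : ((k.*2).+1 <= (m * 4) ^ 2)%N by apply: leq_trans s; lia.
have -> : ((m * 4) ^ 6 = (m * 4) ^ 2 * ((m * 4) ^ 2 * (m * 4) ^ 2))%N.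
  by rewrite -!expnD.
rewrite -(mulnA ((m * 4) ^ 2)%N); apply: leq_mul => //.
rewrite mulnACA -mulnn; apply: leq_mul; apply: (leq_trans h2); exact: leq_mul.
Qed.

Lemma bin_le_exp2 n k : ('C(n, k) <= 2 ^ n)%N.
Proof.
elim: n k => [|n IH] [|k]; rewrite ?bin0 ?bin0n ?expn_gt0 // binS expnS.
by have := IH k; have := IH k.+1; lia.
Qed.

Local Open Scope ring_scope.

Section Resources.
Variables (R : realType) (p : program) (i : instance).
Hypothesis rp : resources i p.
Let n := inst_n i. Let l := inst_l i.
Let N := 'C(n %/ 4, l %/ 4).
Let b := inst_bits i.

Lemma bit_ops_le w : (bit_ops R p i w <= (l * (N ^ 2 * b * log_factor N ^ 77))%N%:R%:E)%E.
Proof.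
have [K [c [hK h1 _ h3 _]]] := rp.
apply: lime_le; first by apply: is_cvg_nneseries => j _ _; rewrite lee_fin.
apply: nearW => M; rewrite sumEFin lee_fin -natr_sum ler_nat.
(* the machine has halted after [K] steps and costs nothing from then on *)
apply: leq_trans hK; rewrite -[K in (K * _)%N]subn0 -sum_nat_const_nat.
rewrite big_mkord [X in (_ <= X)%N]big_mkord.
case: (leqP M K) => h.
  rewrite (big_ord_widen _ (fun j => step_cost p (inst_input i) (run p (inst_input i) w j)) h).
  by rewrite big_mkcond /=; apply: leq_sum => j _; case: ifP.
rewrite -(big_mkord xpredT (fun j => step_cost p (inst_input i) (run p (inst_input i) w j))).
rewrite (@big_cat_nat _ _ _ K) ?(ltnW h) //= [X in (_ + X)%N]big_nat [X in (_ + X)%N]big1.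
  by rewrite addn0 big_mkord; apply: leq_sum.
by move=> j /andP[Kj _]; rewrite /step_cost h1.
Qed.

Lemma space_bits_le : (space_bits R p i <= (N * b * log_factor N ^ 22)%N%:R%:E)%E.
Proof.
have [K [c [_ _ _ _ h4]]] := rp.
by apply: ge_ereal_sup => _ [[w j] _ <-] /=; rewrite lee_fin ler_nat.
Qed.

(** The integrand is constant because the coins do not influence the run. *)
Lemma expected_time_le d (Omega : measurableType d) (P : probability Omega R) coin :
  deterministic p ->
  (expected_time P coin p i <= (l * (N ^ 2 * b * log_factor N ^ 77))%N%:R%:E)%E.
Proof.
move=> dp; have <- : bit_ops R p i (fun=> false) = expected_time P coin p i.
  rewrite /expected_time (eq_integral (cst (bit_ops R p i (fun=> false)))).
    by rewrite integral_cst // -[LHS]mule1 -(probability_setT P).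
  move=> w _ /=; rewrite /bit_ops; apply: congr_lim; apply/funext => M.
  by apply: eq_bigr => j _; rewrite !det_run.
exact: bit_ops_le.
Qed.

End Resources.

Section Log.
Variable R : realType.

Lemma le_log2 (x : R) e : 2 ^+ e <= x -> e%:R <= log2 x.
Proof.
move=> h; have x0 : 0 < x by apply: lt_le_trans h; rewrite exprn_gt0.
have l2 : 0 < ln (2 : R) by rewrite ln_gt0 // ltr1n.
by rewrite /log2 ler_pdivlMr // mulr_natl -lnXn // ler_ln // posrE exprn_gt0.
Qed.

(** With [x = log2 (3 + g)] one has [2 <= x] and [trunc_log 2 N <= x], so
    [log_factor N <= x + 2 <= x ^ 2]. *)
Lemma log_factor_log2 N e (g : R) : (0 < N)%N -> N%:R <= g ->
  (log_factor N ^ e)%N%:R <= log2 (3 + g) ^+ e.*2.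
Proof.
move=> N0 Ng; have N1 : 1 <= N%:R :> R by rewrite ler1n.
have h2 : 2 <= log2 (3 + g) by apply: (le_log2 (e := 2)); rewrite expr2; lra.
have h1 : (trunc_log 2 N)%:R <= log2 (3 + g).
  apply: le_log2; rewrite -natrX; apply: (@le_trans _ _ N%:R); last by lra.
  by rewrite ler_nat trunc_logP.
rewrite -mul2n exprM natrX; apply: lerXn2r; rewrite ?nnegrE ?sqr_ge0 //.
by rewrite /log_factor -addn2 natrD expr2; nra.
Qed.

End Log.

Section Classes.
Variable R : realType.
Let N (i : instance) := 'C(inst_n i %/ 4, inst_l i %/ 4).
Variables (f : instance -> \bar R) (A : instance -> nat) (e : nat).
Hypothesis fA : forall i, valid_instance i ->
  (f i <= (A i * log_factor (N i) ^ e)%N%:R%:E)%E.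

Lemma bin_pos i : valid_instance i -> (0 < N i)%N.
Proof. by move=> vi; rewrite bin_gt0 leq_div2r // inst_l_le_n. Qed.

Lemma softO_log_factor (g : instance -> R) :
  (forall i, valid_instance i -> (N i <= A i)%N /\ (A i)%:R <= g i) -> softO f g.
Proof.
move=> hg; exists e.*2, 0%N => i vi _; apply: le_trans (fA vi) _.
have [NA Ag] := hg i vi; rewrite lee_fin natrM; apply: ler_pM => //.
by apply: log_factor_log2; rewrite ?bin_pos // (le_trans _ Ag) // ler_nat.
Qed.

(** Since [N <= 2 ^ m], the logarithmic overhead is also polynomial in [n]. *)
Lemma log_factor_le i : valid_instance i -> (log_factor (N i) <= inst_n i)%N.
Proof.
move=> vi; have k0 := quarter_pos vi; have ln := inst_l_le_n vi.
have m0 : (0 < inst_n i %/ 4)%N by apply: leq_trans k0 _; apply: leq_div2r.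
have h : (trunc_log 2 (N i) <= inst_n i %/ 4)%N.
  rewrite -[leqRHS](@trunc_expnK 2) //; apply: leq_trunc_log; exact: bin_le_exp2.
by have := leq_trunc_div (inst_n i) 4; rewrite /log_factor; lia.
Qed.

Lemma exponential_log_factor d (E : nat -> nat -> nat) :
  (forall i, valid_instance i ->
     (A i <= (inst_n i * inst_bits i) ^ d * E (inst_n i) (inst_l i))%N) ->
  exponential_term f E.
Proof.
move=> hA; exists (d + e)%N, 0%N => i vi _; apply: le_trans (fA vi) _.
rewrite lee_fin ler_nat expnD mulnAC; apply: leq_mul; first exact: hA.
case: (posnP e) => [->|e0]; first by rewrite !expn0.
by rewrite leq_exp2r // (leq_trans (log_factor_le vi)) // leq_pmulr // inst_bits_pos.
Qed.

End Classes.

Section Combine.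
Variables (R : realType) (p : program).
Hypothesis rp : forall i, valid_instance i -> resources i p.
Let expS n l := 'C(n %/ 4, l %/ 4).
Let expT n l := ('C(n %/ 4, l %/ 4) ^ 2)%N.
Let boundS i : R := (expS (inst_n i) (inst_l i))%:R * (inst_bits i)%:R.
Let boundT i : R := (expT (inst_n i) (inst_l i))%:R * (inst_bits i)%:R.

Lemma halts i : valid_instance i ->
  correct_on_halt p i /\ forall w, exists k, halted p (run p (inst_input i) w k).
Proof.
move=> /rp[K [c [_ h1 h2 _ _]]]; split; first by move=> w k; apply: h2.
by move=> w; exists K; apply: h1.
Qed.

Lemma space_class : softO (space_bits R p) boundS /\ exponential_term (space_bits R p) expS.
Proof.
have h i (vi : valid_instance i) := space_bits_le R (rp vi).
split.
  apply: (softO_log_factor h) => i vi; rewrite leq_pmulr ?inst_bits_pos //; split=> //.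
  by rewrite natrM.
apply: (exponential_log_factor (d := 1) h) => i vi; rewrite expn1 mulnC leq_mul2r leq_pmull ?orbT //.
by apply: leq_trans (inst_l_le_n vi); apply: leq_trans (leq_div _ 4); apply: quarter_pos.
Qed.

Lemma time_class f (h : instance -> R) :
  (forall i, valid_instance i -> (f i <= (inst_l i *
    (expT (inst_n i) (inst_l i) * inst_bits i * log_factor (expS (inst_n i) (inst_l i)) ^ 77))%N%:R%:E)%E) ->
  (forall i, valid_instance i -> (inst_l i)%:R <= h i) ->
  softO f (fun i => h i * boundT i) /\ exponential_term f expT.
Proof.
move=> hf hh; have l0 i : valid_instance i -> (0 < inst_l i)%N.
  by move=> vi; apply: leq_trans (leq_div _ 4); apply: quarter_pos.
pose A i := (inst_l i * (expT (inst_n i) (inst_l i) * inst_bits i))%N.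
have hA i : valid_instance i -> (f i <= (A i * log_factor (expS (inst_n i) (inst_l i)) ^ 77)%N%:R%:E)%E.
  by rewrite /A -mulnA; apply: hf.
split.
  apply: (softO_log_factor hA) => i vi; split; last first.
    by rewrite /A /boundT 2!natrM ler_wpM2r ?hh ?mulr_ge0.
  rewrite /A /expT -mulnn -!mulnA mulnCA leq_pmulr // !muln_gt0 l0 // inst_bits_pos //.
  by rewrite bin_pos.
apply: (exponential_log_factor (d := 1) hA) => i vi.
by rewrite expn1 /A mulnA mulnAC leq_mul2r leq_mul2r (inst_l_le_n vi) !orbT.
Qed.

End Combine.

Lemma natr_le_powR (R : realType) l : l%:R <= l%:R `^ (3 / 2) :> R.
Proof.
case: l => [|l]; first by rewrite powR_ge0.
rewrite -[leLHS]powRr1 ?ler0n //; apply: ler_powR; first by rewrite ler1n.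
by lra.
Qed.

Theorem theorem2p2 (R : realType) :
  let expS := fun n l : nat => 'C(n %/ 4, l %/ 4)%N in
  let expT := fun n l : nat => ('C(n %/ 4, l %/ 4) ^ 2)%N in
  let boundS := fun i : instance =>
    (expS (inst_n i) (inst_l i))%:R * (inst_bits i)%:R : R in
  let boundT := fun i : instance =>
    (expT (inst_n i) (inst_l i))%:R * (inst_bits i)%:R : R in
  [/\ eq_up_to_poly (fun n l => expT n l * expS n l ^ 2)%N (fun n l => 'C(n, l)%N),
      (exists p : program,
        [/\ deterministic p,
            (forall i, valid_instance i ->
               correct_on_halt p i /\
               exists k, halted p (run p (inst_input i) (fun=> false) k)),
            softO (det_time R p) (fun i => (inst_n i)%:R ^+ 3 * boundT i) /\
            exponential_term (det_time R p) expT &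
            softO (space_bits R p) boundS /\
            exponential_term (space_bits R p) expS]) &
      (exists p : program,
        (forall i, valid_instance i -> correct_on_halt p i) /\
        (softO (space_bits R p) boundS /\ exponential_term (space_bits R p) expS) /\
        forall (d : measure_display) (Omega : measurableType d)
               (P : probability Omega R) (coin : nat -> Omega -> bool),
          fair_coins P coin ->
          [/\ (forall i, valid_instance i ->
                 {ae P, forall w, exists k,
                    halted p (run p (inst_input i) (coin^~ w) k)}),
              softO (expected_time P coin p)
                    (fun i => (inst_l i)%:R `^ (3 / 2) * boundT i) &
              exponential_term (expected_time P coin p) expT])].
Proof.
move=> expS expT boundS boundT.
have [p dp rp] : exists2 p, deterministic p & forall i, valid_instance i -> resources i p.
  by exists (compile solver) => [|i]; [apply: deterministic_comp|apply: solver_resources].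
split; first exact: tradeoff_curve.
  exists p; split=> //.
  - by move=> i /(halts rp)[? h]; split.
  - apply: time_class => i vi; first exact: (bit_ops_le R (rp i vi)).
    rewrite -natrX ler_nat; apply: leq_trans (inst_l_le_n vi) _.
    by case: (inst_n i) => // n; rewrite -{1}[n.+1]expn1 leq_pexp2l.
  - exact: space_class.
exists p; split; first by move=> i /(halts rp)[].
split; first exact: space_class.
move=> d Omega P coin _.
have [h1 h2] := time_class (fun i vi => expected_time_le (rp i vi) P coin dp)
  (fun i _ => natr_le_powR R (inst_l i)).
split=> // i /(halts rp)[_ h]; exact: aeW.
Qed.
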